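(* Let $(\Omega,u)$ be a solution to the overdetermined problem $$\begin{cases}\Delta u=-2 & \text{in } \Omega,\\ u=a,\ \ \dfrac{\partial u}{\partial\nu}=\alpha & \text{on } \Gamma_i,\\ u=b,\ \ \dfrac{\partial u}{\partial\nu}=\beta & \text{on } \Gamma_o,\end{cases}$$ where $a,b,\alpha,\beta\in\mathbb{R}$ are constants, such that $a<b$ and $a<u<b$ in $\Omega$. Then $\Omega$ is an annulus and $u$ is rotationally symmetric with $\partial u/\partial|x|>0$ in $\Omega$.
   Context: Setting: $E_i\Subset E_o\subset\mathbb{R}^2$ are two nonempty simply connected bounded domains whose boundaries $\partial E_o=\Gamma_o$ and $\partial E_i=\Gamma_i$ are simple closed smooth curves, and $\Omega=E_o\setminus\overline{E_i}$, so that $\partial\Omega=\Gamma_i\sqcup\Gamma_o$. The function $u$ is smooth up to the boundary of $\Omega$, and $\nu$ is the unit normal to $\partial\Omega$ pointing outside $\Omega$. Rotational symmetry is understood with respect to the center of the annulus: there are a point $x_0\in\mathbb{R}^2$ and radii $0<\rho_i<\rho_o$ such that $\Omega=\{\rho_i<|x-x_0|<\rho_o\}$ and $u$ depends only on $|x-x_0|$; the derivative $\partial u/\partial|x|$ is the derivative in the radial direction, the origin being placed at $x_0$. *)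

(* Defs.v *)
From mathcomp Require Export all_boot all_order all_algebra.
From mathcomp Require Export all_classical all_reals all_analysis.
Export Order.TTheory GRing.Theory Num.Theory.
Export numFieldNormedType.Exports.

Set Implicit Arguments.
Unset Strict Implicit.
Unset Printing Implicit Defensive.

Local Open Scope classical_set_scope.
Local Open Scope ring_scope.

Notation plane R := 'rV[R]_2.

(* The library norm `|x| on row vectors is the sup norm: it is used only for
   topological notions, and Euclidean lengths are written with enorm. *)
Definition dotp (R : realType) (x y : plane R) : R :=
  \sum_(i < 2) x ord0 i * y ord0 i.

Definition enorm (R : realType) (x : plane R) : R := Num.sqrt (dotp x x).

Definition boundary (T : topologicalType) (A : set T) : set T :=
  closure A `\` interior A.

Definition compactly_contained (T : topologicalType) (A B : set T) : Prop :=
  compact (closure A) /\ closure A `<=` B.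

Definition domain (R : realType) (E : set (plane R)) : Prop :=
  [/\ E !=set0, open E & connected E].

(* Every loop in E contracts to its base point inside E.  Connectedness is the
   same as path-connectedness for the open sets this is applied to. *)
Definition simply_connected (R : realType) (E : set (plane R)) : Prop :=
  connected E /\
  forall c : R -> plane R,
    {within `[0, 1], continuous c} ->
    (forall t, t \in `[0, 1] -> E (c t)) ->
    c 0 = c 1 ->
    exists h : R * R -> plane R,
      [/\ {within `[0, 1] `*` `[0, 1], continuous h},
          forall s t, s \in `[0, 1] -> t \in `[0, 1] -> E (h (s, t)),
          forall t, t \in `[0, 1] -> h (0, t) = c t,
          forall t, t \in `[0, 1] -> h (1, t) = c 0 &
          forall s, s \in `[0, 1] -> h (s, 0) = c 0 /\ h (s, 1) = c 0].

(* Regular (nowhere vanishing velocity) C^oo parametrization of period 1. *)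
Definition simple_closed_smooth_curve (R : realType) (S : set (plane R)) :
    Prop :=
  exists c : R -> plane R,
    [/\ forall (n : nat) (t : R), derivable (derive1n n c) t 1,
        forall t, derive1 c t != 0,
        forall t, c (t + 1) = c t,
        {in `[0, 1[ &, injective c} &
        range c = S].

Definition pderiv (R : realType) (i : 'I_2) (f : plane R -> R) : plane R -> R :=
  fun x => 'D_(delta_mx ord0 i) f x.

(* The mixed partial derivative along a list of coordinate directions. *)
Definition iter_pderiv (R : realType) (s : seq 'I_2) (f : plane R -> R) :
    plane R -> R :=
  foldr (@pderiv R) f s.

Definition laplacian (R : realType) (f : plane R -> R) : plane R -> R :=
  fun x => \sum_(i < 2) iter_pderiv [:: i; i] f x.

(* u is C^oo on the closure of the open set Om, in the usual sense: all partial
   derivatives of all orders exist in Om and extend continuously to the closure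
   of Om, u itself being its own extension.  The values of u outside the closure
   are irrelevant. *)
Definition smooth_up_to_boundary (R : realType) (Om : set (plane R))
    (u : plane R -> R) : Prop :=
  {within closure Om, continuous u} /\
  forall s : seq 'I_2,
    (forall (i : 'I_2) x, Om x ->
       derivable (iter_pderiv s u) x (delta_mx ord0 i)) /\
    exists g : plane R -> R,
      {within closure Om, continuous g} /\
      forall x, Om x -> g x = iter_pderiv s u x.

Definition tangent_vector (R : realType) (S : set (plane R)) (x v : plane R) :
    Prop :=
  exists c : R -> plane R,
    [/\ c 0 = x, forall t, S (c t) & is_derive (0 : R) (1 : R) c v].

Definition outer_unit_normal (R : realType) (Om : set (plane R))
    (x nu : plane R) : Prop :=
  [/\ enorm nu = 1,
      forall v, tangent_vector (boundary Om) x v -> dotp nu v = 0 &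
      \forall t \near 0^'+, ~ Om (x + t *: nu)].

(* Since u is only meaningful on the closure of the domain, the derivative at a
   boundary point x along the outer normal nu is the one-sided limit of the
   difference quotient taken from inside. *)
Definition normal_derivative_is (R : realType) (u : plane R -> R)
    (x nu : plane R) (d : R) : Prop :=
  (u x - u (x - t *: nu)) / t @[t --> (0 : R)^'+] --> d.

Definition annulus (R : realType) (x0 : plane R) (ri ro : R) : set (plane R) :=
  [set x | ri < enorm (x - x0) < ro].

Definition radial_derivative (R : realType) (x0 : plane R) (u : plane R -> R)
    (x : plane R) : R :=
  'D_((enorm (x - x0))^-1 *: (x - x0)) u x.

(* Main.v *)
Require Import Defs.
From mathcomp Require Import ring lra.

(** The proof is a moving plane argument.  Let [v] be [b - u] on the closure of
    [Om], [b - a] on the closure of [Ei] and [0] outside [Eo], and let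
    [M = b - a].  Then [v] is continuous on the whole plane with [0 <= v <= M],
    the open set [Om] is exactly [0 < v < M], the Laplacian of [v] is [2] there,
    and along each of the two boundary curves the gradient of [v] is a constant
    multiple of the normal.  These facts are collected in the record [solution].
    The aim is that [v] is a nonincreasing function of the distance to some
    point: then [M <= v] is a closed disc, [0 < v] is an open disc, and [Om] lies
    between two concentric circles.

    Fix a unit vector [e].  For a line of equation [dotp y e = l], let
    [wdiff v e l y] be [v] at the mirror image of [y] minus [v y], and let
    [mono v e l] say that it is nonnegative on the side [l < dotp y e].  This
    holds for large [l] because [v] has bounded support; let [l] be the critical
    value, the infimum of the values beyond which it always holds.  The function
    [wdiff] is harmonic wherever [y] and its image both lie in [Om], so by the
    strong minimum principle and the connectedness of [Om] either [v] is
    symmetric in the critical line, or [wdiff] is positive at all such points of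
    the open half plane ([sym_of_zero]).  In the second case every point [x] is
    stable: the inequality [v y <= v (refl e l' y)] persists for [y] near [x] and
    [l'] near [l] ([stable_everywhere]).  By compactness the line can then be
    pushed further, against the choice of [l]; hence [v] is symmetric ([sweep]).

    Only the points with [wdiff v e l x = 0] need an argument for stability.
    - If [x] is in [Om], it is on the line, and the Hopf lemma makes [v] strictly
      decreasing along [e] near [x] ([hopf_line]).
    - If [v x = 0] and [x] is off the line, [x] and its image are boundary points
      of the same level.  Their normals correspond to each other and their normal
      derivatives agree, which the Hopf lemma forbids ([no_tangency]).
    - If [v x = 0] and [x] is on the line, the normal [n] satisfies
      [0 <= dotp n e].  When [dotp n e = 0], the function [wdiff] vanishes to
      second order at [x], whereas a barrier in a half disc forces quadratic
      growth ([corner]).  When [0 < dotp n e], [v] decreases along [e] near [x];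
      if the gradient vanishes at [x], this is read off the Hessian, whose only
      nonzero entry is then the second normal derivative ([descends_near]).
    - If [v x = M], the three cases apply to [M - v], with [- e] and the image
      of [x] in place of [e] and [x].  This exchanges the two boundary curves and
      preserves [solution] ([solution_dual]).

    Symmetry in every direction gives the conclusion ([radial_symmetry]): two
    orthogonal axes define a center, and an axis missing it would make [v]
    periodic.

    The rest is preparation.  All barriers are explicit polynomials.  Boundary
    values of gradients and Hessians enter through first order expansions at
    boundary points, obtained from the mean value theorem on three segments
    inside the domain ([boundary_derivative]).  On the topological side, each
    curve is locally the graph of a function ([curve_graph]), [Om] is on one side
    of it ([Om_chart]), and [Om] is connected because by the maximum principle each of
    its components reaches the inner curve, along which [Om] belongs to a single
    component ([Om_connected]). *)

Set Implicit Arguments.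
Unset Strict Implicit.
Unset Printing Implicit Defensive.

Local Open Scope classical_set_scope.
Local Open Scope ring_scope.

(** * The Euclidean plane *)

(** The linear arithmetic procedures read every inequality of the context,
    at a cost that grows quickly; this keeps only those moved to the goal. *)
Ltac clear_ineqs := repeat match goal with H : is_true (_ <= _) |- _ => clear H
  | H : is_true (_ < _) |- _ => clear H end.

Lemma quarter_lt (R : realType) (d : R) : 0 < d -> d / 4 < d. Proof. by move=> ?; lra. Qed.
Lemma norm_small_eq0 (R : realType) (a : R) : (forall eps, 0 < eps -> `|a| <= eps) -> a = 0.
Proof.
move=> h; apply/eqP; rewrite -normr_eq0; apply/eqP/le_anti; rewrite normr_ge0 andbT.
by apply/ler_addgt0Pl => eps e0; rewrite addr0 h.
Qed.
Lemma half_gt0 (R : realType) : 0 < (1 / 2 : R). Proof. by lra. Qed.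

Lemma min2 (R : realType) (a b : R) : 0 < a -> 0 < b ->
  exists2 c, 0 < c & c < a /\ c < b.
Proof.
move=> a0 b0; exists (Num.min a b / 2); first by rewrite divr_gt0// lt_min a0.
have : Num.min a b <= a by rewrite ge_min lexx.
have : Num.min a b <= b by rewrite ge_min lexx orbT.
have : 0 < Num.min a b by rewrite lt_min a0.
by move=> *; split; lra.
Qed.

Section PlaneGeometry.
Context {R : realType}.
Implicit Types (x y z p q e n : plane R) (a b r s t l : R).

Definition perp x : plane R := \row_i (if i == 0 then - x ord0 1 else x ord0 0).

Lemma planeP x y : x ord0 0 = y ord0 0 -> x ord0 1 = y ord0 1 -> x = y.
Proof.
move=> h0 h1; apply/rowP => -[[|[|//]] i].
- by rewrite (_ : Ordinal i = 0) //; apply/val_inj.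
- by rewrite (_ : Ordinal i = 1) //; apply/val_inj.
Qed.

Lemma dotpE x y : dotp x y = x ord0 0 * y ord0 0 + x ord0 1 * y ord0 1.
Proof. by rewrite /dotp big_ord_recl big_ord1; congr (_ + x _ _ * y _ _); apply/val_inj. Qed.

Lemma perp0E x : perp x ord0 0 = - x ord0 1. Proof. by rewrite mxE. Qed.
Lemma perp1E x : perp x ord0 1 = x ord0 0. Proof. by rewrite mxE. Qed.

Definition plE := (dotpE, perp0E, perp1E, mxE).

Lemma dotpC x y : dotp x y = dotp y x. Proof. by rewrite !plE; ring. Qed.
Lemma dotpDl x y z : dotp (x + y) z = dotp x z + dotp y z. Proof. by rewrite !plE; ring. Qed.
Lemma dotpDr x y z : dotp z (x + y) = dotp z x + dotp z y. Proof. by rewrite !plE; ring. Qed.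
Lemma dotpNl x z : dotp (- x) z = - dotp x z. Proof. by rewrite !plE; ring. Qed.
Lemma dotpNr x z : dotp z (- x) = - dotp z x. Proof. by rewrite !plE; ring. Qed.
Lemma dotpZl a x z : dotp (a *: x) z = a * dotp x z. Proof. by rewrite !plE; ring. Qed.
Lemma dotpZr a x z : dotp z (a *: x) = a * dotp z x. Proof. by rewrite !plE; ring. Qed.
Lemma dotp_perp x : dotp x (perp x) = 0. Proof. by rewrite !plE; ring. Qed.
Lemma dotp_perpl x : dotp (perp x) x = 0. Proof. by rewrite !plE; ring. Qed.
Lemma dotp_perp2 x y : dotp (perp x) (perp y) = dotp x y. Proof. by rewrite !plE; ring. Qed.
Definition dotpl := (dotpDl, dotpDr, dotpNl, dotpNr, dotpZl, dotpZr, dotp_perp, dotp_perpl, dotp_perp2).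

Lemma dotp_ge0 x : 0 <= dotp x x.
Proof. by rewrite dotpE; nra. Qed.

Lemma dotp_gt0 x : x != 0 -> 0 < dotp x x.
Proof.
move=> x0; rewrite lt_neqAle dotp_ge0 andbT; apply: contra x0 => /eqP; rewrite dotpE => h.
by apply/eqP/planeP; rewrite mxE; nra.
Qed.

Lemma enorm_ge0 x : 0 <= enorm x. Proof. exact: sqrtr_ge0. Qed.
Lemma enorm_sq x : enorm x ^+ 2 = dotp x x. Proof. by rewrite sqr_sqrtr// dotp_ge0. Qed.

Lemma enorm_lt x r : 0 < r -> (enorm x < r) = (dotp x x < r ^+ 2).
Proof. by move=> r0; rewrite -enorm_sq ltr_pXn2r// nnegrE ?enorm_ge0// ltW. Qed.
Lemma enorm_le x r : 0 <= r -> (enorm x <= r) = (dotp x x <= r ^+ 2).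
Proof. by move=> r0; rewrite -enorm_sq ler_pXn2r// nnegrE enorm_ge0. Qed.
Lemma enorm_gt x r : 0 <= r -> (r < enorm x) = (r ^+ 2 < dotp x x).
Proof. by move=> r0; rewrite -enorm_sq ltr_pXn2r// nnegrE enorm_ge0. Qed.

Lemma enorm_unit x : enorm x = 1 -> dotp x x = 1.
Proof. by move=> h; rewrite -enorm_sq h expr1n. Qed.
Lemma unit_enorm x : dotp x x = 1 -> enorm x = 1.
Proof. by move=> h; rewrite /enorm h sqrtr1. Qed.

Lemma dotp_le x y : `|dotp x y| <= enorm x * enorm y.
Proof.
rewrite -(@ler_pXn2r _ 2)// ?nnegrE ?mulr_ge0 ?enorm_ge0//.
rewrite exprMn !enorm_sq real_normK ?num_real// !dotpE.
have := sqr_ge0 (x ord0 0 * y ord0 1 - x ord0 1 * y ord0 0).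
by move=> h; rewrite -subr_ge0 (le_trans h)// le_eqVlt; apply/orP; left; apply/eqP; ring.
Qed.

Lemma dotp_le_unit x e : dotp e e = 1 -> `|dotp x e| <= enorm x.
Proof. by move=> /unit_enorm e1; rewrite (le_trans (dotp_le _ _))// e1 mulr1. Qed.

Lemma enormZ a x : enorm (a *: x) = `|a| * enorm x.
Proof. by rewrite /enorm dotpZl dotpZr mulrA -expr2 sqrtrM ?sqr_ge0// sqrtr_sqr. Qed.
Lemma enormN x : enorm (- x) = enorm x.
Proof. by rewrite /enorm dotpNl dotpNr opprK. Qed.
Lemma enorm0 : enorm (0 : plane R) = 0.
Proof. by rewrite -(scale0r 0) enormZ normr0 mul0r. Qed.
Lemma enormC x y : enorm (x - y) = enorm (y - x). Proof. by rewrite -enormN opprB. Qed.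
Lemma enorm_eq0 x : enorm x = 0 -> x = 0.
Proof.
move=> h; apply/eqP/negPn/negP => /dotp_gt0; rewrite -enorm_sq h; lra.
Qed.
Lemma enorm_gt0 x : x != 0 -> 0 < enorm x.
Proof. by move=> x0; rewrite sqrtr_gt0 dotp_gt0. Qed.

Lemma enormD x y : enorm (x + y) <= enorm x + enorm y.
Proof.
rewrite -(@ler_pXn2r _ 2)// ?nnegrE ?addr_ge0 ?enorm_ge0//.
rewrite sqrrD !enorm_sq dotpDl !dotpDr (dotpC y x).
have := dotp_le x y; have := ler_norm (dotp x y); lra.
Qed.
Lemma unit_direction x : x != 0 -> exists2 e, dotp e e = 1 & x = enorm x *: e.
Proof.
move=> /enorm_gt0 x0; exists ((enorm x)^-1 *: x).
  by rewrite dotpZl dotpZr -enorm_sq; field; exact: lt0r_neq0.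
by rewrite scalerA divff ?scale1r// lt0r_neq0.
Qed.
Lemma enorm_tri z x y : enorm (x - y) <= enorm (x - z) + enorm (z - y).
Proof. by rewrite (le_trans _ (enormD _ _))// addrA subrK. Qed.

Lemma enorm_sup x : enorm x <= 2 * `|x|.
Proof.
have h i : `|x ord0 i| <= `|x| by rewrite /Num.norm /= mx_normrE; apply: (le_bigmax _ _ (ord0, i)).
have h0 := h 0; have h1 := h 1; rewrite enorm_le ?mulr_ge0// dotpE.
move: h0 h1; rewrite !ler_norml; have := normr_ge0 x; nra.
Qed.
Lemma sup_enorm x : `|x| <= enorm x.
Proof.
rewrite {1}/Num.norm /= mx_normrE; apply/bigmax_leP; split; first exact: enorm_ge0.
move=> -[i j] _ /=; rewrite (ord1 i) {i} -(@ler_pXn2r _ 2)// ?nnegrE ?enorm_ge0//.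
rewrite enorm_sq real_normK ?num_real// dotpE.
case: j => -[|[|//]] j.
- by rewrite (_ : Ordinal j = 0) ?lerDl -?expr2 ?sqr_ge0 //; apply/val_inj.
- by rewrite (_ : Ordinal j = 1) ?lerDr -?expr2 ?sqr_ge0 //; apply/val_inj.
Qed.

(** The topology of the plane comes from the sup norm; this is the bridge to
    Euclidean discs, in terms of which all estimates are written. *)
Lemma nbhs_enorm p (A : set (plane R)) :
  nbhs p A <-> exists2 d : R, 0 < d & forall y, enorm (y - p) < d -> A y.
Proof.
split.
  move=> /(@nbhs_normP R (plane R) p A)[d /= d0 h]; exists d => // y yp; apply: h; rewrite /ball_ /= distrC.
  exact: le_lt_trans (sup_enorm _) yp.
move=> [d d0 h]; apply/(@nbhs_normP R (plane R) p A); exists (d / 2); rewrite /= ?divr_gt0// => y yp.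
apply: h; apply: (le_lt_trans (enorm_sup _)).
by move: yp; rewrite /ball_ /= distrC; lra.
Qed.

Lemma openE_enorm (A : set (plane R)) : open A -> forall p, A p ->
  exists2 d : R, 0 < d & forall y, enorm (y - p) < d -> A y.
Proof. by move=> oA p Ap; apply/nbhs_enorm/open_nbhs_nbhs. Qed.

Lemma enorm_open (A : set (plane R)) :
  (forall p, A p -> exists2 d : R, 0 < d & forall y, enorm (y - p) < d -> A y) -> open A.
Proof. by move=> h; rewrite openE => p /h ?; apply/nbhs_enorm. Qed.

Lemma closure_enorm (A : set (plane R)) p :
  closure A p <-> forall d, 0 < d -> exists2 y, A y & enorm (y - p) < d.
Proof.
split.
  move=> cA d d0; have [|y [Ay yp]] := cA [set y | enorm (y - p) < d]; first by apply/nbhs_enorm; exists d.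
  by exists y.
by move=> h B /nbhs_enorm[d d0 hB]; have [y Ay yp] := h d d0; exists y; split=> //; apply: hB.
Qed.

Lemma continuous_enorm (f : plane R -> R) p : {for p, continuous f} ->
  forall a, 0 < a -> exists2 d : R, 0 < d & forall y, enorm (y - p) < d -> `|f y - f p| < a.
Proof.
move=> cf a a0.
have /nbhs_enorm[d d0 h] : nbhs p (f @^-1` ball (f p) a) by exact: cf (nbhsx_ballx _ _ a0).
by exists d => // y /h; rewrite /ball /= distrC.
Qed.

Lemma enorm_continuous (f : plane R -> R) p :
  (forall a, 0 < a -> exists2 d : R, 0 < d & forall y, enorm (y - p) < d -> `|f y - f p| < a) ->
  {for p, continuous f}.
Proof.
move=> h B /nbhs_ballP[a /= a0 aB]; have [d d0 hd] := h a a0.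
apply/nbhs_enorm; exists d => // y /hd yd; apply: aB.
by rewrite /ball /= distrC.
Qed.

Lemma within_enorm (A : set (plane R)) (f : plane R -> R) p : {within A, continuous f} -> A p ->
  forall a, 0 < a -> exists2 d : R, 0 < d & forall y, A y -> enorm (y - p) < d -> `|f y - f p| < a.
Proof.
move=> cf Ap a a0; move/subspace_continuousP: cf => /(_ p Ap) cf.
have : nbhs p (fun y => A y -> ball (f p) a (f y)) by exact: cf (nbhsx_ballx _ _ a0).
move=> /nbhs_enorm[d d0 h].
by exists d => // y Ay /h /(_ Ay); rewrite /ball /= distrC.
Qed.

Lemma enorm_within (A : set (plane R)) (f : plane R -> R) :
  (forall p, A p -> forall a, 0 < a ->
    exists2 d : R, 0 < d & forall y, A y -> enorm (y - p) < d -> `|f y - f p| < a) ->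
  {within A, continuous f}.
Proof.
move=> h; apply/subspace_continuousP => p Ap B /nbhs_ballP[a /= a0 aB].
have [d d0 hd] := h p Ap a a0.
suff : nbhs p (fun y => A y -> B (f y)) by [].
apply/nbhs_enorm; exists d => // y yp Ay; apply: aB.
by rewrite /ball /= distrC; exact: hd.
Qed.

Lemma frameE e x : dotp e e = 1 -> x = dotp x e *: e + dotp x (perp e) *: perp e.
Proof.
by move=> e1; apply/planeP; rewrite !plE; move: e1; rewrite dotpE => e1;
  [rewrite -[LHS]mulr1 -e1|rewrite -[LHS]mulr1 -e1]; ring.
Qed.
Lemma dotp_frame e x y : dotp e e = 1 ->
  dotp x y = dotp x e * dotp y e + dotp x (perp e) * dotp y (perp e).
Proof.
by move=> e1; rewrite !plE; move: e1; rewrite dotpE => e1; rewrite -[LHS]mulr1 -e1; ring.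
Qed.
End PlaneGeometry.

(** * Second derivatives and the weak minimum principle *)

Section Calc.
Context {R : realType}.

(** Without a quotient the estimate also covers [t = 0] and stays linear in
    [f], so that such estimates combine by linear arithmetic. *)
Lemma is_deriveP (V : normedModType R) (f : V -> R) (x v : V) (a : R) :
  is_derive x v f a <-> forall eps, 0 < eps -> exists2 d : R, 0 < d &
    forall t, `|t| < d -> `|f (x + t *: v) - f x - a * t| <= eps * `|t|.
Proof.
split.
  move=> [df <-] e e0.
  have /cvgrPdist_le /(_ e e0) : (fun h => h^-1 *: ((f \o shift x) (h *: v) - f x)) @ 0^' --> 'D_v f x.
    exact: df.
  rewrite near_withinE => /nbhs_ballP[d /= d0 h]; exists d => // t td.
  have [->|t0] := eqVneq t 0; first by rewrite scale0r addr0 subrr mulr0 subr0 normr0 mulr0.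
  have := h t; rewrite /ball /= sub0r normrN td => /(_ isT t0).
  rewrite distrC -(@ler_pM2r _ `|t|) ?normr_gt0// -normrM /= (addrC _ x).
  by rewrite mulrBl /GRing.scale /= mulrAC mulVf// mul1r.
move=> h.
have H : (fun h => h^-1 *: ((f \o shift x) (h *: v) - f x)) @ 0^' --> a.
  apply/cvgrPdist_le => e e0; rewrite near_withinE; have [d d0 hd] := h e e0.
  apply/nbhs_ballP; exists d => //= t; rewrite /ball /= sub0r normrN => td t0.
  rewrite distrC -(@ler_pM2r _ `|t|) ?normr_gt0// -normrM /= (addrC _ x).
  by rewrite mulrBl /GRing.scale /= mulrAC mulVf// mul1r; exact: hd.
apply: DeriveDef; first by apply: cvgP H.
exact: cvg_lim H.
Qed.

Lemma is_derive_uniq (V : normedModType R) (f : V -> R) (x v : V) (a b : R) :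
  is_derive x v f a -> is_derive x v f b -> a = b.
Proof. by move=> [_ <-] [_ <-]. Qed.

Lemma is_derive_line (f : plane R -> R) (x v : plane R) (t a : R) :
  is_derive (x + t *: v) v f a -> is_derive t 1 (fun s => f (x + s *: v)) a.
Proof.
move=> /is_deriveP h; apply/is_deriveP => e /h[d d0 hd]; exists d => // s /hd.
by rewrite [_%:A]mulr1 scalerDl addrA.
Qed.

(** With a negative second derivative, [df] would be negative just after the
    minimum, and [f] would go below [f 0] by the mean value theorem. *)
Lemma min_second_test (f df : R -> R) (a d : R) : 0 < d ->
  (forall t : R, `|t| < d -> is_derive t 1 f (df t)) -> is_derive (0 : R) 1 df a ->
  (forall t, `|t| < d -> f 0 <= f t) -> 0 <= a.
Proof.
move=> d0 hf hdf fmin; rewrite leNgt; apply/negP => a0.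
have ino t : t \in `]-d, d[ -> `|t| < d by rewrite in_itv /= ltr_norml.
have df0 : df 0 = 0.
  have /hf D0 : `|0 : R| < d by rewrite normr0.
  apply: (is_derive_uniq D0); apply: (@derive1_at_min _ f (-d) d).
  - lra.
  - by move=> t /ino/hf [].
  - by rewrite in_itv /= oppr_lt0 d0.
  - by move=> t /ino; exact: fmin.
have [d' d'0 hd'] := (is_deriveP df 0 1 a).1 hdf (- a / 2) ltac:(lra).
pose m := Num.min d d' / 2.
have m0 : 0 < m by rewrite divr_gt0// lt_min d0.
have [md md'] : m < d /\ m < d'.
  have : Num.min d d' <= d by rewrite ge_min lexx.
  have : Num.min d d' <= d' by rewrite ge_min lexx orbT.
  by move: m0; rewrite /m; lra.
have [||c] := @MVT R f df 0 m m0.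
- by move=> x; rewrite in_itv /= => /andP[x0 xm]; apply: hf; rewrite gtr0_norm//; lra.
- apply: derivable_within_continuous => x; rewrite in_itv /= => /andP[x0 xm].
  by have [] // := hf x; rewrite ger0_norm//; lra.
rewrite in_itv /= subr0 => /andP[c0 cm] E.
have := fmin m; rewrite gtr0_norm// => /(_ md); rewrite -subr_ge0 E pmulr_lge0//.
have := hd' c; rewrite gtr0_norm// add0r [_%:A]mulr1 df0 subr0.
move=> /(_ ltac:(lra)); rewrite ler_norml => /andP[_]; nra.
Qed.

(** Only the restriction of [f] to a line is involved.  This weak notion
    passes to reflections and differences at no cost, and it is all that the
    second derivative test at a minimum needs. *)
Definition is_derive2 (f : plane R -> R) (x e : plane R) (a : R) :=
  exists df : R -> R, [/\ exists2 d : R, 0 < d &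
    forall t : R, `|t| < d -> is_derive t 1 (fun s => f (x + s *: e)) (df t) &
    is_derive (0 : R) 1 df a].

Lemma is_derive2B (f g : plane R -> R) (x e : plane R) (a b : R) :
  is_derive2 f x e a -> is_derive2 g x e b -> is_derive2 (f \- g) x e (a - b).
Proof.
move=> [df [[d d0 h] h0]] [dg [[d' d'0 h'] h'0]]; exists (df - dg); split.
  exists (Num.min d d'); first by rewrite lt_min d0.
  move=> t; rewrite lt_min => /andP[td td'].
  by have := h t td; have := h' t td' => ? ?; exact: is_deriveB.
exact: is_deriveB.
Qed.

Lemma is_derive2Z (f : plane R -> R) (x e : plane R) (a k : R) :
  is_derive2 f x e a -> is_derive2 (fun y => k * f y) x e (k * a).
Proof.
move=> [df [[d d0 h] h0]]; exists (k \*: df); split; last exact: is_deriveZ.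
by exists d => // t /h ?; exact: is_deriveZ.
Qed.

Lemma is_derive2_min (f : plane R -> R) (x e : plane R) (a d : R) : 0 < d ->
  (forall t, `|t| < d -> f x <= f (x + t *: e)) -> is_derive2 f x e a -> 0 <= a.
Proof.
move=> d0 fmin [df [[d' d'0 h] h0]].
apply: (@min_second_test (fun s => f (x + s *: e)) df a (Num.min d d')) => //.
- by rewrite lt_min d0.
- by move=> t; rewrite lt_min => /andP[_]; exact: h.
- by move=> t; rewrite lt_min scale0r addr0 => /andP[+ _]; exact: fmin.
Qed.

(** The Laplacian in the orthonormal frame [(e, perp e)].  The frame is a
    parameter because a reflection with axis orthogonal to [e] preserves it up to
    sign, so that reflected functions have the same second derivatives. *)
Definition lap_le (f : plane R -> R) (x e : plane R) (c : R) :=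
  exists a b, [/\ is_derive2 f x e a, is_derive2 f x (perp e) b & a + b <= c].

(** At a negative minimum both second derivatives would be nonnegative,
    which the strictly negative Laplacian excludes. *)
Lemma weak_min (f : plane R -> R) (K : set (plane R)) (e : plane R) :
  dotp e e = 1 ->
  compact K -> {within K, continuous f} ->
  (forall x, K x -> f x < 0 -> (exists2 d : R, 0 < d & forall y, enorm (y - x) < d -> K y) /\
     exists2 c, c < 0 & lap_le f x e c) ->
  forall x, K x -> 0 <= f x.
Proof.
move=> e1 cK fK H x Kx; rewrite leNgt; apply/negP => fx.
have [m /set_mem Km mmin] := @EVT_min_rV _ _ _ _ (ex_intro _ x Kx) cK fK.
have fm : f m < 0 by apply: le_lt_trans fx; apply: mmin; apply/mem_set.
have [[d d0 Kd] [c c0 [a [b [da db ab]]]]] := H m Km fm.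
have P v : dotp v v = 1 -> forall t, `|t| < d -> f m <= f (m + t *: v).
  move=> v1 t td; apply: mmin; apply/mem_set/Kd; rewrite addrC addKr enormZ.
  by rewrite (unit_enorm v1) mulr1.
have a0 := is_derive2_min d0 (P e e1) da.
have b0 := is_derive2_min d0 (P (perp e) _) db.
by rewrite dotp_perp2 in b0; have := b0 e1; lra.
Qed.
End Calc.

(** * Segments and compact sets *)

Section SegmentsAndCompacts.
Context {R : realType}.
Implicit Types (x y z p q e c : plane R) (s t d a r : R).

(** Connectedness of the unit interval: the supremum of the
    [t] such that [P] holds up to [t] can only be [1]. *)
Lemma unit_interval_induction (P : R -> Prop) : P 0 ->
  (forall t, 0 <= t <= 1 -> P t ->
     exists2 d : R, 0 < d & forall s, 0 <= s <= 1 -> `|s - t| < d -> P s) ->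
  (forall t, 0 <= t <= 1 ->
     (forall d, 0 < d -> exists s, [/\ 0 <= s <= 1, `|s - t| < d & P s]) -> P t) ->
  forall t, 0 <= t <= 1 -> P t.
Proof.
move=> P0 Po Pc.
pose S := [set t | 0 <= t <= 1 /\ forall s, 0 <= s <= t -> P s].
have S0 : S 0.
  by split=> [|s]; [rewrite lexx ler01|rewrite -eq_le => /eqP <-].
have hS : has_sup S.
  by split; [exists 0|exists 1 => t [/andP[]]].
pose m := sup S.
have m0 : 0 <= m by apply: ub_le_sup => //; case: hS.
have m1 : m <= 1 by apply: ge_sup; [exists 0|move=> t [/andP[]]].
have Plt s : 0 <= s < m -> P s.
  move=> /andP[s0 sm]; have [t [_ tP] st] := sup_gt (ex_intro _ 0 S0) sm.
  by apply: tP; rewrite s0 ltW.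
have Pm : P m.
  apply: Pc; rewrite ?m0// => d d0.
  have [t [/andP[t0 t1] tP]] := sup_adherent d0 hS; rewrite -/m => mt.
  have tm : t <= m by apply: ub_le_sup; [case: hS|split; rewrite ?t0].
  exists t; split; [by rewrite t0| |by apply: tP; rewrite t0 lexx].
  by rewrite distrC ger0_norm ?subr_ge0//; lra.
have [d d0 Pd] := Po m ltac:(by rewrite m0) Pm.
have Sd : S (Num.min 1 (m + d / 2)).
  split; first by rewrite ge_min lexx andbT le_min ler01; lra.
  move=> s; rewrite le_min => /and3P[s0 s1 sm].
  have [sm'|sm'] := ltP s m; first by apply: Plt; rewrite s0.
  by apply: Pd; rewrite ?s0// ger0_norm ?subr_ge0//; lra.
have m1' : m = 1.
  have := ub_le_sup (proj2 hS) Sd; rewrite -/m ge_min => /orP[|]; lra.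
move=> t /andP[t0]; rewrite le_eqVlt => /orP[/eqP ->|t1]; first by rewrite -m1'.
by apply: Plt; rewrite t0 m1'.
Qed.

Lemma segment_near x y s t d : `|s - t| < d / (enorm (y - x) + 1) ->
  enorm (x + s *: (y - x) - (x + t *: (y - x))) < d.
Proof.
rewrite ltr_pdivlMr ?ltr_wpDl ?enorm_ge0// opprD addrACA subrr add0r -scalerBl enormZ; apply: le_lt_trans.
by rewrite ler_wpM2l// lerDl.
Qed.

Lemma segment_propagate (Q : plane R -> Prop) x y : Q x ->
  (forall t, 0 <= t <= 1 -> Q (x + t *: (y - x)) ->
     exists2 d, 0 < d & forall t', 0 <= t' <= 1 ->
       enorm (x + t' *: (y - x) - (x + t *: (y - x))) < d -> Q (x + t' *: (y - x))) ->
  (forall t, 0 <= t <= 1 -> (forall d, 0 < d -> exists2 z, enorm (z - (x + t *: (y - x))) < d & Q z) ->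
    Q (x + t *: (y - x))) -> Q y.
Proof.
move=> Qx Qo Qc.
have N0 : 0 < enorm (y - x) + 1 by rewrite ltr_wpDl ?enorm_ge0.
suff H t : 0 <= t <= 1 -> Q (x + t *: (y - x)).
  by have := H 1; rewrite scale1r (addrC x) subrK ler01 lexx; apply.
move: t; apply: (unit_interval_induction (P := fun t => Q (x + t *: (y - x)))).
- by rewrite scale0r addr0.
- move=> t t01 /(Qo t t01)[d d0 hd]; exists (d / (enorm (y - x) + 1)); first by rewrite divr_gt0.
  by move=> s s01 /segment_near; exact: hd.
- move=> t t01 H; apply: Qc => // d d0.
  have [|s [s01 /segment_near st Qs]] := H (d / (enorm (y - x) + 1)); first by rewrite divr_gt0.
  by exists (x + s *: (y - x)).
Qed.

Lemma cont_gt (f : plane R -> R) x a : {for x, continuous f} -> a < f x ->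
  exists2 d : R, 0 < d & forall y, enorm (y - x) < d -> a < f y.
Proof.
move=> cf af; have [|d d0 h] := continuous_enorm cf (a := f x - a); first by rewrite subr_gt0.
by exists d => // y /h; rewrite ltr_norml => /andP[]; lra.
Qed.
Lemma cont_lt (f : plane R -> R) x a : {for x, continuous f} -> f x < a ->
  exists2 d : R, 0 < d & forall y, enorm (y - x) < d -> f y < a.
Proof.
move=> cf af; have [|d d0 h] := continuous_enorm cf (a := a - f x); first by rewrite subr_gt0.
by exists d => // y /h; rewrite ltr_norml => /andP[]; lra.
Qed.
Lemma near_and x (P Q : plane R -> Prop) :
  (exists2 d : R, 0 < d & forall y, enorm (y - x) < d -> P y) ->
  (exists2 d : R, 0 < d & forall y, enorm (y - x) < d -> Q y) ->
  exists2 d : R, 0 < d & forall y, enorm (y - x) < d -> P y /\ Q y.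
Proof.
move=> [d d0 h] [d' d'0 h']; exists (Num.min d d'); first by rewrite lt_min d0.
by move=> y; rewrite lt_min => /andP[/h ? /h' ?].
Qed.

Lemma dotp_continuous e : continuous (fun y => dotp y e).
Proof.
move=> y; apply: enorm_continuous => a a0; exists (a / (enorm e + 1)).
  by rewrite divr_gt0// ltr_wpDl// enorm_ge0.
move=> z; rewrite ltr_pdivlMr ?ltr_wpDl ?enorm_ge0// => h.
rewrite -dotpNl -dotpDl (le_lt_trans (dotp_le _ _))// (le_lt_trans _ h)//.
by rewrite ler_wpM2l ?enorm_ge0// lerDl.
Qed.

Lemma sqdist_continuous c : continuous (fun y => dotp (y - c) (y - c)).
Proof.
have E : (fun y => dotp (y - c) (y - c)) = (fun y => (y ord0 0 - c ord0 0) * (y ord0 0 - c ord0 0) + (y ord0 1 - c ord0 1) * (y ord0 1 - c ord0 1)).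
  by apply/funext => y; rewrite !plE; ring.
have C i : continuous (fun y : plane R => y ord0 i - c ord0 i).
  by move=> y; apply: continuousB; [exact: coord_continuous|exact: cst_continuous].
have D i : continuous (fun y : plane R => (y ord0 i - c ord0 i) * (y ord0 i - c ord0 i)).
  by move=> y; exact: (@continuousM _ _ (fun y : plane R => y ord0 i - c ord0 i) (fun y : plane R => y ord0 i - c ord0 i) y (C i y) (C i y)).
by rewrite E => y; exact: (continuousD (D 0 y) (D 1 y)).
Qed.

Lemma closed_ge_cont (f : plane R -> R) a : continuous f -> closed [set y | a <= f y].
Proof. by move=> cf; apply: (@closed_comp _ _ f [set t | a <= t]) => //; exact: closed_ge. Qed.
Lemma closed_le_cont (f : plane R -> R) a : continuous f -> closed [set y | f y <= a].
Proof. by move=> cf; apply: (@closed_comp _ _ f [set t | t <= a]) => //; exact: closed_le. Qed.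

Lemma bounded_enorm (A : set (plane R)) : bounded_set A <-> exists r, forall y, A y -> enorm y <= r.
Proof.
split.
  move=> [M [_ hM]]; exists (2 * (M + 1)) => y Ay.
  have yM : `|y| <= M + 1 by apply: (hM (M + 1)) => //; rewrite ltrDl.
  by rewrite (le_trans (enorm_sup _))// ler_pM2l.
move=> [r h]; exists r; split; first exact: num_real.
by move=> M rM y /h yr; rewrite /= (le_trans (sup_enorm _))// (le_trans yr)// ltW.
Qed.

Lemma compact_cball (A : set (plane R)) c r : closed A ->
  (forall y, A y -> enorm (y - c) <= r) -> compact A.
Proof.
move=> cA h; apply: bounded_closed_compact => //; apply/bounded_enorm.
exists (r + enorm c) => y /h yr; rewrite -(subrK c y).
by rewrite (le_trans (enormD _ _))// lerD2r.
Qed.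

Lemma compact_min_pos (A : set (plane R)) (w : plane R -> R) : A !=set0 -> compact A ->
  continuous w -> (forall y, A y -> 0 < w y) -> exists2 m : R, 0 < m & forall y, A y -> m <= w y.
Proof.
move=> A0 cA cw wA.
have [x /set_mem Ax xm] := EVT_min_rV A0 cA (continuous_subspaceT cw).
by exists (w x); [exact: wA|move=> y Ay; apply/xm/mem_set].
Qed.

(** The barriers are polynomial on each line, so their second derivatives
    are coefficients. *)
Lemma is_derive2_poly (f : plane R -> R) x e (p : {poly R}) :
  (forall s, f (x + s *: e) = p.[s]) -> is_derive2 f x e (2 * p`_2).
Proof.
move=> h; exists (fun t => p^`().[t]); split.
  exists 1 => // t _; rewrite (_ : (fun s => _) = (fun s => p.[s])); last exact/funext.
  exact: is_derive_poly.
have := is_derive_poly p^`() 0.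
by rewrite horner_coef0 !coef_deriv mulr2n mulr1n mulrDl !mul1r.
Qed.

End SegmentsAndCompacts.

(** * A barrier in a disc *)

Section Barriers.
Context {R : realType}.
Implicit Types (x y z p q e c v : plane R) (s t d a r l m k : R) (w : plane R -> R).

Lemma sqdist_line c x v s : dotp v v = 1 ->
  dotp (x + s *: v - c) (x + s *: v - c) =
  dotp (x - c) (x - c) + 2 * s * dotp (x - c) v + s ^+ 2.
Proof.
move=> v1; have -> : x + s *: v - c = (x - c) + s *: v by rewrite addrAC.
by move: (x - c) => z; rewrite !dotpl v1 (dotpC v); ring.
Qed.

(** With [q = r ^ 2 - |y - c| ^ 2] this is [q + (8 / r ^ 2) q ^ 2].  It vanishes
    on the circle of radius [r]; the square makes it strictly subharmonic on the
    shell [3 / 4 r ^ 2 <= |y - c| ^ 2 <= r ^ 2], and with the constant [8] it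
    remains so after multiplication by a positive affine function. *)
Definition bump c r : plane R -> R := fun y =>
  (r ^+ 2 - dotp (y - c) (y - c)) + 8 / r ^+ 2 * (r ^+ 2 - dotp (y - c) (y - c)) ^+ 2.

Lemma bump_derive2 c r x v : dotp v v = 1 ->
  is_derive2 (bump c r) x v
    (2 * (- 1 + 8 / r ^+ 2 * (4 * dotp (x - c) v ^+ 2 - 2 * (r ^+ 2 - dotp (x - c) (x - c))))).
Proof.
move=> v1; set X := dotp (x - c) v; set q := r ^+ 2 - _; set A := 8 / _.
have -> : - 1 + A * (4 * X ^+ 2 - 2 * q) =
   (Poly [:: q + A * q ^+ 2; - 2 * X - 4 * A * q * X; - 1 + A * (4 * X ^+ 2 - 2 * q);
            4 * A * X; A])`_2 by rewrite coef_Poly.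
apply: is_derive2_poly => s; rewrite horner_Poly /= /bump sqdist_line// -/X -/A.
by rewrite /q; ring.
Qed.

Lemma tilted_bump_derive2 c r l x e v : dotp v v = 1 ->
  is_derive2 (fun y => (dotp y e - l) * bump c r y) x v
    (2 * ((dotp x e - l) *
      (- 1 + 8 / r ^+ 2 * (4 * dotp (x - c) v ^+ 2 - 2 * (r ^+ 2 - dotp (x - c) (x - c))))
      + dotp v e * (- 2 * dotp (x - c) v
          - 4 * (8 / r ^+ 2) * (r ^+ 2 - dotp (x - c) (x - c)) * dotp (x - c) v))).
Proof.
move=> v1; set X := dotp (x - c) v; set q := r ^+ 2 - _; set A := 8 / _.
set Z := dotp x e - l; set m := dotp v e.
pose c0 := q + A * q ^+ 2; pose c1 := - 2 * X - 4 * A * q * X.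
pose c2 := - 1 + A * (4 * X ^+ 2 - 2 * q).
have -> : Z * (- 1 + A * (4 * X ^+ 2 - 2 * q)) + m * (- 2 * X - 4 * A * q * X) =
   (Poly [:: Z * c0; Z * c1 + m * c0; Z * c2 + m * c1; Z * (4 * A * X) + m * c2;
             Z * A + m * (4 * A * X); m * A])`_2 by rewrite coef_Poly.
apply: is_derive2_poly => s; rewrite horner_Poly /= /bump sqdist_line// -/X -/A dotpDl dotpZl -/m.
by rewrite /c0 /c1 /c2 /q /Z; ring.
Qed.

Lemma continuous_mul (f g : plane R -> R) : continuous f -> continuous g ->
  continuous (fun y => f y * g y).
Proof. by move=> cf cg y; exact: (@continuousM _ _ f g y (cf y) (cg y)). Qed.
Lemma continuous_sub (f g : plane R -> R) : continuous f -> continuous g ->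
  continuous (fun y => f y - g y).
Proof. by move=> cf cg y; exact: (@continuousB _ _ _ f g y (cf y) (cg y)). Qed.
Lemma continuous_add (f g : plane R -> R) : continuous f -> continuous g ->
  continuous (fun y => f y + g y).
Proof. by move=> cf cg y; exact: (@continuousD _ _ _ f g y (cf y) (cg y)). Qed.
Lemma continuous_const k : continuous (fun _ : plane R => k).
Proof. by move=> y; exact: cst_continuous. Qed.

Lemma bump_continuous c r : continuous (bump c r).
Proof.
have D1 : continuous (fun y => r ^+ 2 - dotp (y - c) (y - c)).
  exact: (continuous_sub (@continuous_const _) (@sqdist_continuous R c)).
have -> : bump c r = fun y => r ^+ 2 - dotp (y - c) (y - c) +
    8 / r ^+ 2 * ((r ^+ 2 - dotp (y - c) (y - c)) * (r ^+ 2 - dotp (y - c) (y - c))).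
  by apply/funext => y; rewrite /bump expr2.
exact: (continuous_add D1 (continuous_mul (@continuous_const _) (continuous_mul D1 D1))).
Qed.

(** Subtracting a small multiple of a strictly subharmonic barrier makes a
    superharmonic function strictly superharmonic, as [weak_min] requires. *)
Lemma lap_leB_scale w (b : plane R -> R) x e (c1 c2 k : R) : 0 <= k ->
  lap_le w x e c1 -> (exists a1 a2, [/\ is_derive2 b x e a1, is_derive2 b x (perp e) a2 & c2 <= a1 + a2]) ->
  lap_le (fun y => w y - k * b y) x e (c1 - k * c2).
Proof.
move=> k0 [a [a' [da da' aa]]] [b1 [b2 [db db' bb]]].
exists (a - k * b1), (a' - k * b2); split.
- by apply: is_derive2B => //; apply: is_derive2Z.
- by apply: is_derive2B => //; apply: is_derive2Z.
- have := ler_wpM2l k0 bb; lra.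
Qed.

Lemma bump_le c r y : 0 < r -> 3 / 4 * r ^+ 2 <= dotp (y - c) (y - c) <= r ^+ 2 ->
  r ^+ 2 - dotp (y - c) (y - c) <= bump c r y <= r ^+ 2.
Proof.
move=> r0; have r2 : 0 < r ^+ 2 by rewrite exprn_gt0.
rewrite /bump; set q := r ^+ 2 - _ => /andP[h1 h2].
have q0 : 0 <= q by rewrite /q; lra.
have q1 : q <= r ^+ 2 / 4 by rewrite /q; lra.
have -> : 8 / r ^+ 2 * q ^+ 2 = 8 * q ^+ 2 / r ^+ 2 by ring.
apply/andP; split; first by rewrite lerDl divr_ge0 ?mulr_ge0 ?sqr_ge0// ltW.
have : 8 * q ^+ 2 / r ^+ 2 <= r ^+ 2 / 2 by rewrite ler_pdivrMr//; nra.
lra.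
Qed.

Lemma bump_sphere c r y : dotp (y - c) (y - c) = r ^+ 2 -> bump c r y = 0.
Proof. by rewrite /bump => ->; rewrite subrr expr0n mulr0 addr0. Qed.

Lemma within_sub_bump w (b : plane R -> R) k (K : set (plane R)) : continuous w -> continuous b ->
  {within K, continuous (fun y => w y - k * b y)}.
Proof.
move=> cw cb; apply: continuous_subspaceT.
exact: (continuous_sub cw (continuous_mul (@continuous_const k) cb)).
Qed.

(** Comparison with a multiple of [bump] on the shell: the multiple is
    chosen so that the barrier is below [m] on the inner circle, and it vanishes on
    the outer one. *)
Lemma ball_barrier w c r m e : dotp e e = 1 -> 0 < r -> 0 <= m -> continuous w ->
  (forall y, enorm (y - c) < r -> lap_le w y e 0) ->
  (forall y, enorm (y - c) <= r -> 0 <= w y) ->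
  (forall y, dotp (y - c) (y - c) = 3 / 4 * r ^+ 2 -> m <= w y) ->
  forall y, 3 / 4 * r ^+ 2 <= dotp (y - c) (y - c) <= r ^+ 2 ->
    m / r ^+ 2 * (r ^+ 2 - dotp (y - c) (y - c)) <= w y.
Proof.
move=> e1 r0 m0 cw hl w0 wm.
have r2 : 0 < r ^+ 2 by rewrite exprn_gt0.
move: m0; rewrite le_eqVlt => /orP[/eqP<- y /andP[_ yr]|m0].
  by rewrite mul0r mul0r; apply: w0; rewrite enorm_le// ltW.
pose K := [set y | 3 / 4 * r ^+ 2 <= dotp (y - c) (y - c)] `&` [set y | dotp (y - c) (y - c) <= r ^+ 2].
have cK : compact K.
  apply: (@compact_cball _ _ c r).
    by apply: closedI; [apply: closed_ge_cont|apply: closed_le_cont]; exact: sqdist_continuous.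
  by move=> y [_ /= yr]; rewrite enorm_le// ltW.
pose k := m / r ^+ 2.
have k0 : 0 < k by rewrite divr_gt0.
have main : forall y, K y -> 0 <= w y - k * bump c r y.
  apply: (weak_min e1 cK (@within_sub_bump w _ k K cw (@bump_continuous c r))).
  move=> x [/= x1 x2] fx.
  have bx : bump c r x <= r ^+ 2 by have /andP[] := bump_le r0 (introT andP (conj x1 x2)).
  have x2' : dotp (x - c) (x - c) < r ^+ 2.
    rewrite lt_neqAle x2 andbT; apply/eqP => E; move: fx; rewrite (bump_sphere E) mulr0 subr0.
    by rewrite ltNge w0// enorm_le// ltW.
  have x1' : 3 / 4 * r ^+ 2 < dotp (x - c) (x - c).
    rewrite lt_neqAle x1 andbT; apply/eqP => E; move: fx; have := wm x (esym E).
    have : k * bump c r x <= m by rewrite -[leRHS](divfK (lt0r_neq0 r2)) ler_wpM2l// ltW.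
    lra.
  split.
    have [d d0 h] := near_and (cont_gt (@sqdist_continuous R c x) x1') (cont_lt (@sqdist_continuous R c x) x2').
    by exists d => // y /h[h1 h2]; split; rewrite /= ltW.
  exists (0 - k * 2); first lra.
  apply: lap_leB_scale (ltW k0) _ _; first by apply: hl; rewrite enorm_lt.
  do 2 eexists; split; [exact: bump_derive2|by apply: bump_derive2; rewrite dotp_perp2|].
  have := dotp_frame (x - c) (x - c) e1.
  move: (dotp (x - c) e) (dotp _ (perp e)) (dotp _ _) x1 => X Y D x1 DE.
  have -> : 2 * (-1 + 8 / r ^+ 2 * (4 * X ^+ 2 - 2 * (r ^+ 2 - D))) +
    2 * (-1 + 8 / r ^+ 2 * (4 * Y ^+ 2 - 2 * (r ^+ 2 - D))) =
    - 4 + 16 / r ^+ 2 * (8 * D - 4 * r ^+ 2) by rewrite DE; field; exact: lt0r_neq0.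
  have : 16 <= 16 / r ^+ 2 * (8 * D - 4 * r ^+ 2) by rewrite mulrAC ler_pdivlMr//; lra.
  lra.
move=> y hy; have [y1 y2] := andP hy; have /andP[b1 b2] := bump_le r0 hy.
have := main y (conj y1 y2); have := ler_wpM2l (ltW k0) b1; rewrite -/k; lra.
Qed.

End Barriers.

(** * A barrier in a half disc *)

Section HalfDisc.
Context {R : realType}.
Implicit Types (x y z p q e c v : plane R) (s t d a r l m k : R) (w : plane R -> R).

Lemma addlK (c v : plane R) : c + v - c = v. Proof. by rewrite addrC addKr. Qed.

(** [13 / 15] bounds the square root of [3 / 4] from above. *)
Lemma inner_radius z r : 0 < r -> dotp z z = 3 / 4 * r ^+ 2 -> enorm z <= 13 / 15 * r.
Proof. by move=> r0 zr; rewrite enorm_le ?zr; nra. Qed.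

(** Linear growth away from the flat side, on the inner half circle.  The
    points at height at least [r / 160] form a compact set on which [w] is
    positive.  A lower point is inside a disc of radius [r / 20] tangent to the flat
    side, and [ball_barrier] in this disc gives growth along its vertical
    diameter. *)
Lemma flat_growth w c r l e : dotp e e = 1 -> 0 < r -> continuous w -> dotp c e = l ->
  (forall y, enorm (y - c) < r -> l < dotp y e -> lap_le w y e 0 /\ 0 < w y) ->
  (forall y, enorm (y - c) <= r -> l <= dotp y e -> 0 <= w y) ->
  exists2 k, 0 < k & forall y, dotp (y - c) (y - c) = 3 / 4 * r ^+ 2 -> l <= dotp y e ->
    k * (dotp y e - l) <= w y.
Proof.
move=> e1 r0 cw ce hw w0.
(* the discs of radius r / 20 below have their inner circles in this set: their
   lowest points are at height r / 20 * (1 - 13 / 15) = r / 150 *)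
pose K := [set y | l + r / 160 <= dotp y e] `&` [set y | dotp (y - c) (y - c) <= (29 / 30 * r) ^+ 2].
have cK : compact K.
  apply: (@compact_cball _ _ c (29 / 30 * r)).
    by apply: closedI; [apply: closed_ge_cont; exact: dotp_continuous|apply: closed_le_cont; exact: sqdist_continuous].
  by move=> y [_ /= yr]; rewrite enorm_le//; lra.
have K0 : K !=set0.
  exists (c + (r / 2) *: e); rewrite /K /= addlK !dotpl e1 ce; split; first lra.
  by rewrite !mulr1; nra.
have [m m0 Km] : exists2 m : R, 0 < m & forall y, K y -> m <= w y.
  apply: compact_min_pos => // y [/= y1 y2]; apply: (hw y _ _).2; last lra.
  by rewrite enorm_lt// (le_lt_trans y2)//; nra.
exists (m / r); first by rewrite divr_gt0.
move=> y yr; set s := dotp y e - l => ls; have s0 : 0 <= s by rewrite subr_ge0.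
have yn := inner_radius r0 yr.
have sr : s <= r.
  have := dotp_le_unit (y - c) e1; rewrite dotpDl dotpNl ce -/s ler_norml => /andP[_]; lra.
have [sb|sb] := leP (r / 160) s.
  apply: (@le_trans _ _ m).
    by rewrite mulrAC ler_pdivrMr// ler_wpM2l// ltW.
  apply: Km; split; rewrite /=; first by move: sb; rewrite /s; lra.
  by rewrite yr; nra.
pose r' := r / 20; pose z := y + (r' - s) *: e.
have r'0 : 0 < r' by rewrite /r' divr_gt0.
have yz : y - z = (s - r') *: e by rewrite /z opprD addrA subrr add0r -scaleNr opprB.
have ze : dotp z e = l + r' by rewrite /z dotpDl dotpZl e1 /s; ring.
(* 11 / 12 = 13 / 15 + 1 / 20 *)
have zc : enorm (z - c) <= 11 / 12 * r.
  rewrite (le_trans (enorm_tri y _ _))// enormC yz enormZ (unit_enorm e1) mulr1.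
  by move: sb s0 r0 yn; clear_ineqs => sb s0 r0 yn; rewrite ler0_norm /r'; lra.
have side y' : `|dotp y' e - (l + r')| <= enorm (y' - z).
  by rewrite -ze -dotpNl -dotpDl dotp_le_unit.
have near_c y' : enorm (y' - c) <= enorm (y' - z) + 11 / 12 * r.
  by rewrite (le_trans (enorm_tri z _ _))// lerD2l.
have := @ball_barrier R w z r' m e e1 r'0 (ltW m0) cw _ _ _ y.
rewrite yz dotpZl dotpZr e1 mulr1.
have -> : m / r' ^+ 2 * (r' ^+ 2 - (s - r') * (s - r')) = m / r' ^+ 2 * (s * (2 * r' - s)) by ring.
move=> H; apply: le_trans (H _ _ _ _).
- have -> : m / r' ^+ 2 * (s * (2 * r' - s)) = m * (s * (2 * r' - s)) / r' ^+ 2 by ring.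
  rewrite ler_pdivlMr ?exprn_gt0//.
  have -> : m / r * s * r' ^+ 2 = m * s * (r / 400) by rewrite /r'; field; exact: lt0r_neq0.
  by rewrite [leRHS]mulrA ler_wpM2l ?mulr_ge0 ?(ltW m0)//; move: sb s0 r0; clear_ineqs; rewrite /r'; lra.
- move=> y' y'z; have := side y'; have := near_c y'; rewrite ler_norml => h1 /andP[h2 h3].
  by apply: (hw y' _ _).1; move: y'z h1 h2 r0; clear_ineqs; rewrite /r'; lra.
- move=> y' y'z; have := side y'; have := near_c y'; rewrite ler_norml => h1 /andP[h2 h3].
  by apply: w0; move: y'z h1 h2 r0; clear_ineqs; rewrite /r'; lra.
- move=> y' y'z; apply: Km.
  have y'n := inner_radius r'0 y'z.
  have := side y'; have := near_c y'; rewrite ler_norml => h1 /andP[h2 h3].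
  split; rewrite /=; first by move: y'n h2 r0; clear_ineqs; rewrite /r'; lra.
  move: y'n h1 r0; clear_ineqs => q1 q2 q3.
  by rewrite -enorm_le; move: q1 q2; rewrite /r'; lra.
- by move: sb s0 r0; clear_ineqs; rewrite /r'; move: (s) => q q1 q2 q3; apply/andP; split; nra.
Qed.

(** The barrier is [dotp y e - l] times [bump]: it vanishes on the flat
    side as well as on the circle, and in the corner of the half disc it is
    comparable with the product of the distances to the two sides. *)
Lemma half_disc_barrier w c r l e : dotp e e = 1 -> 0 < r -> continuous w -> dotp c e = l ->
  (forall y, enorm (y - c) < r -> l < dotp y e -> lap_le w y e 0 /\ 0 < w y) ->
  (forall y, enorm (y - c) <= r -> l <= dotp y e -> 0 <= w y) ->
  exists2 k, 0 < k & forall y, 3 / 4 * r ^+ 2 <= dotp (y - c) (y - c) <= r ^+ 2 -> l <= dotp y e ->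
    k * ((dotp y e - l) * (r ^+ 2 - dotp (y - c) (y - c))) <= w y.
Proof.
move=> e1 r0 cw ce hw w0.
have [k1 k10 H1] := flat_growth e1 r0 cw ce hw w0.
have r2 : 0 < r ^+ 2 by rewrite exprn_gt0.
pose K := ([set y | 3 / 4 * r ^+ 2 <= dotp (y - c) (y - c)] `&` [set y | dotp (y - c) (y - c) <= r ^+ 2])
  `&` [set y | l <= dotp y e].
have cK : compact K.
  apply: (@compact_cball _ _ c r).
    apply: closedI; last by apply: closed_ge_cont; exact: dotp_continuous.
    by apply: closedI; [apply: closed_ge_cont|apply: closed_le_cont]; exact: sqdist_continuous.
  by move=> y [[_ /= yr] _]; rewrite enorm_le// ltW.
pose k := k1 / r ^+ 2; have k0 : 0 < k by rewrite divr_gt0.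
pose b := fun y => (dotp y e - l) * bump c r y.
have cb : continuous b.
  apply: continuous_mul (@bump_continuous R c r).
  exact: (continuous_sub (@dotp_continuous R e) (@continuous_const R l)).
have main : forall y, K y -> 0 <= w y - k * b y.
  apply: (weak_min e1 cK (@within_sub_bump _ w _ k K cw cb)).
  move=> x [[/= x1 x2] x3] fx.
  have /andP[b0 bx] := bump_le r0 (introT andP (conj x1 x2)).
  have Z0 : 0 <= dotp x e - l by rewrite subr_ge0.
  have wx : 0 <= w x by apply: w0 => //; rewrite enorm_le// ltW.
  have x2' : dotp (x - c) (x - c) < r ^+ 2.
    rewrite lt_neqAle x2 andbT; apply/eqP => E; move: fx.
    by rewrite /b (bump_sphere E) !mulr0 subr0 ltNge wx.
  have x3' : l < dotp x e.
    rewrite lt_neqAle x3 andbT; apply/eqP => E; move: fx.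
    by rewrite /b -E subrr mul0r mulr0 subr0 ltNge wx.
  have x1' : 3 / 4 * r ^+ 2 < dotp (x - c) (x - c).
    rewrite lt_neqAle x1 andbT; apply/eqP => E; move: fx; have := H1 x (esym E) x3.
    have : k * b x <= k1 * (dotp x e - l).
      have -> : k * b x = k1 * (dotp x e - l) * bump c r x / r ^+ 2 by rewrite /k /b; ring.
      by rewrite ler_pdivrMr// ler_wpM2l// mulr_ge0// ltW.
    lra.
  split.
    have [d d0 h] := near_and (near_and (cont_gt (@sqdist_continuous _ c x) x1') (cont_lt (@sqdist_continuous _ c x) x2'))
      (cont_gt (@dotp_continuous _ e x) x3').
    by exists d => // y /h[[h1 h2] h3]; split; [split|]; rewrite /= ltW.
  exists (0 - k * (2 * (dotp x e - l))).
    by rewrite sub0r oppr_lt0 mulr_gt0// mulr_gt0// subr_gt0.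
  apply: lap_leB_scale (ltW k0) _ _; first by apply: (hw x _ _).1 => //; rewrite enorm_lt.
  do 2 eexists; split; [exact: tilted_bump_derive2|by apply: tilted_bump_derive2; rewrite dotp_perp2|].
  have Xe : dotp (x - c) e = dotp x e - l by rewrite dotpDl dotpNl ce.
  have := dotp_frame (x - c) (x - c) e1.
  rewrite e1 dotp_perpl Xe mul1r mul0r.
  have : 0 < dotp x e - l by rewrite subr_gt0.
  move: (dotp x e - l) (dotp _ (perp e)) (dotp _ _) x1 => X Y D x1 X0 DE.
  have -> : 2 * (X * (-1 + 8 / r ^+ 2 * (4 * X ^+ 2 - 2 * (r ^+ 2 - D))) +
     (- 2 * X - 4 * (8 / r ^+ 2) * (r ^+ 2 - D) * X)) +
    2 * (X * (-1 + 8 / r ^+ 2 * (4 * Y ^+ 2 - 2 * (r ^+ 2 - D))) + 0) =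
    X * (- 8 + 16 / r ^+ 2 * (12 * D - 8 * r ^+ 2)) by rewrite DE; field; exact: lt0r_neq0.
  rewrite mulrC ler_pM2l//.
  have : 16 <= 16 / r ^+ 2 * (12 * D - 8 * r ^+ 2) by rewrite mulrAC ler_pdivlMr//; lra.
  lra.
exists k => // y hy ly; have [y1 y2] := andP hy; have /andP[b1 b2] := bump_le r0 hy.
have := main y (conj (conj y1 y2) ly).
have : k * ((dotp y e - l) * (r ^+ 2 - dotp (y - c) (y - c))) <= k * b y.
  by rewrite ler_pM2l// /b ler_wpM2l// subr_ge0.
lra.
Qed.
End HalfDisc.

(** * The Hopf lemma and the strong minimum principle *)

Section StrongMax.
Context {R : realType}.
Implicit Types (x y z p q e c v : plane R) (s t d a r l m k : R) (w : plane R -> R).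

(** The bound [t <= r / 10] keeps the point in the shell where the barrier
    is available. *)
Lemma hopf_ball w c r u e : dotp e e = 1 -> dotp u u = 1 -> 0 < r -> continuous w ->
  (forall y, enorm (y - c) < r -> lap_le w y e 0 /\ 0 < w y) ->
  (forall y, enorm (y - c) <= r -> 0 <= w y) ->
  exists2 k, 0 < k & forall t, 0 < t <= r / 10 -> k * t <= w (c + (r - t) *: u).
Proof.
move=> e1 u1 r0 cw hw w0.
have [m m0 hm] : exists2 m : R, 0 < m & forall z, [set z | dotp (z - c) (z - c) <= 3 / 4 * r ^+ 2] z -> m <= w z.
  apply: compact_min_pos => //.
  - by exists c; rewrite /= subrr -enorm_sq enorm0 expr0n /=; nra.
  - apply: (@compact_cball _ _ c r); first by apply: closed_le_cont; exact: sqdist_continuous.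
    by move=> z /= zy; rewrite enorm_le ?(ltW r0)//; nra.
  - by move=> z /= zy; apply: (hw _ _).2; rewrite enorm_lt//; nra.
exists (m / r); first by rewrite divr_gt0.
move=> t /andP[t0 tr].
have r2 : 0 < r ^+ 2 by rewrite exprn_gt0.
have := @ball_barrier R w c r m e e1 r0 (ltW m0) cw (fun y yr => (hw y yr).1) w0 _ (c + (r - t) *: u).
rewrite addlK dotpZl dotpZr u1 mulr1 => H.
apply: le_trans (H _ _).
- have -> : m / r ^+ 2 * (r ^+ 2 - (r - t) * (r - t)) = m / r ^+ 2 * (t * (2 * r - t)) by ring.
  have -> : m / r * t = m / r ^+ 2 * (t * r) by field; exact: lt0r_neq0.
  by rewrite ler_wpM2l ?divr_ge0 ?(ltW m0) ?(ltW r2)// ler_wpM2l ?(ltW t0)//; lra.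
- by move=> y yE; apply: hm; rewrite /= yE.
- by apply/andP; split; nra.
Qed.

(** If [w] is positive at [y], take a zero [z0] nearest to [y].  In the
    disc centered at [y] with [z0] on its circle the Hopf lemma gives [w] a nonzero
    slope at [z0], which is impossible at an interior minimum. *)
Lemma strong_min_local w (U : set (plane R)) e x : dotp e e = 1 -> continuous w -> open U ->
  (forall y, U y -> [/\ 0 <= w y, lap_le w y e 0 & forall v, derivable w y v]) ->
  U x -> w x = 0 -> exists2 d : R, 0 < d & forall y, enorm (y - x) < d -> w y = 0.
Proof.
move=> e1 cw oU hU Ux wx.
have [d0 d00 hd0] := openE_enorm oU Ux.
pose d := d0 / 3; have d_0 : 0 < d by rewrite divr_gt0.
exists d => // y yx; apply/eqP; rewrite eq_le (_ : 0 <= w y); last first.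
  by have [] := hU y _; first by apply: hd0; move: yx; rewrite /d; lra.
rewrite andbT leNgt; apply/negP => wy.
pose Z := [set z | dotp (z - x) (z - x) <= (2 * d) ^+ 2] `&` ([set z | w z <= 0] `&` [set z | 0 <= w z]).
have cZ : compact Z.
  apply: (@compact_cball _ _ x (2 * d)).
    apply: closedI; first by apply: closed_le_cont; exact: sqdist_continuous.
    by apply: closedI; [exact: closed_le_cont|exact: closed_ge_cont].
  by move=> z [/= zx _]; rewrite enorm_le//; lra.
have Zx : Z x by split; rewrite /= ?wx// subrr -enorm_sq enorm0 expr0n/= exprn_ge0//; lra.
have [z0 /set_mem[/= z0x [z00 z00']] zmin] := EVT_min_rV (ex_intro _ x Zx) cZ (continuous_subspaceT (@sqdist_continuous _ y)).
have wz0 : w z0 = 0 by apply/eqP; rewrite eq_le z00.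
pose r := enorm (z0 - y).
have rz z : enorm (z - x) <= 2 * d -> w z = 0 -> r <= enorm (z - y).
  move=> zx wz; rewrite /r enorm_le ?enorm_ge0// enorm_sq; apply/zmin/mem_set.
  by split; rewrite /= ?wz// -enorm_le//; lra.
have r0 : 0 < r.
  by apply: enorm_gt0; rewrite subr_eq0; apply/eqP => E; move: wy; rewrite -E wz0 ltxx.
have rd : r < d by apply: le_lt_trans yx; rewrite enormC; apply: rz => //; rewrite subrr enorm0; lra.
have inx z : enorm (z - y) <= r -> enorm (z - x) < 2 * d.
  by move=> zy; have := enorm_tri y z x; lra.
have inU z : enorm (z - x) <= 2 * d -> U z by move=> zx; apply: hd0; move: zx; rewrite /d; lra.
have wpos z : enorm (z - y) < r -> 0 < w z.
  move=> zy; have zx := inx z (ltW zy); have [w0 _ _] := hU z (inU _ (ltW zx)).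
  rewrite lt_neqAle w0 andbT; apply/eqP => E; have := rz z (ltW zx) (esym E); lra.
have Uz0 : U z0 by apply: inU; rewrite ltW// inx.
have zy0 : z0 - y != 0 by apply/eqP => E; move: r0; rewrite /r E enorm0 ltxx.
have [v v1 zE] := unit_direction zy0; rewrite -/r in zE.
have [k k0 hk] := @hopf_ball w y r v e e1 v1 r0 cw
  ltac:(move=> z zy; split; [by have [] := hU z (inU _ (ltW (inx _ (ltW zy))))|exact: wpos])
  ltac:(move=> z zy; by have [] := hU z (inU _ (ltW (inx _ zy)))).
have [_ _ /(_ v)] := hU z0 Uz0.
move=> /derivableP; set D := 'D_ _ _ _ => /is_deriveP /(_ (k / 4) ltac:(lra)) [d1 d10 hd1].
have [d2 d20 hd2] := openE_enorm oU Uz0.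
pose t := Num.min (Num.min (d1 / 2) (r / 10)) (d2 / 2).
have t0 : 0 < t by rewrite !lt_min !divr_gt0.
have [t1 t2 t3] : [/\ t <= d1 / 2, t <= r / 10 & t <= d2 / 2].
  by rewrite /t; split; rewrite !ge_min ?lexx ?orbT.
have td1 : t < d1 by move: t1 d10; clear_ineqs; lra.
have td2 : t < d2 by move: t3 d20; clear_ineqs; lra.
have := hk t; rewrite t0 t2 => /(_ isT).
have -> : y + (r - t) *: v = z0 + (- t) *: v.
  by rewrite scalerBl addrA -zE (addrC y) subrK scaleNr.
have w1 : 0 <= w (z0 + t *: v).
  have [] // := hU (z0 + t *: v) _; apply: hd2.
  by rewrite addlK enormZ (unit_enorm v1) mulr1 gtr0_norm.
have := hd1 t; have := hd1 (- t); rewrite normrN gtr0_norm// wz0 !subr0.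
move=> /(_ td1) B1 /(_ td1) B2 B3; move: B1 B2; rewrite !ler_norml => /andP[_ B1] /andP[_ B2].
have kt : 0 < k * t by rewrite mulr_gt0.
move: kt w1 B1 B2 B3; clear_ineqs; lra.
Qed.

Lemma strong_min_convex w (U : set (plane R)) e x y : dotp e e = 1 -> continuous w -> open U ->
  (forall y, U y -> [/\ 0 <= w y, lap_le w y e 0 & forall v, derivable w y v]) ->
  (forall t, 0 <= t <= 1 -> U (x + t *: (y - x))) ->
  w x = 0 -> w y = 0.
Proof.
move=> e1 cw oU hU xyU wx.
apply: (@segment_propagate _ (fun z => w z = 0) x y wx) => t t01.
  move=> wt; have [d d0 h] := strong_min_local e1 cw oU hU (xyU _ t01) wt.
  by exists d => // s _; exact: h.
move=> H; apply/eqP/negPn/negP => wt.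
have [d d0 hd] := continuous_enorm (cw (x + t *: (y - x))) (a := `|w (x + t *: (y - x))|) ltac:(by rewrite normr_gt0).
by have [z /hd + wz] := H d d0; rewrite wz sub0r normrN ltxx.
Qed.
End StrongMax.

(** * Functions of class C1 and C2 up to the boundary *)

Section Gradients.
Context {R : realType}.
Implicit Types (x y z p q e c v w : plane R) (s t d a r l m k : R) (f : plane R -> R).
Implicit Types (g : 'I_2 -> plane R -> R) (h : 'I_2 -> 'I_2 -> plane R -> R) (Om : set (plane R)).

Lemma is_derive_scaledir f x v a k : is_derive x v f a -> is_derive x (k *: v) f (k * a).
Proof.
move=> /is_deriveP H; apply/is_deriveP => eps e0.
have [d d0 hd] := H (eps / (`|k| + 1)) ltac:(by rewrite divr_gt0// ltr_wpDl).
exists (d / (`|k| + 1)); first by rewrite divr_gt0// ltr_wpDl.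
move=> t; rewrite ltr_pdivlMr ?ltr_wpDl// => td; rewrite scalerA (_ : k * a * t = a * (t * k)); last ring.
have := hd (t * k); rewrite normrM.
have tk : `|t| * `|k| <= `|t| * (`|k| + 1) by rewrite ler_wpM2l// lerDl.
move=> /(_ (le_lt_trans tk td)) /le_trans -> //.
by rewrite mulrAC ler_pdivrMr ?ltr_wpDl// -mulrA ler_wpM2l// ltW.
Qed.

Lemma is_derive_translate f x v c a : is_derive (x + c) v f a -> is_derive x v (fun y => f (y + c)) a.
Proof.
move=> /is_deriveP H; apply/is_deriveP => eps /H[d d0 hd]; exists d => // t /hd.
by rewrite (addrAC x).
Qed.

Lemma line_mvt f x v (D : R -> R) :
  (forall s, 0 < s < 1 -> is_derive (x + s *: v) v f (D s)) ->
  {within `[0, 1], continuous (fun s => f (x + s *: v))} ->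
  exists2 s : R, 0 < s < 1 & f (x + v) - f x = D s.
Proof.
move=> hD hc; have [||s] := @MVT R (fun s => f (x + s *: v)) D 0 1 ltr01 => //.
- by move=> s; rewrite in_itv /= => /hD; exact: is_derive_line.
- by rewrite in_itv /= => s01; rewrite scale1r scale0r addr0 subr0 mulr1; exists s.
Qed.

Lemma line_mvt_open f x v (D : R -> R) :
  (forall s, 0 <= s <= 1 -> is_derive (x + s *: v) v f (D s)) ->
  exists2 s : R, 0 < s < 1 & f (x + v) - f x = D s.
Proof.
move=> hD; apply: line_mvt.
  by move=> s /andP[s0 s1]; apply: hD; rewrite !ltW.
apply: derivable_within_continuous => s; rewrite in_itv /= => s01.
by have /is_derive_line[] := hD s s01.
Qed.

Definition grad_dot g x v := g 0 x * v ord0 0 + g 1 x * v ord0 1.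
Definition hess h x v w := grad_dot (h 0) x w * v ord0 0 + grad_dot (h 1) x w * v ord0 1.

(** Class C1 up to the boundary: [g] is the gradient of [f] inside [Om] and its
    continuous extension on the boundary. *)
Definition C1bar Om f g := [/\ {within closure Om, continuous f},
  forall i, {within closure Om, continuous (g i)} &
  forall i x, Om x -> is_derive x (delta_mx ord0 i) f (g i x)].

Lemma C1bar_near Om f g x : open Om -> C1bar Om f g -> Om x -> forall a, 0 < a ->
  exists2 d : R, 0 < d & forall y, enorm (y - x) < d ->
    Om y /\ forall i, `|g i y - g i x| < a.
Proof.
move=> oU [_ cg _] Ux a a0.
have [d d0 hd] := openE_enorm oU Ux.
have H i : exists2 d : R, 0 < d & forall y, enorm (y - x) < d -> `|g i y - g i x| < a.
  have [d' d'0 hd'] := within_enorm (cg i) (subset_closure Ux) a0.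
  exists (Num.min d d'); first by rewrite lt_min d0.
  by move=> y; rewrite lt_min => /andP[/hd Uy yd']; apply: hd' => //; exact: subset_closure.
have [d1 d10 h1] := near_and (H 0) (H 1).
exists (Num.min d d1); first by rewrite lt_min d0.
move=> y; rewrite lt_min => /andP[/hd Uy /h1[h0' h1']]; split=> // -[[|[|//]] i].
- by rewrite (_ : Ordinal i = 0) //; apply/val_inj.
- by rewrite (_ : Ordinal i = 1) //; apply/val_inj.
Qed.

Lemma plane_basis v : v = v ord0 0 *: delta_mx ord0 0 + v ord0 1 *: delta_mx ord0 1.
Proof. by apply/planeP; rewrite !mxE /= ?(mulr1, mulr0, addr0, add0r). Qed.

Lemma enorm_delta i : enorm (delta_mx ord0 i : plane R) = 1.
Proof.
apply: unit_enorm; rewrite dotpE !mxE /=; case: i => -[|[|//]] i /=;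
by rewrite ?(mulr1, mulr0, addr0, add0r).
Qed.

Lemma coord_enorm v i : `|v ord0 i| <= enorm v.
Proof.
by rewrite (le_trans _ (sup_enorm v))// /Num.norm /= mx_normrE; apply: (le_bigmax _ _ (ord0, i)).
Qed.

(** Continuous partial derivatives give all directional derivatives: go from
    [x] to [x + t *: v] along the coordinate axes. *)
Lemma C1bar_derive Om f g x v : open Om -> C1bar Om f g -> Om x ->
  is_derive x v f (grad_dot g x v).
Proof.
move=> oU C1 Ux; apply/is_deriveP => eps e0; have [_ _ hf] := C1.
have N0 : 0 < 2 * (enorm v + 1) by rewrite mulr_gt0// ltr_wpDl ?enorm_ge0.
have [d d0 hd] := C1bar_near oU C1 Ux (divr_gt0 e0 N0).
exists (d / (2 * (enorm v + 1))); first by rewrite divr_gt0.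
move=> t; rewrite ltr_pdivlMr// => td.
set e0' := delta_mx ord0 0 : plane R; set e1' := delta_mx ord0 1 : plane R.
have small a b : `|a| <= `|t * v ord0 0| -> `|b| <= `|t * v ord0 1| -> enorm (a *: e0' + b *: e1') < d.
  move=> ha hb; apply: le_lt_trans td; rewrite (le_trans (enormD _ _))// !enormZ !enorm_delta.
  rewrite !mulr1 (le_trans (lerD ha hb))// !normrM -mulrDr ler_wpM2l//.
  by have := coord_enorm v 0; have := coord_enorm v 1; lra.
have [s0 s01 E0] : exists2 s : R, 0 < s < 1 &
    f (x + (t * v ord0 0) *: e0') - f x = t * v ord0 0 * g 0 (x + s *: ((t * v ord0 0) *: e0')).
  apply: line_mvt_open => s /andP[s0 s1]; apply: is_derive_scaledir; apply: hf.
  have [] // := hd (x + s *: ((t * v ord0 0) *: e0')) _; rewrite addlK scalerA.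
  have := small (s * (t * v ord0 0)) 0; rewrite scale0r addr0; apply; last by rewrite normr0.
  by rewrite normrM ger0_norm// ler_piMl.
have [s1 s11 E1] : exists2 s : R, 0 < s < 1 &
    f (x + (t * v ord0 0) *: e0' + (t * v ord0 1) *: e1') - f (x + (t * v ord0 0) *: e0') =
     t * v ord0 1 * g 1 (x + (t * v ord0 0) *: e0' + s *: ((t * v ord0 1) *: e1')).
  apply: line_mvt_open => s /andP[s0' s1]; apply: is_derive_scaledir; apply: hf.
  have [] // := hd (x + (t * v ord0 0) *: e0' + s *: ((t * v ord0 1) *: e1')) _.
  rewrite -(addrA x) addlK scalerA; apply: small => //.
  by rewrite normrM ger0_norm// ler_piMl.
have -> : x + t *: v = x + (t * v ord0 0) *: e0' + (t * v ord0 1) *: e1'.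
  by rewrite [in LHS](plane_basis v) scalerDr !scalerA addrA.
have [_ /(_ 0) G0] := hd (x + s0 *: ((t * v ord0 0) *: e0')) ltac:(
  rewrite addlK scalerA; have := small (s0 * (t * v ord0 0)) 0; rewrite scale0r addr0; apply;
  [by rewrite normrM gtr0_norm ?ler_piMl//; lra|by rewrite normr0]).
have [_ /(_ 1) G1] := hd (x + (t * v ord0 0) *: e0' + s1 *: ((t * v ord0 1) *: e1')) ltac:(
  rewrite -(addrA x) addlK scalerA; apply: small => //; rewrite normrM gtr0_norm ?ler_piMl//; lra).
move: G0 G1 E0 E1; move: (g 0 (x + _)) (g 1 (x + _ + _)) => G0 G1 hG0 hG1 E0 E1.
have -> : f (x + (t * v ord0 0) *: e0' + (t * v ord0 1) *: e1') - f x - grad_dot g x v * t =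
   t * (v ord0 0 * (G0 - g 0 x) + v ord0 1 * (G1 - g 1 x)).
  by rewrite /grad_dot; move: E0 E1; lra.
rewrite normrM mulrC ler_wpM2r// (le_trans (ler_normD _ _))// !normrM.
have h0 := coord_enorm v 0; have h1 := coord_enorm v 1.
have eN : eps / (2 * (enorm v + 1)) * (enorm v + 1) = eps / 2 by field; have := enorm_ge0 v; lra.
set a := eps / (2 * (enorm v + 1)) in hG0 hG1 eN; have a0 : 0 < a by rewrite divr_gt0.
have := ler_pM (normr_ge0 _) (normr_ge0 _) h0 (ltW hG0).
have := ler_pM (normr_ge0 _) (normr_ge0 _) h1 (ltW hG1).
lra.
Qed.

Lemma seg_mvt Om f g x y : open Om -> C1bar Om f g -> closure Om x -> closure Om y ->
  (forall s, 0 < s < 1 -> Om (x + s *: (y - x))) ->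
  exists2 s : R, 0 < s < 1 & f y - f x = grad_dot g (x + s *: (y - x)) (y - x).
Proof.
move=> oU C1 Ux Uy sOm; have [cf _ _] := C1.
have E : x + (y - x) = y by rewrite addrC subrK.
rewrite -{1}E; apply: (@line_mvt f x (y - x) (fun s => grad_dot g (x + s *: (y - x)) (y - x))).
  by move=> s s01; apply: (C1bar_derive _ oU C1); exact: sOm.
have inc s : 0 <= s <= 1 -> closure Om (x + s *: (y - x)).
  move=> /andP[]; rewrite !le_eqVlt => /orP[/eqP<- _|s0 /orP[/eqP->|s1]].
  - by rewrite scale0r addr0.
  - by rewrite scale1r E.
  - by apply/subset_closure/sOm; rewrite s0.
apply/subspace_continuousP => s /=; rewrite in_itv /= => s01 B /nbhs_ballP[a /= a0 aB].
have [d d0 hd] := within_enorm cf (inc s s01) a0.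
suff : nbhs s (fun t => t \in `[0, 1] -> B (f (x + t *: (y - x)))).
  by apply: filterS => t H t01; apply: H.
apply/nbhs_ballP; exists (d / (enorm (y - x) + 1)) => /=; first by rewrite divr_gt0// ltr_wpDl ?enorm_ge0.
move=> t; rewrite /ball /= distrC => ts; rewrite in_itv /= => t01; apply: aB; rewrite /ball /= distrC.
by apply: hd; [exact: inc|exact: segment_near].
Qed.

Definition C2bar Om f g h := C1bar Om f g /\ forall i, C1bar Om (g i) (h i).

Lemma grad_dotZ g x k v : grad_dot g x (k *: v) = k * grad_dot g x v.
Proof. by rewrite /grad_dot !mxE; ring. Qed.
Lemma grad_dotD g x v w : grad_dot g x (v + w) = grad_dot g x v + grad_dot g x w.
Proof. by rewrite /grad_dot !mxE; ring. Qed.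
Lemma grad_dotN g x v : grad_dot g x (- v) = - grad_dot g x v.
Proof. by rewrite /grad_dot !mxE; ring. Qed.

Lemma C1bar_dir Om f g h v : open Om -> C2bar Om f g h ->
  C1bar Om (fun x => grad_dot g x v) (fun j x => h 0 j x * v ord0 0 + h 1 j x * v ord0 1).
Proof.
move=> oU [C1 C2].
have L (F G : plane R -> R) a b : {within closure Om, continuous F} ->
    {within closure Om, continuous G} -> {within closure Om, continuous (fun x => F x * a + G x * b)}.
  move=> cF cG x; pose T := subspace (closure Om).
  have HF := @continuousM R T F (fun=> a) x (cF x) (@cst_continuous _ _ _ _).
  have HG := @continuousM R T G (fun=> b) x (cG x) (@cst_continuous _ _ _ _).
  exact: (@continuousD _ _ _ (fun y : T => F y * a) (fun y : T => G y * b) x HF HG).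
split.
- by apply: L; [case: (C2 0)|case: (C2 1)].
- by move=> j; apply: L; [case: (C2 0)|case: (C2 1)].
- move=> j x Ux; have [_ _ /(_ j x Ux) d0] := C2 0; have [_ _ /(_ j x Ux) d1] := C2 1.
  move: d0 d1 => /is_deriveP d0 /is_deriveP d1; apply/is_deriveP => eps e0.
  have N0 : 0 < 2 * (enorm v + 1) by rewrite mulr_gt0// ltr_wpDl ?enorm_ge0.
  have [r0 r00 h0] := d0 _ (divr_gt0 e0 N0); have [r1 r10 h1] := d1 _ (divr_gt0 e0 N0).
  exists (Num.min r0 r1); first by rewrite lt_min r00.
  move=> t; rewrite lt_min => /andP[/h0 {}h0 /h1 {}h1]; rewrite /grad_dot.
  move: h0 h1; set A := g 0 _ - _ - _; set B := g 1 _ - _ - _ => h0 h1.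
  rewrite (_ : _ - _ = A * v ord0 0 + B * v ord0 1); last by rewrite /A /B; ring.
  rewrite (le_trans (ler_normD _ _))// !normrM.
  have c0 := coord_enorm v 0; have c1 := coord_enorm v 1.
  have eN : eps / (2 * (enorm v + 1)) * (enorm v + 1) = eps / 2 by field; have := enorm_ge0 v; lra.
  set a := eps / (2 * (enorm v + 1)) in h0 h1 eN; have a0 : 0 < a by rewrite divr_gt0.
  have := ler_pM (normr_ge0 _) (normr_ge0 _) h0 c0.
  have := ler_pM (normr_ge0 _) (normr_ge0 _) h1 c1.
  have E2 : eps * `|t| = 2 * (a * (enorm v + 1) * `|t|) by rewrite eN; field.
  have := mulr_ge0 (ltW a0) (normr_ge0 t); rewrite E2; lra.
Qed.

Lemma grad_dot_hess h x v w :
  grad_dot (fun j x => h 0 j x * v ord0 0 + h 1 j x * v ord0 1) x w = hess h x v w.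
Proof. by rewrite /hess /grad_dot; ring. Qed.

Lemma C2bar_derive2 Om f g h x v : open Om -> C2bar Om f g h -> Om x -> is_derive2 f x v (hess h x v v).
Proof.
move=> oU C2 Ux; exists (fun t => grad_dot g (x + t *: v) v).
have [d d0 hd] := openE_enorm oU Ux; split.
  exists (d / (enorm v + 1)); first by rewrite divr_gt0// ltr_wpDl ?enorm_ge0.
  move=> t td; apply: is_derive_line; apply: (@C1bar_derive Om) => //; first by case: C2.
  apply: hd; rewrite addlK enormZ.
  move: td; rewrite ltr_pdivlMr ?ltr_wpDl ?enorm_ge0//; apply: le_lt_trans.
  by rewrite ler_wpM2l// lerDl.
rewrite -grad_dot_hess; apply: (@is_derive_line _ (fun y => grad_dot g y v)).
by rewrite scale0r addr0; apply: (C1bar_derive _ oU (C1bar_dir _ oU C2)).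
Qed.

End Gradients.

(** * The Hessian *)

Section Hessian.
Context {R : realType}.
Implicit Types (x y z p q e c v w n : plane R) (s t d a r l m k : R) (f : plane R -> R).
Implicit Types (g : 'I_2 -> plane R -> R) (h : 'I_2 -> 'I_2 -> plane R -> R) (Om : set (plane R)).

(** The mean value theorem, applied in direction [i] and then in
    direction [j]. *)
Lemma second_difference Om f g h x (i j : 'I_2) t d : C2bar Om f g h ->
  (forall y, enorm (y - x) < d -> Om y) -> 0 < t -> 2 * t < d ->
  exists2 y, enorm (y - x) < d &
    f (x + t *: delta_mx ord0 i + t *: delta_mx ord0 j) - f (x + t *: delta_mx ord0 i)
    - (f (x + t *: delta_mx ord0 j) - f x) = t * t * h i j y.
Proof.
move=> [[_ _ C1] C2] dOm t0 td; set ei := delta_mx ord0 i : plane R; set ej := delta_mx ord0 j : plane R.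
have small a b : 0 <= a <= t -> 0 <= b <= t -> enorm (a *: ei + b *: ej) < d.
  move=> /andP[a0 a1] /andP[b0 b1]; rewrite (le_lt_trans (enormD _ _))// !enormZ !enorm_delta.
  by rewrite !ger0_norm// !mulr1; lra.
have st s : 0 <= s <= 1 -> 0 <= s * t <= t.
  by move=> /andP[s0 s1]; rewrite mulr_ge0 ?(ltW t0)// ler_piMl// ltW.
have inb s : 0 <= s <= 1 -> Om (x + s *: (t *: ei)) /\ Om (x + s *: (t *: ei) + t *: ej).
  move=> s01; split; apply: dOm.
    rewrite addlK scalerA; have := small _ 0 (st s s01); rewrite scale0r addr0; apply.
    by rewrite lexx ltW.
  by rewrite -(addrA x) addlK scalerA; apply: small (st s s01) _; rewrite (ltW t0) lexx.
have [s s01 E] : exists2 s : R, 0 < s < 1 &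
    (f (x + t *: ei + t *: ej) - f (x + t *: ei)) - (f (x + t *: ej) - f x) =
    t * g i (x + s *: (t *: ei) + t *: ej) - t * g i (x + s *: (t *: ei)).
  apply: (@line_mvt_open _ (fun y => f (y + t *: ej) - f y) x (t *: ei)
    (fun s => t * g i (x + s *: (t *: ei) + t *: ej) - t * g i (x + s *: (t *: ei)))).
  move=> s /inb[U1 U2]; apply: is_deriveB; last by apply: is_derive_scaledir; exact: C1.
  by apply: is_derive_translate; apply: is_derive_scaledir; exact: C1.
have s01' : 0 <= s <= 1 by case/andP: s01 => ? ?; rewrite !ltW.
have [_ _ C2i] := C2 i.
have inb' s' : 0 <= s' <= 1 -> enorm (x + s *: (t *: ei) + s' *: (t *: ej) - x) < d.
  by move=> s'01; rewrite -(addrA x) addlK !scalerA; apply: small; exact: st.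
have [s' s'01 E'] : exists2 s' : R, 0 < s' < 1 &
    g i (x + s *: (t *: ei) + t *: ej) - g i (x + s *: (t *: ei)) =
    t * h i j (x + s *: (t *: ei) + s' *: (t *: ej)).
  apply: line_mvt_open => s' s'01; apply: is_derive_scaledir; apply: C2i.
  by apply: dOm; exact: inb'.
exists (x + s *: (t *: ei) + s' *: (t *: ej)).
  by apply: inb'; case/andP: s'01 => ? ?; rewrite !ltW.
by rewrite E -mulrBr E' mulrA.
Qed.

(** The second difference is symmetric in the two directions, and
    [second_difference] computes it in both orders. *)
Lemma hess_sym_in Om f g h x : open Om -> C2bar Om f g h -> Om x -> h 0 1 x = h 1 0 x.
Proof.
move=> oU C2 Ux; apply/eqP; rewrite -subr_eq0; apply/eqP/norm_small_eq0 => eps e0.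
have [[_ _ _] C2'] := C2.
have e2 : 0 < eps / 2 by rewrite divr_gt0.
have [d0 d00 h0] := C1bar_near oU (C2' 0) Ux e2.
have [d1 d10 h1] := C1bar_near oU (C2' 1) Ux e2.
pose d := Num.min d0 d1; have d_0 : 0 < d by rewrite lt_min d00.
have dOm y : enorm (y - x) < d -> [/\ Om y, `|h 0 1 y - h 0 1 x| < eps / 2 & `|h 1 0 y - h 1 0 x| < eps / 2].
  by rewrite lt_min => /andP[/h0[Uy H0] /h1[_ H1]].
have dOm' y : enorm (y - x) < d -> Om y by move=> /dOm[].
have t0 : 0 < d / 4 by rewrite divr_gt0.
have td : 2 * (d / 4) < d by lra.
have [y yd E] := second_difference 0 1 C2 dOm' t0 td.
have [z zd E'] := second_difference 1 0 C2 dOm' t0 td.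
have Eh : h 0 1 y = h 1 0 z.
  have tt : d / 4 * (d / 4) != 0 by rewrite mulf_neq0// lt0r_neq0.
  apply: (mulfI tt); rewrite -E -E'; rewrite (addrAC x).
  by move: (f _) (f _) (f _) (f _) => *; ring.
have [_ H1 _] := dOm y yd; have [_ _ H2] := dOm z zd.
move: H1 H2; rewrite Eh !ltr_norml ler_norml => /andP[H1 H2] /andP[H3 H4].
apply/andP; split; lra.
Qed.

Lemma eq_on_closure (F G : plane R -> R) Om x : {within closure Om, continuous F} ->
  {within closure Om, continuous G} -> (forall y, Om y -> F y = G y) -> closure Om x -> F x = G x.
Proof.
move=> cF cG FG clx; apply/eqP; rewrite -subr_eq0; apply/eqP/norm_small_eq0 => eps e0.
have e2 : 0 < eps / 2 by rewrite divr_gt0.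
have [d0 d00 h0] := within_enorm cF clx e2; have [d1 d10 h1] := within_enorm cG clx e2.
have [|y Uy] := (closure_enorm Om x).1 clx (Num.min d0 d1); first by rewrite lt_min d00.
rewrite lt_min => /andP[/(h0 _ (subset_closure Uy)) H0 /(h1 _ (subset_closure Uy)) H1].
move: H0 H1; rewrite FG// !ltr_norml ler_norml => /andP[H1 H2] /andP[H3 H4].
apply/andP; split; lra.
Qed.

Lemma hess_sym Om f g h x : open Om -> C2bar Om f g h -> closure Om x -> h 0 1 x = h 1 0 x.
Proof.
move=> oU C2; apply: eq_on_closure; [by case: (C2.2 0)|by case: (C2.2 1)|].
by move=> y; exact: hess_sym_in C2.
Qed.

Lemma hessC Om f g h x v w : open Om -> C2bar Om f g h -> closure Om x -> hess h x v w = hess h x w v.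
Proof. by move=> oU C2 clx; rewrite /hess /grad_dot (hess_sym oU C2 clx); ring. Qed.

(** The Laplacian does not depend on the orthonormal frame. *)
Lemma hess_trace h x e : dotp e e = 1 -> hess h x e e + hess h x (perp e) (perp e) = h 0 0 x + h 1 1 x.
Proof.
move=> e1; rewrite /hess /grad_dot perp0E perp1E; rewrite -[RHS]mulr1 -e1 dotpE; ring.
Qed.

Lemma hessZl h x k v w : hess h x (k *: v) w = k * hess h x v w.
Proof. by rewrite /hess /grad_dot !mxE; ring. Qed.
Lemma hessZr h x k v w : hess h x w (k *: v) = k * hess h x w v.
Proof. by rewrite /hess /grad_dot !mxE; ring. Qed.
Lemma hessDl h x v v' w : hess h x (v + v') w = hess h x v w + hess h x v' w.
Proof. by rewrite /hess /grad_dot !mxE; ring. Qed.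
Lemma hessDr h x v v' w : hess h x w (v + v') = hess h x w v + hess h x w v'.
Proof. by rewrite /hess /grad_dot !mxE; ring. Qed.
Lemma hessNN h x v : hess h x (- v) (- v) = hess h x v v.
Proof. by rewrite /hess /grad_dot !mxE; ring. Qed.
End Hessian.

(** * Boundary charts and Taylor expansion at the boundary *)

Section Charts.
Context {R : realType}.
Implicit Types (x y z p q e c v w n : plane R) (s t d a r l m k eta K : R) (f : plane R -> R).
Implicit Types (g : 'I_2 -> plane R -> R) (h : 'I_2 -> 'I_2 -> plane R -> R) (Om : set (plane R)).

(** The small Lipschitz constant [eta] is what keeps segments and cones inside
    [Om]; the quadratic bound gives an interior tangent disc. *)
Definition chart Om p n eta := exists (phi : R -> R) d K,
  [/\ 0 < d, phi 0 = 0,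
      forall s s', `|s| < d -> `|s'| < d -> `|phi s - phi s'| <= eta * `|s - s'|,
      forall s, `|s| < d -> `|phi s| <= K * s ^+ 2 &
      forall y, enorm (y - p) < d ->
        (Om y <-> dotp (y - p) n < phi (dotp (y - p) (perp n))) /\
        (boundary Om y <-> dotp (y - p) n = phi (dotp (y - p) (perp n)))].

Lemma boundary_open Om p : open Om -> boundary Om p -> ~ Om p.
Proof. by move=> oU [_ nO] Op; apply: nO; move: oU; rewrite openE; apply. Qed.

Lemma closure_boundary Om y : open Om -> (closure Om y <-> Om y \/ boundary Om y).
Proof.
move=> oU; split.
  move=> cy; have [|ny] := pselect (Om y); first by left.
  by right; split => // /interior_subset.
by case=> [/subset_closure //|[]].
Qed.

Lemma C1bar_near_closure Om f g p : C1bar Om f g -> closure Om p -> forall a, 0 < a ->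
  exists2 d : R, 0 < d & forall y, closure Om y -> enorm (y - p) < d ->
    forall i, `|g i y - g i p| < a.
Proof.
move=> [_ cg _] cp a a0.
have [d0 d00 h0] := within_enorm (cg 0) cp a0; have [d1 d10 h1] := within_enorm (cg 1) cp a0.
exists (Num.min d0 d1); first by rewrite lt_min d00.
move=> y cy; rewrite lt_min => /andP[/(h0 _ cy) H0 /(h1 _ cy) H1] -[[|[|//]] i].
- by rewrite (_ : Ordinal i = 0) //; apply/val_inj.
- by rewrite (_ : Ordinal i = 1) //; apply/val_inj.
Qed.

Lemma grad_dot_close g x y a v : (forall i, `|g i y - g i x| < a) ->
  `|grad_dot g y v - grad_dot g x v| <= 2 * a * enorm v.
Proof.
move=> H; rewrite (_ : _ - _ = (g 0 y - g 0 x) * v ord0 0 + (g 1 y - g 1 x) * v ord0 1); last first.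
  by rewrite /grad_dot; ring.
rewrite (le_trans (ler_normD _ _))// !normrM.
have := ler_pM (normr_ge0 _) (normr_ge0 _) (ltW (H 0)) (coord_enorm v 0).
have := ler_pM (normr_ge0 _) (normr_ge0 _) (ltW (H 1)) (coord_enorm v 1).
lra.
Qed.

(** First order expansion at a boundary point from inside: join [p] to
    [y] by going down by [D = 2 |y - p|] along [n], across, and up again.  The chart
    keeps this path in [Om], and on each segment the mean value theorem compares
    the gradient with its value at [p]. *)
Lemma boundary_derivative Om f g p n : open Om -> dotp n n = 1 -> C1bar Om f g ->
  closure Om p -> chart Om p n (1 / 2) -> forall eps, 0 < eps ->
  exists2 d : R, 0 < d & forall y, closure Om y -> enorm (y - p) < d ->
    `|f y - f p - grad_dot g p (y - p)| <= eps * enorm (y - p).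
Proof.
move=> oU n1 C1 cp [phi [d [K [d0 phi0 lip _ ch]]]] eps eps0.
(* the three segments have total length at most 5 |y - p|, and each of the two
   coordinates of the gradient contributes *)
have a0 : 0 < eps / 10 by rewrite divr_gt0.
have [d1 d10 near1] := C1bar_near_closure C1 cp a0.
pose d2 := Num.min d d1 / 4; have d20 : 0 < d2 by rewrite divr_gt0// lt_min d0.
have [d2d d2d1] : 4 * d2 <= d /\ 4 * d2 <= d1.
  by rewrite /d2; split; rewrite mulrC divfK// ge_min lexx ?orbT.
exists d2 => // y cy yd.
have [->|yp] := eqVneq y p.
  by rewrite !subrr enorm0 mulr0 sub0r normrN /grad_dot !mxE !mulr0 addr0 normr0.
set N := enorm (y - p) in yd *.
have N0 : 0 < N by rewrite enorm_gt0// subr_eq0.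
have n1p : dotp (perp n) (perp n) = 1 by rewrite dotp_perp2.
have N3d : 3 * N < d by lra.
have N3d1 : 3 * N < d1 by lra.
set s := dotp (y - p) (perp n); set t := dotp (y - p) n.
have sN : `|s| <= N by exact: dotp_le_unit.
have tN : `|t| <= N by exact: dotp_le_unit.
have tphi : t <= phi s.
  have [H1 H2] := ch y ltac:(by rewrite -/N; lra).
  by have [/H1 /ltW|/H2 E] := (closure_boundary y oU).1 cy; rewrite /t ?E.
have phiN s' : `|s'| <= N -> `|phi s'| <= N / 2.
  move=> s'N; have := lip s' 0; rewrite phi0 !subr0 normr0 => /(_ ltac:(lra) d0); lra.
have inOm q : enorm (q - p) < d -> dotp (q - p) n < phi (dotp (q - p) (perp n)) -> Om q.
  by move=> /ch[[_ H] _]; exact: H.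
pose D := 2 * N.
have nn : enorm n = 1 by exact: unit_enorm.
have inA r : 0 < r <= 1 -> enorm (p + r *: (- D *: n) - p) <= 3 * N /\ Om (p + r *: (- D *: n)).
  move=> /andP[r0 r1]; have rN : r * N <= N by rewrite ger_pMl.
  have rN0 : 0 < r * N by rewrite mulr_gt0.
  have E : enorm (p + r *: (- D *: n) - p) = r * D.
    by rewrite addlK scalerA enormZ nn mulr1 mulrN normrN gtr0_norm// /D; lra.
  have small : enorm (p + r *: (- D *: n) - p) <= 3 * N by rewrite E /D; lra.
  split=> //; apply: inOm; first (by exact: le_lt_trans small N3d); rewrite addlK !dotpl n1 !mulr0 phi0; move: rN0; clear_ineqs; rewrite /D; lra.
have inC r : 0 <= r <= 1 -> enorm (p + (- D *: n) + r *: (y - p) - p) <= 3 * N /\ Om (p + (- D *: n) + r *: (y - p)).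
  move=> /andP[r0 r1]; have rN : r * N <= N by rewrite ger_pMl.
  have rN0 : 0 <= r * N by rewrite mulr_ge0 // ltW.
  have E : p + (- D *: n) + r *: (y - p) - p = r *: (y - p) + (- D *: n).
    by apply/planeP; rewrite !mxE; ring.
  have small : enorm (p + (- D *: n) + r *: (y - p) - p) <= 3 * N.
    rewrite E (le_trans (enormD _ _))// !enormZ nn mulr1 normrN (ger0_norm r0) -/N ger0_norm.
      by move: rN; clear_ineqs; rewrite /D; lra.
    by rewrite mulr_ge0// ltW.
  split=> //; apply: inOm; first (by exact: le_lt_trans small N3d); rewrite E !dotpDl !dotpZl n1 !dotp_perp mulr1 mulr0 addr0 -/s -/t.
  have rsN : `|r * s| <= N.
    by rewrite normrM (ger0_norm r0); apply: le_trans sN; rewrite ler_piMl.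
  have := phiN (r * s) rsN; rewrite ler_norml => /andP[+ _].
  have rt : r * t <= N.
    apply: le_trans (ler_norm _) _; rewrite normrM (ger0_norm r0).
    by apply: le_trans tN; rewrite ler_piMl.
  move: rt N0; clear_ineqs; rewrite /D; lra.
have inB r : 0 <= r < 1 -> enorm (y + (- D *: n) + r *: (D *: n) - p) <= 3 * N /\ Om (y + (- D *: n) + r *: (D *: n)).
  move=> /andP[r0 r1]; have rN : r * N <= N by rewrite ger_pMl// ltW.
  have rN0 : 0 <= r * N by rewrite mulr_ge0 // ltW.
  have E : y + (- D *: n) + r *: (D *: n) - p = (y - p) + ((r - 1) * D) *: n.
    by apply/planeP; rewrite !mxE; ring.
  have small : enorm (y + (- D *: n) + r *: (D *: n) - p) <= 3 * N.
    rewrite E (le_trans (enormD _ _))// !enormZ nn mulr1 -/N.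
    move: r0 r1 rN rN0 N0; clear_ineqs => r0 r1 rN rN0 N0; rewrite ler0_norm /D; nra.
  split=> //; apply: inOm; first (by exact: le_lt_trans small N3d); rewrite E !(dotpDl (y - p)) !dotpZl n1 !dotp_perp mulr1 mulr0 addr0 -/s -/t.
  apply: lt_le_trans tphi; move: r1 N0; clear_ineqs; rewrite gtrDl /D; nra.
have clA : closure Om (p + - D *: n).
  by apply: subset_closure; have [] := inC 0 ltac:(by rewrite lexx ler01); rewrite scale0r addr0.
have clC : closure Om (y + - D *: n).
  apply: subset_closure; have [] := inB 0 ltac:(by rewrite lexx ltr01); by rewrite scale0r addr0.
have [rA rA1 EA] := @seg_mvt R Om f g p (p + - D *: n) oU C1 cp clA
  ltac:(by move=> r /andP[r0 r1]; rewrite addlK; apply: (inA r _).2; rewrite r0 ltW).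
have [rC rC1 EC] := @seg_mvt R Om f g (p + - D *: n) (y + - D *: n) oU C1 clA clC
  ltac:(by move=> r /andP[r0 r1]; rewrite opprD addrACA subrr addr0; apply: (inC r _).2; rewrite !ltW).
have EyD : y - (y + - D *: n) = D *: n by apply/planeP; rewrite !mxE; ring.
have [rB rB1 EB] := @seg_mvt R Om f g (y + - D *: n) y oU C1 clC cy
  ltac:(by move=> r /andP[r0 r1]; rewrite EyD; apply: (inB r _).2; rewrite r1 ltW).
rewrite addlK in EA; rewrite opprD addrACA subrr addr0 in EC; rewrite EyD in EB.
have [sA uA] := inA rA ltac:(by case/andP: rA1 => ? ?; rewrite ltW ?andbT).
have [sC uC] := inC rC ltac:(by case/andP: rC1 => ? ?; rewrite !ltW).
have [sB uB] := inB rB ltac:(by case/andP: rB1 => ? ->; rewrite ltW).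
have D0 : 0 <= D by rewrite mulr_ge0// ltW.
have cl3 q : enorm (q - p) <= 3 * N -> Om q -> forall i, `|g i q - g i p| < eps / 10.
  by move=> qN Uq; apply: near1; [exact: subset_closure|exact: le_lt_trans qN N3d1].
have := grad_dot_close (- D *: n) (cl3 _ sA uA); have := grad_dot_close (y - p) (cl3 _ sC uC).
have := grad_dot_close (D *: n) (cl3 _ sB uB).
rewrite -EA -EB -EC !enormZ nn -/N normrN !(ger0_norm D0) !grad_dotZ.
clear_ineqs.
rewrite !ler_norml /D => /andP[B1 B2] /andP[B3 B4] /andP[B5 B6]; apply/andP; split; lra.
Qed.

End Charts.

(** * Geometric and first order consequences of a chart *)

Section ChartConsequences.
Context {R : realType}.
Implicit Types (x y z p q e c v w n : plane R) (s t d a r l m k eta K : R) (f : plane R -> R).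
Implicit Types (g : 'I_2 -> plane R -> R) (h : 'I_2 -> 'I_2 -> plane R -> R) (Om : set (plane R)).

Lemma chart_line Om p n eta w b : chart Om p n eta -> 0 < b -> b <= `|dotp w n| ->
  exists2 d, 0 < d & forall t, 0 < t < d ->
    (dotp w n < 0 -> Om (p + t *: w)) /\ (0 < dotp w n -> ~ closure Om (p + t *: w)).
Proof.
move=> [phi [d [K [d0 phi0 _ quad ch]]]] b0 bw.
pose S := dotp w (perp n).
pose D := Num.min (d / (enorm w + `|S| + 1)) (b / (`|K| * S ^+ 2 + 1)).
have p1 : 0 < enorm w + `|S| + 1 by have := enorm_ge0 w; have := normr_ge0 S; lra.
have p2 : 0 < `|K| * S ^+ 2 + 1 by have := mulr_ge0 (normr_ge0 K) (sqr_ge0 S); lra.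
exists D; first by rewrite lt_min !divr_gt0.
move=> t /andP[t0]; rewrite lt_min ltr_pdivlMr// ltr_pdivlMr// => /andP[t1 t2].
have tw : 0 <= t * enorm w by rewrite mulr_ge0 ?enorm_ge0// ltW.
have tS : 0 <= t * `|S| by rewrite mulr_ge0// ltW.
have yd : enorm (p + t *: w - p) < d by rewrite addlK enormZ gtr0_norm//; lra.
have := quad (t * S); rewrite normrM (gtr0_norm t0) => /(_ ltac:(lra)) qu.
have KK : K * (t * S) ^+ 2 <= t * (t * (`|K| * S ^+ 2)).
  rewrite exprMn (_ : t * _ = `|K| * (t ^+ 2 * S ^+ 2)); last ring.
  by apply: ler_wpM2r (ler_norm K); exact: mulr_ge0 (sqr_ge0 _) (sqr_ge0 _).
have KB : t * (t * (`|K| * S ^+ 2)) < t * b by rewrite ltr_pM2l//; lra.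
have {qu} : `|phi (t * S)| < t * b by lra.
have [H1 H2] := ch _ yd; move: H1 H2; rewrite addlK !dotpZl -/S ltr_norml => H1 H2 /andP[B1 B2].
split=> wn.
  apply/H1; apply: le_lt_trans B1; rewrite -mulrN ler_pM2l//.
  by move: bw; rewrite ltr0_norm//; lra.
have bt : t * b <= t * dotp w n by rewrite ler_pM2l//; move: bw; rewrite gtr0_norm.
move=> cl; have [Ho|nO] := pselect (Om (p + t *: w)); first by have /H1 := Ho; lra.
have /H2 : boundary Om (p + t *: w) by split => // /interior_subset.
lra.
Qed.

Lemma chart_inside Om p n eta w : chart Om p n eta -> dotp w n < 0 ->
  exists2 d, 0 < d & forall t, 0 < t < d -> Om (p + t *: w).
Proof.
move=> ch wn; have [| |d d0 hd] := @chart_line Om p n eta w (- dotp w n) ch; first lra.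
  by rewrite ltr0_norm.
by exists d => // t /hd[/(_ wn)].
Qed.

Lemma chart_outside Om p n eta w : chart Om p n eta -> 0 < dotp w n ->
  exists2 d, 0 < d & forall t, 0 < t < d -> ~ closure Om (p + t *: w).
Proof.
move=> ch wn; have [|d d0 hd] := @chart_line Om p n eta w (dotp w n) ch wn; first by rewrite gtr0_norm.
by exists d => // t /hd[_ /(_ wn)].
Qed.

Lemma interior_ball Om p n eta : dotp n n = 1 -> chart Om p n eta ->
  exists2 r0, 0 < r0 & forall r, 0 < r < r0 -> forall y, enorm (y - (p - r *: n)) < r -> Om y.
Proof.
move=> n1 [phi [d [K [d0 phi0 _ quad ch]]]].
exists (Num.min (d / 2) (1 / (2 * (`|K| + 1)))).
  by rewrite lt_min !divr_gt0// mulr_gt0// ltr_wpDl.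
move=> r /andP[r0]; rewrite lt_min => /andP[rd]; rewrite ltr_pdivlMr ?mulr_gt0 ?ltr_wpDl// => rK y yr.
have nn : enorm n = 1 by exact: unit_enorm.
have yp : enorm (y - p) < d.
  apply: le_lt_trans (enorm_tri (p - r *: n) _ _) _.
  have -> : p - r *: n - p = - (r *: n) by rewrite addlK.
  by rewrite enormN enormZ nn mulr1 gtr0_norm//; lra.
apply: (ch y yp).1.2.
have n1p : dotp (perp n) (perp n) = 1 by rewrite dotp_perp2.
have sd : `|dotp (y - p) (perp n)| < d by apply: le_lt_trans yp; exact: dotp_le_unit.
have := quad _ sd; move: yr; rewrite enorm_lt//.
have -> : y - (p - r *: n) = (y - p) + r *: n by apply/planeP; rewrite !mxE; ring.
rewrite (dotp_frame _ _ n1) !(dotpDl (y - p)) !dotpZl n1 dotp_perp mulr0 addr0 mulr1.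
move: (dotp _ (perp n)) (dotp _ n) => s t yr /ler_normlP[q1 q2].
have KK : K * s ^+ 2 <= `|K| * s ^+ 2 by rewrite ler_wpM2r ?sqr_ge0 ?ler_norm.
have t0 : t < 0 by have := sqr_ge0 s; have := sqr_ge0 t; rewrite !expr2; nra.
have h1 : s ^+ 2 < - 2 * r * t by have := sqr_ge0 t; rewrite !expr2; nra.
have h2 : `|K| * s ^+ 2 < - t.
  have K0 := normr_ge0 K.
  have : `|K| * s ^+ 2 <= `|K| * (- 2 * r * t) by rewrite ler_wpM2l// ltW.
  have : 0 < r * - t by rewrite mulr_gt0// oppr_gt0.
  have : 2 * r * `|K| < 1 by nra.
  nra.
lra.
Qed.

(** The curve [s |-> p + s *: perp n + phi s *: n] runs in the boundary and is
    tangent to [perp n] at [p], because [phi] is quadratic. *)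
Lemma tangential_max Om f g p n : open Om -> dotp n n = 1 -> C1bar Om f g -> boundary Om p ->
  chart Om p n (1 / 2) ->
  (exists2 d, 0 < d & forall y, boundary Om y -> enorm (y - p) < d -> f y <= f p) ->
  grad_dot g p (perp n) = 0.
Proof.
move=> oU n1 C1 bp ch [d1 d10 fmax].
have H := boundary_derivative oU n1 C1 bp.1 ch.
have [phi [d [K [d0 phi0 lip quad chK]]]] := ch.
set T := grad_dot g p (perp n); set N := grad_dot g p n.
have main eps : 0 < eps -> exists2 s0, 0 < s0 & forall s, `|s| < s0 -> s * T <= eps * `|s|.
  move=> e0; have [d2 d20 hd2] := H (eps / 4) ltac:(by rewrite divr_gt0).
  pose D := Num.min (Num.min d d1) d2 / 2; have D0 : 0 < D by rewrite divr_gt0// !lt_min d0 d10.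
  have [Dd Dd1 Dd2] : [/\ 2 * D <= d, 2 * D <= d1 & 2 * D <= d2].
    by rewrite /D; split; rewrite mulrC divfK// !ge_min lexx ?orbT.
  exists (Num.min D (eps / (2 * (`|K| * `|N| + 1)))).
    by rewrite lt_min D0 divr_gt0// mulr_gt0// ltr_wpDl ?mulr_ge0.
  move=> s; rewrite lt_min => /andP[sD]; rewrite ltr_pdivlMr ?mulr_gt0 ?ltr_wpDl ?mulr_ge0// => sK.
  have sd : `|s| < d by lra.
  have := lip s 0 sd; rewrite normr0 phi0 !subr0 => /(_ d0) ps.
  pose y := p + (s *: perp n + phi s *: n).
  have n1p : dotp (perp n) (perp n) = 1 by rewrite dotp_perp2.
  have yN : enorm (y - p) <= 2 * `|s|.
    rewrite /y addlK (le_trans (enormD _ _))// !enormZ (unit_enorm n1) (unit_enorm n1p); have := normr_ge0 s; lra.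
  have yb : boundary Om y.
    apply: (chK y _).2.2; first lra.
    by rewrite /y addlK !dotpDl !dotpZl n1 n1p dotp_perp dotp_perpl !mulr0 !mulr1 add0r addr0.
  have yd1 : enorm (y - p) < d1 by apply: le_lt_trans yN _; lra.
  have yd2 : enorm (y - p) < d2 by apply: le_lt_trans yN _; lra.
  have := hd2 y yb.1 yd2; have := fmax y yb yd1.
  rewrite /y addlK grad_dotD !grad_dotZ -/T -/N ler_norml -/y => fy /andP[B1 B2].
  have B3 : `|phi s * N| <= `|s| * (`|K| * `|N| * `|s|).
    rewrite normrM; have := quad s sd; rewrite -real_normK ?num_real// => q.
    have q2 : K * `|s| ^+ 2 <= `|K| * `|s| ^+ 2 by rewrite ler_wpM2r ?sqr_ge0 ?ler_norm.
    have := ler_wpM2r (normr_ge0 N) (le_trans q q2); move/le_trans; apply.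
    by rewrite le_eqVlt; apply/orP; left; apply/eqP; ring.
  have B4 : `|s| * (`|K| * `|N| * `|s|) <= `|s| * (eps / 2) by rewrite ler_wpM2l//; have := normr_ge0 s; lra.
  have B5 : eps / 4 * enorm (s *: perp n + phi s *: n) <= eps / 4 * (2 * `|s|).
    by rewrite ler_pM2l ?divr_gt0//; move: yN; rewrite /y addlK.
  move: B3; rewrite ler_norml => /andP[B3 _]; lra.
apply: norm_small_eq0 => eps e0; have [s0 s00 hs] := main eps e0.
have s2 : 0 < s0 / 2 by rewrite divr_gt0.
have := hs (s0 / 2); have := hs (- (s0 / 2)); rewrite normrN gtr0_norm// => h1 h2.
have {}h1 := h1 ltac:(lra); have {}h2 := h2 ltac:(lra).
rewrite ler_norml; apply/andP; split.
- by rewrite -(ler_pM2l s2); lra.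
- by rewrite -(ler_pM2l s2); lra.
Qed.

(** Along the boundary the gradient is [- gam] times a unit normal [m],
    so the product of its component on [n] with [- gam] is [gam ^ 2 * dotp m n], which
    is maximal at [p], where [m = n]; hence its tangential derivative vanishes
    there.  If [gam = 0], every component of the gradient vanishes on the
    boundary. *)
Lemma hess_normal_tangent Om f g h p n (gam : R) : open Om -> dotp n n = 1 -> C2bar Om f g h ->
  boundary Om p -> chart Om p n (1 / 2) ->
  (forall w, grad_dot g p w = - gam * dotp n w) ->
  (exists2 d, 0 < d & forall y, boundary Om y -> enorm (y - p) < d ->
     exists2 m, dotp m m = 1 & forall w, grad_dot g y w = - gam * dotp m w) ->
  hess h p n (perp n) = 0 /\ (gam = 0 -> forall w, hess h p w (perp n) = 0).
Proof.
move=> oU n1 C2 bp ch gp [d d0 gy].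
have G0 : gam = 0 -> forall w, hess h p w (perp n) = 0.
  move=> E w; rewrite -grad_dot_hess.
  apply: (tangential_max oU n1 (C1bar_dir w oU C2) bp ch); exists d => // y by_ yd.
  by have [m m1 ->] := gy y by_ yd; rewrite gp E !oppr0 !mul0r.
split=> //; have [E|g0] := eqVneq gam 0; first exact: G0.
apply: (mulfI g0); rewrite mulr0; apply: oppr_inj; rewrite oppr0 -mulNr -hessZl -grad_dot_hess.
apply: (tangential_max oU n1 (C1bar_dir _ oU C2) bp ch); exists d => // y by_ yd.
have [m m1 ->] := gy y by_ yd; rewrite gp !dotpZr n1 mulr1.
have := dotp_le m n; rewrite (unit_enorm m1) (unit_enorm n1) mulr1 => /(le_trans (ler_norm _)) mn.
have : 0 <= gam ^+ 2 * (1 - dotp m n) by rewrite mulr_ge0 ?sqr_ge0 ?subr_ge0.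
lra.
Qed.

End ChartConsequences.

(** * Reflections and reflection differences *)

Section Reflection.
Context {R : realType}.
Implicit Types (x y z p q e c u n : plane R) (s t d a r l m k : R) (v w f : plane R -> R).

Definition refl e l y : plane R := y - (2 * (dotp y e - l)) *: e.

Lemma refl_side e l y : dotp e e = 1 -> dotp (refl e l y) e = 2 * l - dotp y e.
Proof. by move=> e1; rewrite /refl !dotpl e1; ring. Qed.
Lemma reflK e l y : dotp e e = 1 -> refl e l (refl e l y) = y.
Proof.
by move=> e1; rewrite {1}/refl refl_side// /refl; apply/planeP; rewrite !mxE; ring.
Qed.
Lemma refl_on e l y : dotp y e = l -> refl e l y = y.
Proof. by rewrite /refl => ->; rewrite subrr mulr0 scale0r subr0. Qed.
Lemma reflN e l y : refl (- e) (- l) y = refl e l y.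
Proof. by apply/planeP; rewrite /refl !plE; ring. Qed.
Lemma refl_add e l y u : refl e l (y + u) = refl e l y + refl e 0 u.
Proof. by apply/planeP; rewrite /refl !plE; ring. Qed.
Lemma refl0Z e k u : refl e 0 (k *: u) = k *: refl e 0 u.
Proof. by apply/planeP; rewrite /refl !plE; ring. Qed.
Lemma refl0_dot e u u' : dotp e e = 1 -> dotp (refl e 0 u) (refl e 0 u') = dotp u u'.
Proof. by move=> e1; rewrite /refl !dotpl e1 (dotpC e u'); ring. Qed.
Lemma refl0_dotC e u u' : dotp (refl e 0 u) u' = dotp u (refl e 0 u').
Proof. by rewrite /refl !dotpl (dotpC e u'); ring. Qed.
Lemma refl0K e u : dotp e e = 1 -> refl e 0 (refl e 0 u) = u. Proof. exact: reflK. Qed.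
Lemma refl_dist e l y z : dotp e e = 1 -> enorm (refl e l y - refl e l z) = enorm (y - z).
Proof.
move=> e1; have -> : refl e l y - refl e l z = refl e 0 (y - z).
  by apply/planeP; rewrite /refl !plE; ring.
by rewrite /enorm refl0_dot.
Qed.
Lemma refl_dist_on e l y c : dotp e e = 1 -> dotp c e = l -> enorm (refl e l y - c) = enorm (y - c).
Proof. by move=> e1 ce; rewrite -{1}(refl_on ce) refl_dist. Qed.
Lemma refl0e e : dotp e e = 1 -> refl e 0 e = - e.
Proof. by move=> e1; rewrite /refl e1; apply/planeP; rewrite !mxE; ring. Qed.
Lemma refl0perp e : refl e 0 (perp e) = perp e.
Proof. by rewrite refl_on// dotp_perpl. Qed.

Lemma refl_continuous e l f : dotp e e = 1 -> continuous f -> continuous (fun y => f (refl e l y)).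
Proof.
move=> e1 cf y; apply: enorm_continuous => a a0.
have [d d0 hd] := continuous_enorm (cf (refl e l y)) a0.
by exists d => // z zy; apply: hd; rewrite refl_dist.
Qed.

Definition wdiff v e l y := v (refl e l y) - v y.

Lemma wdiff_continuous v e l : dotp e e = 1 -> continuous v -> continuous (wdiff v e l).
Proof. by move=> e1 cv; exact: (continuous_sub (refl_continuous (l := l) e1 cv) cv). Qed.
Lemma wdiff_refl v e l y : dotp e e = 1 -> wdiff v e l (refl e l y) = - wdiff v e l y.
Proof. by move=> e1; rewrite /wdiff reflK// opprB. Qed.

Lemma is_derive2_refl v e l y u a : is_derive2 v (refl e l y) (refl e 0 u) a -> is_derive2 (fun y => v (refl e l y)) y u a.
Proof.
move=> [df [[d d0 hd] h0]]; exists df; split=> //; exists d => // t /hd.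
rewrite (_ : (fun s => v (refl e l (y + s *: u))) = (fun s => v (refl e l y + s *: refl e 0 u)))//.
by apply/funext => s; rewrite refl_add refl0Z.
Qed.

End Reflection.

Section Solutions.
Context {R : realType}.
Implicit Types (x y z p q e c u n : plane R) (s t d a r l m k M : R) (v w f : plane R -> R).

(** For the extended function of the problem, this is the ring domain. *)
Definition mid v M := [set x : plane R | 0 < v x < M].

(** What the moving plane method uses of the overdetermined problem.  The
    Neumann datum [gam] depends only on the level of [v] at the boundary point,
    [sol_chart] is the regularity of the boundary with outer normal [nu], and
    [sol_conn] says that the domain is connected.  The fields are arranged so as to
    be invariant under [solution_dual]. *)
Record solution v M k (g : 'I_2 -> plane R -> R) (h : 'I_2 -> 'I_2 -> plane R -> R)
  (nu : plane R -> plane R) (gam : R -> R) : Prop := Solution {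
  sol_M : 0 < M;
  sol_cont : continuous v;
  sol_range : forall x, 0 <= v x <= M;
  sol_C2 : C2bar (mid v M) v g h;
  sol_lap : forall x, mid v M x -> h 0 0 x + h 1 1 x = k;
  sol_k : k != 0;
  sol_nu : forall p, boundary (mid v M) p -> dotp (nu p) (nu p) = 1;
  sol_chart : forall p, boundary (mid v M) p -> forall eta, 0 < eta -> chart (mid v M) p (nu p) eta;
  sol_grad : forall p, boundary (mid v M) p -> forall u, grad_dot g p u = - gam (v p) * dotp (nu p) u;
  sol_conn : forall S, open S -> S !=set0 -> S `<=` mid v M ->
    (forall x, mid v M x -> closure S x -> S x) -> mid v M `<=` S }.

Lemma mid_dual v M : mid (fun x => M - v x) M = mid v M.
Proof.
apply/seteqP; split => x /=; rewrite /mid /= subr_gt0 gtrBl => /andP[-> ->] //.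
Qed.

Lemma grad_dot_opp (g : 'I_2 -> plane R -> R) x u : grad_dot (fun i x => - g i x) x u = - grad_dot g x u.
Proof. by rewrite /grad_dot; ring. Qed.

Lemma within_opp (A : set (plane R)) f a : {within A, continuous f} -> {within A, continuous (fun x => a - f x)}.
Proof.
move=> cf; apply: enorm_within => p Ap b b0; have [d d0 hd] := within_enorm cf Ap b0.
by exists d => // y Ay yd; rewrite (_ : _ - _ = - (f y - f p)) ?normrN ?hd//; ring.
Qed.

Lemma C1bar_opp Om f g a : C1bar Om f g -> C1bar Om (fun x => a - f x) (fun i x => - g i x).
Proof.
move=> [cf cg df]; split.
- exact: within_opp.
- by move=> i; have := within_opp (a := 0) (cg i); under eq_fun do rewrite sub0r.
- move=> i x Ux; rewrite -[X in is_derive _ _ _ X]sub0r.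
  by have := df i x Ux => ?; apply: is_deriveB.
Qed.

(** Exchanging the levels [0] and [M] exchanges the inner and outer boundary
    curves, so that every statement about level [0] has a counterpart at level
    [M]. *)
Lemma solution_dual v M k g h nu gam : solution v M k g h nu gam ->
  solution (fun x => M - v x) M (- k) (fun i x => - g i x) (fun i j x => - h i j x) nu (fun s => - gam (M - s)).
Proof.
move=> [M0 cv vr C2 lap k0 nu1 ch gr cn]; split; rewrite ?mid_dual ?oppr_eq0 //.
- exact: (continuous_sub (@continuous_const R M) cv).
- by move=> x; have /andP[h1 h2] := vr x; rewrite subr_ge0 h2 /=; lra.
- split; first exact: C1bar_opp C2.1.
  move=> i; have := C1bar_opp 0 (C2.2 i); under eq_fun do rewrite sub0r; exact.
- by move=> x /lap <-; rewrite opprD.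
- by move=> p bp u; rewrite grad_dot_opp gr// opprB addrC subrK; ring.
Qed.

(** The inequality carried by the moving line. *)
Definition mono v e l := forall y, l < dotp y e -> v y <= v (refl e l y).

Lemma mono_dual v M e l : dotp e e = 1 -> mono v e l -> mono (fun x => M - v x) (- e) (- l).
Proof.
move=> e1 mo y; rewrite dotpNr ltrN2 => yl; rewrite reflN lerD2l lerN2.
have := mo (refl e l y); rewrite reflK// refl_side//; apply; lra.
Qed.

Lemma mono_ge0 v e l y : mono v e l -> l <= dotp y e -> 0 <= wdiff v e l y.
Proof.
move=> mo; rewrite le_eqVlt => /orP[/eqP E|yl]; first by rewrite /wdiff refl_on// subrr.
by rewrite subr_ge0 mo.
Qed.

Section ReflectionDifference.
Variables (v : plane R -> R) (M k : R) (g : 'I_2 -> plane R -> R) (h : 'I_2 -> 'I_2 -> plane R -> R)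
  (nu : plane R -> plane R) (gam : R -> R).
Hypothesis (sol : solution v M k g h nu gam).
Variables (e : plane R).
Hypothesis (e1 : dotp e e = 1).
Notation Om := (mid v M).
Let cv : continuous v := sol_cont sol.

Lemma mid_open : open Om.
Proof.
apply: enorm_open => p /andP[p0 pM].
have [d d0 hd] := near_and (cont_gt (@cv p) p0) (cont_lt (@cv p) pM).
by exists d => // y /hd[h1 h2]; apply/andP.
Qed.

Lemma wdiff_lap l y : Om y -> Om (refl e l y) -> lap_le (wdiff v e l) y e 0.
Proof.
move=> Uy Uy'; exists (hess h (refl e l y) e e - hess h y e e),
  (hess h (refl e l y) (perp e) (perp e) - hess h y (perp e) (perp e)); split.
- apply: is_derive2B; last exact: C2bar_derive2 mid_open (sol_C2 sol) Uy.
  apply: is_derive2_refl; rewrite refl0e// -hessNN.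
  exact: C2bar_derive2 mid_open (sol_C2 sol) Uy'.
- apply: is_derive2B; last exact: C2bar_derive2 mid_open (sol_C2 sol) Uy.
  apply: is_derive2_refl; rewrite refl0perp.
  exact: C2bar_derive2 mid_open (sol_C2 sol) Uy'.
- have := hess_trace h y e1; have := hess_trace h (refl e l y) e1.
  rewrite !(sol_lap sol)//; lra.
Qed.

Lemma wdiff_is_derive l y u : Om y -> Om (refl e l y) ->
  is_derive y u (wdiff v e l) (grad_dot g (refl e l y) (refl e 0 u) - grad_dot g y u).
Proof.
move=> Uy Uy'; have D1 := C1bar_derive u mid_open (sol_C2 sol).1 Uy.
have D2 := C1bar_derive (refl e 0 u) mid_open (sol_C2 sol).1 Uy'.
have D3 : is_derive y u (fun y => v (refl e l y)) (grad_dot g (refl e l y) (refl e 0 u)).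
  apply/is_deriveP => eps e0; have [d d0 hd] := (is_deriveP _ _ _ _).1 D2 eps e0.
  by exists d => // t /hd; rewrite refl_add refl0Z.
exact: is_deriveB D3 D1.
Qed.

Lemma mid_ends y : ~ Om y -> v y = 0 \/ v y = M.
Proof.
rewrite /mid /= => /negP; rewrite negb_and -!leNgt; have /andP[z0 zM] := sol_range sol y.
by case/orP => H; [left|right]; apply/eqP; rewrite eq_le ?z0 ?H ?zM.
Qed.

(** On this open set the reflection difference is harmonic, nonnegative and
    differentiable: the hypotheses of the strong minimum principle. *)
Lemma wdiff_superharmonic l : mono v e l -> let U := [set y | l < dotp y e] `&` (Om `&` [set y | Om (refl e l y)]) in
  open U /\ forall y, U y -> [/\ 0 <= wdiff v e l y, lap_le (wdiff v e l) y e 0 &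
     forall u, derivable (wdiff v e l) y u].
Proof.
move=> mo U; split.
  apply: enorm_open => p [/= p1 [p2 p3]].
  have [d1 d10 h1] := cont_gt (@dotp_continuous R e p) p1.
  have [d2 d20 h2] := openE_enorm mid_open p2; have [d3 d30 h3] := openE_enorm mid_open p3.
  exists (Num.min d1 (Num.min d2 d3)); first by rewrite !lt_min d10 d20.
  move=> y; rewrite !lt_min => /and3P[/h1 y1 /h2 y2 y3]; split=> //; split=> //=.
  by apply: h3; rewrite refl_dist.
move=> y [/= y1 [y2 y3]]; split; [by apply: mono_ge0 => //; exact: ltW|exact: wdiff_lap|].
by move=> u; have [] := wdiff_is_derive u y2 y3.
Qed.

End ReflectionDifference.
End Solutions.

(** * Symmetry, or a strict inequality *)

Lemma convex_lt (R : realType) (a b d t : R) : 0 <= t <= 1 -> a < d -> b < d -> (1 - t) * a + t * b < d.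
Proof.
move=> /andP[t0 t1] ad bd; rewrite -subr_gt0.
have -> : d - ((1 - t) * a + t * b) = (1 - t) * (d - a) + t * (d - b) by ring.
have [t2|t2] := leP t (1 / 2).
  by apply: ltr_wpDr; rewrite ?mulr_ge0 ?mulr_gt0 ?subr_ge0 ?subr_gt0 ?(ltW bd)//; lra.
by apply: ltr_wpDl; rewrite ?mulr_ge0 ?mulr_gt0 ?subr_ge0 ?subr_gt0 ?(ltW ad)//; lra.
Qed.

Section HalfPlane.
Context {R : realType}.
Implicit Types (x y z p q u n : plane R) (s t d a r m : R).
Variables (v : plane R -> R) (M k : R) (g : 'I_2 -> plane R -> R) (h : 'I_2 -> 'I_2 -> plane R -> R)
  (nu : plane R -> plane R) (gam : R -> R).
Hypothesis (sol : solution v M k g h nu gam).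
Variables (e : plane R) (l : R).
Hypothesis (e1 : dotp e e = 1).
Hypothesis (mo : mono v e l).
Notation Om := (mid v M).
Notation w := (wdiff v e l).

(** The zeros of [w] in [Om] are open and closed in [Om].  At a zero off the
    line this is the strong minimum principle; at one on the line, the principle is
    applied in half a disc, starting from a nearby zero off the line.  So
    [w = 0] on [Om] and on its mirror image.  Elsewhere [v] takes only the values [0]
    and [M], so a nonzero value of [w] has modulus [M], and continuity along the
    segment to the line excludes it. *)
Lemma sym_of_zero y0 : l < dotp y0 e -> Om y0 -> Om (refl e l y0) -> w y0 = 0 ->
  forall x, v (refl e l x) = v x.
Proof.
move=> y0l Uy0 Uy0' wy0.
have cw : continuous w by apply: wdiff_continuous => //; exact: (sol_cont sol).
have [oU hU] := wdiff_superharmonic sol e1 mo; set U := (X in open X) in oU hU.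
pose A := [set y | Om y /\ w y = 0].
have Ar y : A y -> A (refl e l y).
  move=> [Uy wy]; split; last by rewrite wdiff_refl// wy oppr0.
  by move: Uy wy; rewrite /mid /= /wdiff => H /eqP; rewrite subr_eq0 => /eqP ->.
have Anear d x : (forall y, enorm (y - x) < d -> A y) -> 0 < d -> nbhs x A.
  by move=> H d0; apply/nbhs_enorm; exists d.
have Aright x : A x -> l < dotp x e -> nbhs x A.
  move=> Ax xl; have [Ux' _] := Ar _ Ax; have [Ux wx] := Ax.
  have [d d0 hd] := strong_min_local e1 cw oU hU (conj xl (conj Ux Ux')) wx.
  have [d' d'0 hd'] := openE_enorm (mid_open sol) Ux.
  apply: (Anear (Num.min d d')); last by rewrite lt_min d0.
  by move=> y; rewrite lt_min => /andP[/hd ? /hd' ?].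
have Sd x y : nbhs (refl e l x) A -> nbhs x A.
  move=> /nbhs_enorm[d d0 hd]; apply/nbhs_enorm; exists d => // z zx.
  by rewrite -(reflK l z e1); apply/Ar/hd; rewrite refl_dist.
have Aside x : A x -> dotp x e != l -> nbhs x A.
  rewrite neq_lt => Ax /orP[xl|]; last exact: Aright.
  by apply: Sd => //; apply: Aright; [exact: Ar|rewrite refl_side//; lra].
have cl0 x : closure A° x -> w x = 0.
  move=> cx; apply/eqP/negPn/negP => wx.
  have [d d0 hd] := continuous_enorm (cw x) (a := `|w x|) ltac:(by rewrite normr_gt0).
  have [z /interior_subset[_ wz] /hd] := (closure_enorm _ _).1 cx d d0.
  by rewrite wz sub0r normrN ltxx.
have OmA : Om `<=` A°.
  apply: (sol_conn sol); first exact: open_interior.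
  - by exists y0; apply: Aright.
  - by move=> x /interior_subset[].
  - move=> x Ux cx; have wx := cl0 x cx.
    have [xl|/Aside] := eqVneq (dotp x e) l; last exact.
    have [d d0 hd] := openE_enorm (mid_open sol) Ux.
    have [z0 Sz0 z0d] := (closure_enorm _ _).1 cx d d0.
    have inB y : enorm (y - x) < d -> Om y /\ Om (refl e l y).
      by move=> yd; split; apply: hd; rewrite ?refl_dist_on.
    (* a zero off the line, taken to the right side by reflection if necessary *)
    have [z1 [z1d z1l wz1]] : exists z1, [/\ enorm (z1 - x) < d, l < dotp z1 e & w z1 = 0].
      have [z [zd zl wz]] : exists z, [/\ enorm (z - x) < d, dotp z e != l & w z = 0].
        have [z0l|z0l] := eqVneq (dotp z0 e) l; last by exists z0; split=> //; have /interior_subset[] := Sz0.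
        have /nbhs_enorm[d1 d10 h1] := Sz0.
        pose t := Num.min d1 (d - enorm (z0 - x)) / 2.
        have t0 : 0 < t by rewrite divr_gt0// lt_min d10 subr_gt0.
        have [t1 t2] : t < d1 /\ t < d - enorm (z0 - x).
          have : 2 * t <= d1 by rewrite /t mulrC divfK// ge_min lexx.
          have : 2 * t <= d - enorm (z0 - x) by rewrite /t mulrC divfK// ge_min lexx orbT.
          lra.
        have te : enorm (t *: e) = t by rewrite enormZ (unit_enorm e1) mulr1 gtr0_norm.
        exists (z0 + t *: e); split.
        + by rewrite addrAC (le_lt_trans (enormD _ _))// te; lra.
        + by rewrite dotpDl dotpZl e1 z0l mulr1; apply/eqP; lra.
        + by have [] := h1 (z0 + t *: e); rewrite ?addlK ?te.
      have [zl'|zl'] := ltP l (dotp z e); first by exists z.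
      exists (refl e l z); split; first by rewrite refl_dist_on.
      + by rewrite refl_side//; move: zl zl'; rewrite neq_lt => /orP[|]; lra.
      + by rewrite wdiff_refl// wz oppr0.
    have right y : enorm (y - x) < d -> l < dotp y e -> w y = 0.
      move=> yd yl; apply: (@strong_min_convex R w U e z1 y e1 cw oU hU _ wz1).
      move=> t /andP[t0 t1].
      have E : z1 + t *: (y - z1) - x = (1 - t) *: (z1 - x) + t *: (y - x).
        by apply/planeP; rewrite !mxE; ring.
      have zd : enorm (z1 + t *: (y - z1) - x) < d.
        rewrite E (le_lt_trans (enormD _ _))// !enormZ !ger0_norm ?subr_ge0//.
        by apply: convex_lt => //; rewrite t0.
      have [H1 H2] := inB _ zd; split; last by [].
      rewrite /= -ltrN2; have -> : - dotp (z1 + t *: (y - z1)) e = (1 - t) * - dotp z1 e + t * - dotp y e.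
        by rewrite !dotpl; ring.
      by apply: convex_lt; rewrite ?t0 ?ltrN2.
    apply: (Anear d) => // y yd; split; first by have [] := inB y yd.
    have [yl|yl|yl] := ltgtP (dotp y e) l; last by rewrite /wdiff refl_on// subrr.
    + apply: oppr_inj; rewrite oppr0 -wdiff_refl//; apply: right; rewrite ?refl_dist_on//.
      by rewrite refl_side//; lra.
    + exact: right.
have A0 x : Om x \/ Om (refl e l x) -> w x = 0.
  case=> [/OmA/interior_subset[]//|/OmA/interior_subset[_]].
  by rewrite wdiff_refl// => /eqP; rewrite oppr_eq0 => /eqP.
have M0 := sol_M sol.
have quant x : `|w x| < M -> w x = 0.
  move=> wM; have [Hx|nx] := pselect (Om x); first by apply: A0; left.
  have [Hx|nx'] := pselect (Om (refl e l x)); first by apply: A0; right.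
  move: wM; rewrite /wdiff; case: (mid_ends sol nx) => ->; case: (mid_ends sol nx') => ->; rewrite ?subrr//.
  - by rewrite subr0 gtr0_norm// ltxx.
  - by rewrite sub0r normrN gtr0_norm// ltxx.
move=> x; apply/eqP; rewrite -subr_eq0 -/(w x); apply/eqP.
apply: (@segment_propagate R (fun z => w z = 0) (x - (dotp x e - l) *: e) x).
- by rewrite /wdiff refl_on ?subrr// !dotpl e1; ring.
- move=> t t01 wt; have [d d0 hd] := continuous_enorm (cw (x - (dotp x e - l) *: e + t *: (x - (x - (dotp x e - l) *: e)))) M0.
  by exists d => // t' _ /hd; rewrite wt subr0; exact: quant.
- move=> t t01; move: (_ + t *: _) => z H; apply/eqP/negPn/negP => wz.
  have [d d0 hd] := continuous_enorm (cw z) (a := `|w z|) ltac:(by rewrite normr_gt0).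
  by have [z' /hd + wz'] := H d d0; rewrite wz' sub0r normrN ltxx.
Qed.

Hypothesis pos : forall y, l < dotp y e -> Om y -> Om (refl e l y) -> 0 < w y.

(** On the line [w] vanishes and its derivative along [e] is minus twice that
    of [v]; the Hopf lemma in a disc tangent to the line makes it positive. *)
Lemma hopf_line x : Om x -> dotp x e = l -> grad_dot g x e < 0.
Proof.
move=> Ux xl.
have cw : continuous w by apply: wdiff_continuous => //; exact: (sol_cont sol).
have [d d0 hd] := openE_enorm (mid_open sol) Ux.
pose r := d / 4; have r0 : 0 < r by rewrite divr_gt0.
have cx : enorm (x + r *: e - x) = r by rewrite addlK enormZ (unit_enorm e1) mulr1 gtr0_norm.
have inB y : enorm (y - (x + r *: e)) <= r -> Om y /\ Om (refl e l y).
  move=> yr; have yd : enorm (y - x) < d.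
    by rewrite (le_lt_trans (enorm_tri (x + r *: e) _ _))// cx /r; move: yr; rewrite /r; lra.
  by split; apply: hd; rewrite ?refl_dist_on.
have side y : `|dotp y e - (l + r)| <= enorm (y - (x + r *: e)).
  have := dotp_le_unit (y - (x + r *: e)) e1.
  by rewrite dotpDl dotpNl dotpDl dotpZl e1 xl mulr1.
have [m m0 H] := @hopf_ball R w (x + r *: e) r (- e) e e1 ltac:(by rewrite dotpNl dotpNr opprK) r0 cw
  ltac:(move=> y yr; have [U1 U2] := inB y (ltW yr); split; [exact: (wdiff_lap sol e1 U1 U2)|
    by apply: pos => //; have := side y; rewrite ler_norml => /andP[]; lra])
  ltac:(move=> y yr; apply: mono_ge0 mo _; have := side y; rewrite ler_norml => /andP[]; lra).
have := C1bar_derive e (mid_open sol) (sol_C2 sol).1 Ux; set G := grad_dot g x e.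
move=> /is_deriveP /(_ (m / 4) ltac:(lra))[d1 d10 h1].
pose t := Num.min (r / 10) (d1 / 2).
have t0 : 0 < t by rewrite lt_min !divr_gt0.
have [t1 t2] : t <= r / 10 /\ t <= d1 / 2 by rewrite /t; split; rewrite ge_min lexx ?orbT.
have := H t; rewrite t0 t1 => /(_ isT).
have -> : x + r *: e + (r - t) *: - e = x + t *: e by apply/planeP; rewrite !mxE; ring.
have -> : w (x + t *: e) = v (x + (- t) *: e) - v (x + t *: e).
  rewrite /wdiff /refl dotpDl dotpZl e1 xl; congr (v _ - _).
  by apply/planeP; rewrite !mxE; ring.
have := h1 t; have := h1 (- t); rewrite normrN gtr0_norm// => A1 A2.
have {A1} := A1 ltac:(lra); have {A2} := A2 ltac:(lra).
rewrite !ler_norml => /andP[A1 A2] /andP[A3 A4] A5.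
have : 0 < m * t by rewrite mulr_gt0.
rewrite -(pmulr_llt0 _ t0); lra.
Qed.

End HalfPlane.

(** * Boundary points off the reflection line *)

Section OffLine.
Context {R : realType}.
Implicit Types (x y z p q u n : plane R) (s t d a r m : R).
Variables (v : plane R -> R) (M k : R) (g : 'I_2 -> plane R -> R) (h : 'I_2 -> 'I_2 -> plane R -> R)
  (nu : plane R -> plane R) (gam : R -> R).
Hypothesis (sol : solution v M k g h nu gam).
Variables (e : plane R) (l : R).
Hypothesis (e1 : dotp e e = 1).
Hypothesis (mo : mono v e l).
Notation Om := (mid v M).
Notation w := (wdiff v e l).
Hypothesis pos : forall y, l < dotp y e -> Om y -> Om (refl e l y) -> 0 < w y.

Lemma normal_expansion p : boundary Om p -> v p = 0 -> forall eps, 0 < eps ->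
  exists2 d, 0 < d & forall t, 0 < t < d -> Om (p - t *: nu p) /\ `|v (p - t *: nu p) - gam 0 * t| <= eps * t.
Proof.
move=> bp vp eps e0; have n1 := sol_nu sol bp; have ch := sol_chart sol bp (half_gt0 R).
have [d1 d10 h1] := chart_inside ch (w := - nu p) ltac:(rewrite dotpNl n1; lra).
have [d2 d20 h2] := boundary_derivative (mid_open sol) n1 (sol_C2 sol).1 bp.1 ch e0.
exists (Num.min d1 d2); first by rewrite lt_min d10.
move=> t /andP[t0]; rewrite lt_min => /andP[t1 t2].
have E : p - t *: nu p = p + t *: - nu p by rewrite scalerN.
have Op : Om (p - t *: nu p) by rewrite E; apply: h1; rewrite t0.
have tn : enorm (p - t *: nu p - p) = t by rewrite addlK enormN enormZ (unit_enorm n1) mulr1 gtr0_norm.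
split=> //; have := h2 _ (subset_closure Op); rewrite tn => /(_ t2).
rewrite addlK vp (sol_grad sol bp) vp dotpNr dotpZr n1 mulr1.
by rewrite subr0 mulrN mulNr opprK.
Qed.

(** By [mono], near [x] the domain is contained in its mirror image.  Both
    boundaries pass through [x], so they are tangent there and the normals
    correspond; by the Neumann condition [w] has zero normal derivative at [x].
    The Hopf lemma in an interior tangent disc contradicts this. *)
Lemma no_tangency x : boundary Om x -> v x = 0 -> l < dotp x e -> boundary Om (refl e l x) ->
  v (refl e l x) = 0 -> False.
Proof.
move=> bx vx xl bx' vx'.
have cv : continuous v := sol_cont sol; have M0 := sol_M sol.
have cw : continuous w by apply: wdiff_continuous.
have cr : continuous (fun y => v (refl e l y)) by apply: refl_continuous.
have [d d0 hd] : exists2 d, 0 < d & forall y, enorm (y - x) < d ->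
    [/\ l < dotp y e & (Om y -> Om (refl e l y))].
  have vxM : v x < M by rewrite vx. have vxM' : v (refl e l x) < M by rewrite vx'.
  have [d d0 hd] := near_and (cont_gt (@dotp_continuous R e x) xl) (cont_lt (cr x) vxM').
  exists d => // y /hd[yl yM]; split=> // /andP[y0 _]; apply/andP; split=> //.
  exact: lt_le_trans y0 (mo yl).
set n := nu x; set n' := nu (refl e l x).
have n1 : dotp n n = 1 := sol_nu sol bx; have n1' : dotp n' n' = 1 := sol_nu sol bx'.
have ch := sol_chart sol bx (half_gt0 R); have ch' := sol_chart sol bx' (half_gt0 R).
(* otherwise the direction u enters the domain at x while its image leaves it
   at the image of x *)
have En : refl e 0 n' = n.
  apply/eqP; rewrite -subr_eq0; apply/negPn/negP => /dotp_gt0; set u := refl e 0 n' - n => u0.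
  have uu : dotp u u = 2 - 2 * dotp (refl e 0 n') n.
    have q1 : dotp (refl e 0 n') (refl e 0 n') = 1 by rewrite refl0_dot.
    by rewrite /u; move: (refl e 0 n') q1 => q q1; rewrite !dotpl q1 n1 (dotpC n); ring.
  have un : dotp u n < 0 by rewrite /u dotpDl dotpNl n1; lra.
  have un' : 0 < dotp (refl e 0 u) n'.
    by rewrite refl0_dotC /u dotpDl dotpNl refl0_dot// n1' (dotpC n); lra.
  have [d1 d10 h1] := chart_inside ch un; have [d2 d20 h2] := chart_outside ch' un'.
  pose t := Num.min (Num.min d1 d2) (d / (enorm u + 1)) / 2.
  have N0 : 0 < enorm u + 1 by rewrite ltr_wpDl ?enorm_ge0.
  have t0 : 0 < t by rewrite divr_gt0// !lt_min d10 d20 divr_gt0.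
  have [t1 t2 t3] : [/\ t < d1, t < d2 & t < d / (enorm u + 1)].
    have H a b : 0 < a -> Num.min a b / 2 < a by move=> a0; have : Num.min a b <= a; [rewrite ge_min lexx|lra].
    have tt : 2 * t <= Num.min d1 d2 by rewrite /t mulrC divfK// ge_min lexx.
    have : 2 * t <= d / (enorm u + 1) by rewrite /t mulrC divfK// ge_min lexx orbT.
    by move: tt; rewrite le_min => /andP[] *; split; lra.
  have [_ /(_ (h1 t _)) O] := hd (x + t *: u) ltac:(rewrite addlK enormZ gtr0_norm//;
    move: t3; rewrite ltr_pdivlMr//; have := enorm_ge0 u; nra).
  apply: (h2 t); rewrite ?t0//; apply: subset_closure; rewrite -refl0Z -refl_add.
  by apply: O; rewrite t0.
have [r0 r00 hr] := interior_ball n1 ch.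
pose r := Num.min r0 d / 4; have rr : 0 < r by rewrite divr_gt0// lt_min r00.
have [rr0 rd] : r < r0 /\ 2 * r < d.
  have : 4 * r <= r0 by rewrite /r mulrC divfK// ge_min lexx.
  have : 4 * r <= d by rewrite /r mulrC divfK// ge_min lexx orbT.
  by move=> *; split; lra.
have inB y : enorm (y - (x - r *: n)) <= r -> enorm (y - x) < d.
  move=> yr; rewrite (le_lt_trans (enorm_tri (x - r *: n) _ _))//.
  have -> : x - r *: n - x = - (r *: n) by rewrite addlK.
  by rewrite enormN enormZ (unit_enorm n1) mulr1 gtr0_norm//; lra.
have [m m0 H] := @hopf_ball R w (x - r *: n) r n e e1 n1 rr cw
  ltac:(move=> y yr; have Oy := hr r ltac:(by rewrite rr) y yr;
    have [yl /(_ Oy) Oy'] := hd y (inB y (ltW yr)); split; [exact: (wdiff_lap sol e1 Oy Oy')|exact: pos])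
  ltac:(move=> y yr; apply: mono_ge0 mo _; have [yl _] := hd y (inB y yr); exact: ltW).
have [d1 d10 h1] := normal_expansion bx vx (eps := m / 4) ltac:(lra).
have [d2 d20 h2] := normal_expansion bx' vx' (eps := m / 4) ltac:(lra).
pose t := Num.min (Num.min d1 d2) (r / 5) / 2.
have t0 : 0 < t by rewrite divr_gt0// !lt_min d10 d20 divr_gt0.
have [t1 t2 t3] : [/\ t < d1, t < d2 & t <= r / 10].
  have tt : 2 * t <= Num.min d1 d2 by rewrite /t mulrC divfK// ge_min lexx.
  have : 2 * t <= r / 5 by rewrite /t mulrC divfK// ge_min lexx orbT.
  by move: tt; rewrite le_min => /andP[] *; split; lra.
have := H t; rewrite t0 t3 => /(_ isT).
have -> : x - r *: n + (r - t) *: n = x - t *: n by apply/planeP; rewrite !mxE; ring.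
rewrite /wdiff (refl_add _ _ x) -scalerN refl0Z.
have -> : refl e 0 (- n) = - n'.
  by rewrite -En -scaleN1r refl0Z refl0K// scaleN1r.
rewrite !scalerN.
have [_] := h1 t ltac:(by rewrite t0); have [_] := h2 t ltac:(by rewrite t0).
have : 0 < m * t by rewrite mulr_gt0.
rewrite -/n -/n' !ler_norml => ? /andP[? ?] /andP[? ?] ?; lra.
Qed.

End OffLine.

(** * Boundary points on the reflection line *)

Section OnLine.
Context {R : realType}.
Implicit Types (x y z p q u n : plane R) (s t d a r m : R).
Variables (v : plane R -> R) (M k : R) (g : 'I_2 -> plane R -> R) (h : 'I_2 -> 'I_2 -> plane R -> R)
  (nu : plane R -> plane R) (gam : R -> R).
Hypothesis (sol : solution v M k g h nu gam).
Notation Om := (mid v M).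

Let oU := mid_open sol.

Section AtPoint.
Variable p : plane R.
Hypothesis (bp : boundary Om p) (vp : v p = 0).
Notation n := (nu p).
Let n1 : dotp n n = 1 := sol_nu sol bp.
Let ch := sol_chart sol bp (half_gt0 R).

Lemma near_level0 : exists2 d, 0 < d & forall y, enorm (y - p) < d ->
  v y < M /\ (~ Om y -> v y = 0).
Proof.
have vpM : v p < M by rewrite vp; exact: sol_M sol.
have cv : continuous v := sol_cont sol.
have [d d0 hd] := cont_lt (cv p) vpM; exists d => // y /hd yM; split=> // /(mid_ends sol)[//|].
by move=> E; move: yM; rewrite E ltxx.
Qed.

Lemma grad_p u : grad_dot g p u = - gam 0 * dotp n u.
Proof. by rewrite (sol_grad sol bp) vp. Qed.

Lemma hess_p : hess h p n (perp n) = 0 /\ (gam 0 = 0 -> forall u, hess h p u (perp n) = 0).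
Proof.
apply: (hess_normal_tangent oU n1 (sol_C2 sol) bp ch); first exact: grad_p.
have [d d0 hd] := near_level0; exists d => // y by_ yd; exists (nu y); first exact: (sol_nu sol by_).
have [_ vy] := hd y yd => u; rewrite (sol_grad sol by_) vy//; exact: boundary_open oU by_.
Qed.

Lemma hess_pn e : hess h p e n = dotp e n * hess h p n n.
Proof.
rewrite {1}(frameE e n1) hessDl !hessZl (hessC (perp n) n oU (sol_C2 sol) bp.1) hess_p.1 mulr0 addr0.
by [].
Qed.

(** [v] is nonnegative inside and vanishes at [p]. *)
Lemma gam_ge0 : 0 <= gam 0.
Proof.
rewrite leNgt; apply/negP => g0.
have [d d0 hd] := normal_expansion sol bp vp (eps := - gam 0 / 2) ltac:(lra).
have [] := hd (d / 2) ltac:(by rewrite divr_gt0//=; lra).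
have := sol_range sol (p - (d / 2) *: n) => /andP[v0 _] _.
rewrite ler_norml => /andP[_ H]; have : 0 < - gam 0 * d by rewrite mulr_gt0// oppr_gt0.
lra.
Qed.

(** If the gradient vanishes along the boundary, so do its tangential derivatives,
    and the trace of the Hessian is its normal entry.  Since [v >= 0] near [p], this
    entry cannot be negative. *)
Lemma hess_nn : gam 0 = 0 -> hess h p n n = k /\ 0 < k.
Proof.
move=> g0; have [_ /(_ g0) H0] := hess_p.
have E : hess h p n n = k.
  rewrite -[LHS]addr0 -(H0 (perp n)) hess_trace//.
  apply: (@eq_on_closure _ (fun x => h 0 0 x + h 1 1 x) (fun=> k) Om); last exact: bp.1.
  - have [_ c0 _] := (sol_C2 sol).2 0; have [_ c1 _] := (sol_C2 sol).2 1.
    move=> x; exact: (@continuousD _ _ (subspace (closure Om)) (h 0 0) (h 1 1) x (c0 0 x) (c1 1 x)).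
  - by apply: continuous_subspaceT => x; exact: cst_continuous.
  - exact: sol_lap sol.
split=> //; rewrite lt_neqAle eq_sym (sol_k sol) /= leNgt; apply/negP => kn.
have C1 := C1bar_dir n oU (sol_C2 sol).
have [d1 d10 h1] := boundary_derivative oU n1 C1 bp.1 ch (eps := - k / 2) ltac:(lra).
have [d2 d20 h2] := chart_inside ch (w := - n) ltac:(by rewrite dotpNl n1; lra).
have [t t0 [t1 t2]] := min2 d10 d20.
have nn := unit_enorm n1.
have inO s : 0 < s <= 1 -> Om (p + s *: (- t *: n)).
  move=> /andP[s0 s1]; rewrite scaleNr -scalerN scalerA; apply: h2.
  by rewrite mulr_gt0//= (le_lt_trans _ t2)// ger_pMl.
have Ot : Om (p + - t *: n) by have := inO 1; rewrite scale1r ltr01 lexx; apply.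
have [s /andP[s0 s1] E2] := @seg_mvt R Om v g p (p + - t *: n) oU (sol_C2 sol).1 bp.1 (subset_closure Ot)
  ltac:(by rewrite addlK => s /andP[s0 s1]; apply: inO; rewrite s0 ltW).
rewrite addlK in E2.
have Os := inO s ltac:(by rewrite s0 ltW).
have sn : enorm (p + s *: (- t *: n) - p) = s * t.
  by rewrite addlK scalerA enormZ nn mulr1 mulrN normrN gtr0_norm// mulr_gt0.
have st : s * t < d1 by apply: lt_trans t1; rewrite gtr_pMl.
have := h1 _ (subset_closure Os); rewrite sn => /(_ st).
rewrite grad_dot_hess addlK scalerA hessZr E grad_p g0 oppr0 mul0r subr0 mulrN mulNr opprK.
rewrite ler_norml => /andP[A1 A2].
have /andP[v0 _] := sol_range sol (p + - t *: n).
move: E2; rewrite vp subr0 grad_dotZ scalerA mulrN => E2.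
have st0 : 0 < - k * (s * t) by rewrite !mulr_gt0// oppr_gt0.
have G0 : 0 < grad_dot g (p + - (s * t) *: n) n by lra.
have := mulr_gt0 t0 G0; lra.
Qed.

Variables (e : plane R) (l : R).
Hypothesis (e1 : dotp e e = 1) (mo : mono v e l) (pe : dotp p e = l).

(** Otherwise [p + t *: e] is in the domain while its mirror image
    [p - t *: e] is not even in its closure, against [mono]. *)
Lemma normal_side : 0 <= dotp n e.
Proof.
rewrite leNgt; apply/negP => ne.
have [d1 d10 h1] := chart_inside ch (w := e) ltac:(by rewrite dotpC).
have [d2 d20 h2] := chart_outside ch (w := - e) ltac:(by rewrite dotpNl dotpC; lra).
have [d3 d30 h3] := near_level0.
have [c c0 [c1 c2]] := min2 d10 d20; have [t t0 [t1 t2]] := min2 c0 d30.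
have /andP[v0 vM] := h1 t ltac:(by rewrite t0 (lt_trans t1)).
apply: (h2 t); first by rewrite t0 (lt_trans t1).
have [vM' _] := h3 (p + t *: - e) ltac:(by rewrite addlK enormZ enormN (unit_enorm e1) mulr1 gtr0_norm).
apply/subset_closure/andP; split=> //; apply: lt_le_trans v0 _.
have := mo (y := p + t *: e); rewrite dotpDl dotpZl e1 pe mulr1 ltrDl => /(_ t0).
by rewrite refl_add refl_on// refl0Z refl0e.
Qed.

(** The lemma of Serrin at a corner.  If the line meets the boundary
    orthogonally at [p], the mirror symmetric interior disc is cut in two halves.
    In the half where [l < dotp y e], [half_disc_barrier] gives
    [wdiff >= const * t ^ 2] at points of the corner at distance of order [t] from
    [p].  On the other hand the mean value theorem expresses [wdiff] by the sum of
    the derivatives of [v] along [e] at two mirror points.  These vanish at [p]; the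
    sum cancels the contribution of [hess h p e e], and the mixed derivative
    [hess h p e n] is zero, so that [wdiff] is at most [t ^ 2] times any given
    positive constant, for small [t]. *)
Lemma corner : (forall y, l < dotp y e -> Om y -> Om (refl e l y) -> 0 < wdiff v e l y) ->
  dotp n e != 0.
Proof.
move=> pos; apply/eqP => ne.
have cw : continuous (wdiff v e l) by apply: wdiff_continuous => //; exact: (sol_cont sol).
have [r0 r00 hr] := interior_ball n1 ch.
pose r := r0 / 2; have rr : 0 < r by rewrite divr_gt0.
have inB := hr r ltac:(by rewrite rr /r; lra).
have ce : dotp (p - r *: n) e = l by rewrite dotpDl dotpNl dotpZl ne mulr0 oppr0 addr0.
have inB2 y : enorm (y - (p - r *: n)) < r -> Om y /\ Om (refl e l y).
  by move=> yr; split; apply: inB; rewrite ?refl_dist_on.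
have Hd y : enorm (y - (p - r *: n)) < r -> l < dotp y e ->
    lap_le (wdiff v e l) y e 0 /\ 0 < wdiff v e l y.
  by move=> /inB2[U1 U2] yl; split; [exact: (wdiff_lap sol e1 U1 U2)|exact: pos].
have Hc y : enorm (y - (p - r *: n)) <= r -> l <= dotp y e -> 0 <= wdiff v e l y.
  by move=> _; exact: mono_ge0.
have [m m0 H] := half_disc_barrier e1 rr cw ce Hd Hc.
have C1 := C1bar_dir e oU (sol_C2 sol).
have [d d0 hd] := boundary_derivative oU n1 C1 bp.1 ch (eps := m * r / 6) ltac:(by rewrite divr_gt0// mulr_gt0).
have [t t0 [t1 t2]] := min2 (divr_gt0 d0 (ltr0n _ 4)) (divr_gt0 rr (ltr0n _ 20)).
have nn := unit_enorm n1; have ee := unit_enorm e1.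
have en0 : dotp e n = 0 by rewrite dotpC.
(* the points z +- t *: e are at depth 2 t below p and at distance t from the line *)
pose z := p - (2 * t) *: n.
have dist s : dotp (z + s *: e - (p - r *: n)) (z + s *: e - (p - r *: n)) = s ^+ 2 + (r - 2 * t) ^+ 2.
  have -> : z + s *: e - (p - r *: n) = s *: e + (r - 2 * t) *: n by apply/planeP; rewrite !mxE; ring.
  by rewrite !dotpl e1 n1 ne en0; ring.
have zs s : `|s| <= t -> enorm (z + s *: e - p) <= 3 * t /\ Om (z + s *: e).
  move=> st; split.
    have -> : z + s *: e - p = s *: e - (2 * t) *: n by apply/planeP; rewrite !mxE; ring.
    rewrite (le_trans (enormD _ _))// enormN !enormZ nn ee !mulr1 (gtr0_norm (mulr_gt0 _ t0))//; lra.
  apply: inB; rewrite enorm_lt// dist.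
  have : s ^+ 2 <= t ^+ 2 by rewrite -real_normK ?num_real// ler_pXn2r// nnegrE// ltW.
  have := mulr_gt0 rr t0; nra.
have refl_z s : refl e l (z + s *: e) = z + (- s) *: e.
  rewrite refl_add refl0Z refl0e// scalerN scaleNr refl_on//.
  by rewrite dotpDl dotpNl dotpZl ne pe mulr0 oppr0 addr0.
have ze : dotp (z + t *: e) e = l + t.
  by rewrite !dotpDl dotpNl !dotpZl ne pe e1 mulr0 oppr0 addr0 mulr1.
have := H (z + t *: e); rewrite dist ze.
have -> : m * ((l + t - l) * (r ^+ 2 - (t ^+ 2 + (r - 2 * t) ^+ 2))) = m * (t * (t * (4 * r - 5 * t))) by ring.
have shell_t : 3 / 4 * r ^+ 2 <= t ^+ 2 + (r - 2 * t) ^+ 2 <= r ^+ 2.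
  by move: t0 rr t2; clear_ineqs => *; apply/andP; split; nra.
move=> /(_ shell_t); rewrite lerDl => /(_ (ltW t0)) lower.
have [s s01 E] : exists2 s : R, 0 < s < 1 & wdiff v e l (z + t *: e) - wdiff v e l z =
    grad_dot g (refl e l (z + s *: (t *: e))) (refl e 0 (t *: e)) - grad_dot g (z + s *: (t *: e)) (t *: e).
  apply: (line_mvt_open (D := fun s => grad_dot g (refl e l (z + s *: (t *: e))) (refl e 0 (t *: e)) - grad_dot g (z + s *: (t *: e)) (t *: e))).
  move=> s /andP[s0 s1]; rewrite scalerA.
  have st : `|s * t| <= t by rewrite ger0_norm ?mulr_ge0 ?(ltW t0)// ler_piMl// ltW.
  apply: (wdiff_is_derive sol); first exact: (zs _ st).2.
  by rewrite refl_z; apply: (zs _ _).2; rewrite normrN.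
have wz : wdiff v e l z = 0.
  by rewrite /wdiff refl_on ?subrr// dotpDl dotpNl dotpZl ne pe mulr0 oppr0 addr0.
have /andP[s0 s1] := s01.
have st : `|s * t| <= t by rewrite ger0_norm ?mulr_ge0 ?(ltW t0) ?(ltW s0)// ler_piMl ?ltW.
have [q1 O1] := zs _ st; have [q2 O2] := zs (- (s * t)) ltac:(by rewrite normrN).
move: E; rewrite wz subr0 scalerA refl_z refl0Z refl0e// !grad_dotZ grad_dotN => E.
have mr : 0 <= m * r / 6 by rewrite divr_ge0// mulr_ge0// ltW.
have t3 : 3 * t < d by move: t0 t1; clear_ineqs; lra.
have := le_trans (hd _ (subset_closure O1) (le_lt_trans q1 t3)) (ler_wpM2l mr q1).
have := le_trans (hd _ (subset_closure O2) (le_lt_trans q2 t3)) (ler_wpM2l mr q2).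
rewrite !grad_dot_hess grad_p ne mulr0 !subr0.
have -> : z + (s * t) *: e - p = (s * t) *: e + (- (2 * t)) *: n by apply/planeP; rewrite !mxE; ring.
have -> : z + - (s * t) *: e - p = (- (s * t)) *: e + (- (2 * t)) *: n by apply/planeP; rewrite !mxE; ring.
rewrite !hessDr !hessZr hess_pn en0 mul0r mulr0 !addr0 !ler_norml => /andP[B1 B2] /andP[B3 B4].
have tt : 0 < t * t by rewrite mulr_gt0.
have low2 : 2 * (m * r) * (t * t) <= wdiff v e l (z + t *: e).
  apply: le_trans lower; have : 0 <= (m * (t * t)) * (2 * r - 5 * t).
    by rewrite mulr_ge0 ?mulr_ge0 ?(ltW m0) ?(ltW t0)//; move: t0 t2 rr; clear_ineqs; lra.
  by clear_ineqs; lra.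
have := ler_wpM2l (ltW t0) (lerD B1 B3).
have : 0 < m * r * (t * t) by rewrite !mulr_gt0.
move: B2 B4 low2; rewrite E; clear_ineqs; lra.
Qed.

(** If [gam 0 > 0], the derivative of [v] along [e] is negative at [p], hence
    nearby.  If [gam 0 = 0], it vanishes on the boundary near [p], but its normal
    derivative is close to [dotp e n * k > 0]: it increases up to [0] along the
    normal segment from [y] to the boundary. *)
Lemma descends_near : 0 < dotp n e ->
  exists2 d, 0 < d & forall y, Om y -> enorm (y - p) < d -> grad_dot g y e < 0.
Proof.
move=> ne; have C1 := C1bar_dir e oU (sol_C2 sol).
have := gam_ge0; rewrite le_eqVlt => /orP[/eqP g0|g0].
  have [Hn k0] := hess_nn (esym g0).
  have Hp : hess h p e n = dotp e n * k by rewrite hess_pn Hn.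
  (* an error b on each entry of the Hessian changes its value at (e, n) by at
     most 4 b *)
  pose b := dotp e n * k / 8; have b0 : 0 < b by rewrite divr_gt0// mulr_gt0// dotpC.
  have [d0' d00 h0] := C1bar_near_closure ((sol_C2 sol).2 0) bp.1 b0.
  have [d1' d10 h1] := C1bar_near_closure ((sol_C2 sol).2 1) bp.1 b0.
  have [phi [d [K [dd phi0 lip _ chp]]]] := ch.
  have [d2 d20 h2] := near_level0.
  have [c c0 [cd0 cd1]] := min2 d00 d10; have [c' c'0 [c'c c'd]] := min2 c0 dd.
  have [c3 c30 [c3c' c3d2]] := min2 c'0 d20.
  exists (c3 / 4); first by rewrite divr_gt0.
  move=> y Oy; set N := enorm (y - p) => yd.
  have nn := unit_enorm n1.
  have n1p : dotp (perp n) (perp n) = 1 by rewrite dotp_perp2.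
  set S := dotp (y - p) (perp n); set T := dotp (y - p) n.
  have SN : `|S| <= N by exact: dotp_le_unit.
  have TN : `|T| <= N by exact: dotp_le_unit.
  have N3 : N < c3 := lt_trans yd (quarter_lt c30).
  have Nd : N < d by rewrite (lt_trans N3)// (lt_trans c3c').
  have Tphi : T < phi S by apply: (chp y Nd).1.1.
  have phiN : `|phi S| <= N.
    have := lip S 0; rewrite phi0 !subr0 normr0 => /(_ (le_lt_trans SN Nd) dd) H; apply: le_trans H _; move: SN (normr_ge0 S); clear_ineqs; lra.
  pose r := phi S - T; have r0 : 0 < r by rewrite subr_gt0.
  have r2 : r <= 2 * N by move: phiN TN; clear_ineqs; rewrite !ler_norml /r => /andP[? ?] /andP[? ?]; lra.
  have E (q : R) : y + q *: (r *: n) - p = (y - p) + (q * r) *: n by rewrite scalerA addrAC.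
  have near (q : R) : 0 <= q <= 1 -> enorm (y + q *: (r *: n) - p) < c3.
    move=> /andP[q0 q1]; rewrite E (le_lt_trans (enormD _ _))// enormZ nn mulr1 -/N.
    have : 0 <= q * r <= r by rewrite mulr_ge0 ?(ltW r0)//= ler_piMl// ltW.
    by move: r2 yd; clear_ineqs => ? ? /andP[? ?]; rewrite ger0_norm//; lra.
  have coords (q : R) : dotp (y + q *: (r *: n) - p) n = T + q * r /\
      dotp (y + q *: (r *: n) - p) (perp n) = S.
    by rewrite E !(dotpDl (y - p)) !dotpZl n1 dotp_perp mulr1 mulr0 addr0.
  have inO (q : R) : 0 <= q < 1 -> Om (y + q *: (r *: n)).
    move=> /andP[q0 q1]; have [cn ct] := coords q.
    apply: (chp _ _).1.2; first by apply: lt_trans (near q _) (lt_trans c3c' c'd); rewrite q0 ltW.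
    by rewrite cn ct -ltrBrDl gtr_pMl.
  have by' : boundary Om (y + 1 *: (r *: n)).
    have [cn ct] := coords 1.
    apply: (chp _ _).2.2; first by apply: lt_trans (near 1 _) (lt_trans c3c' c'd); rewrite ler01 lexx.
    by rewrite cn ct mul1r /r addrC subrK.
  have vy' : v (y + 1 *: (r *: n)) = 0.
    apply: (h2 _ _).2 (boundary_open oU by').
    by apply: lt_trans (near 1 _) c3d2; rewrite ler01 lexx.
  have near1 := near 1 ltac:(by rewrite ler01 lexx).
  rewrite scale1r in by' vy' near1.
  have yy : y + r *: n - y = r *: n by rewrite addlK.
  have [q /andP[q0 q1] E3] := @seg_mvt R Om (fun x => grad_dot g x e) _ y (y + r *: n) oU C1
    (subset_closure Oy) by'.1 ltac:(by rewrite yy => q /andP[q0 q1]; apply: inO; rewrite q1 ltW).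
  move: E3; rewrite yy (sol_grad sol by') vy' -g0 oppr0 mul0r grad_dot_hess hessZr sub0r => E3.
  rewrite -oppr_gt0 E3 pmulr_rgt0//.
  have Oq := inO q ltac:(by rewrite q1 ltW).
  have nq := near q ltac:(by rewrite !ltW).
  have nc : enorm (y + q *: (r *: n) - p) < c by rewrite (lt_trans nq)// (lt_trans c3c').
  have G0 := grad_dot_close n (h0 _ (subset_closure Oq) (lt_trans nc cd0)).
  have G1 := grad_dot_close n (h1 _ (subset_closure Oq) (lt_trans nc cd1)).
  move: G0 G1 Hp; rewrite /hess nn mulr1.
  move: (grad_dot (h 0) p n) (grad_dot (h 1) p n) (grad_dot (h 0) _ n) (grad_dot (h 1) _ n) => P0 P1 Q0 Q1 G0 G1 Hp.
  have e0 := coord_enorm e 0; have e1' := coord_enorm e 1; rewrite (unit_enorm e1) in e0 e1'.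
  have M0 := ler_pM (normr_ge0 _) (normr_ge0 _) G0 e0.
  have M1 := ler_pM (normr_ge0 _) (normr_ge0 _) G1 e1'.
  rewrite -!normrM !ler_norml in M0 M1; move: M0 M1 => /andP[M0 _] /andP[M1 _].
  have b2 : 8 * b = dotp e n * k by rewrite /b mulrC divfK.
  by move: b0 M0 M1; clear_ineqs; lra.
have [C _ _] := C1.
have [d d0 hd] := within_enorm C bp.1 (a := gam 0 * dotp n e) ltac:(by rewrite mulr_gt0).
exists d => // y Oy yd; have := hd y (subset_closure Oy) yd.
by rewrite grad_p ltr_norml => /andP[_]; lra.
Qed.

(** A chart whose Lipschitz constant is small with respect to [dotp n e]
    makes [- e] point into the domain. *)
Lemma descending_cone : 0 < dotp n e ->
  exists2 d, 0 < d & forall y s, Om y -> enorm (y - p) < d -> 0 <= s ->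
    enorm (y - s *: e - p) < d -> Om (y - s *: e).
Proof.
move=> ne; have eta0 : 0 < dotp n e / 2 by rewrite divr_gt0.
have [phi [d [K [d0 phi0 lip _ chp]]]] := sol_chart sol bp eta0.
exists d => // y s Oy yd s0 yd'; apply: (chp _ yd').1.2.
have := (chp _ yd).1.1 Oy.
have n1p : dotp (perp n) (perp n) = 1 by rewrite dotp_perp2.
have l1 := le_lt_trans (dotp_le_unit (y - p) n1p) yd.
have l2 := le_lt_trans (dotp_le_unit (y - s *: e - p) n1p) yd'.
have := lip _ _ l2 l1.
have -> : y - s *: e - p = (y - p) - s *: e by rewrite addrAC.
rewrite !(dotpDl (y - p)) !dotpNl !dotpZl.
move: (dotp (y - p) (perp n)) (dotp (y - p) n) => S T.
have -> : `|S - s * dotp e (perp n) - S| = s * `|dotp e (perp n)|.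
  by rewrite addrAC subrr add0r normrN normrM ger0_norm.
have := dotp_le_unit e n1p; rewrite (unit_enorm e1) => q.
have := ler_wpM2l s0 q; rewrite mulr1 => q2 q3 q4.
have q5 : dotp n e / 2 * (s * `|dotp e (perp n)|) <= dotp n e / 2 * s.
  by rewrite ler_wpM2l// ltW.
have q6 : 0 <= dotp n e * s by rewrite mulr_ge0 // ltW.
move: q3; rewrite ler_norml => /andP[q3 _]; rewrite (dotpC e n); lra.
Qed.

(** The segment from [y] to its image is parallel to [- e]: it stays in the
    domain, and [v] increases along it. *)
Lemma stable_on_line : (forall y, l < dotp y e -> Om y -> Om (refl e l y) -> 0 < wdiff v e l y) ->
  exists2 d, 0 < d & forall l' y, `|l' - l| < d -> enorm (y - p) < d -> l' < dotp y e ->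
    v y <= v (refl e l' y).
Proof.
move=> pos; have ne : 0 < dotp n e by rewrite lt_neqAle eq_sym corner// normal_side.
have [d1 d10 h1] := descends_near ne; have [d2 d20 h2] := descending_cone ne.
have [d3 d30 h3] := near_level0.
have [c c0 [cd1 cd2]] := min2 d10 d20; have [c' c'0 [c'c c'd]] := min2 c0 d30.
exists (c' / 6); first by rewrite divr_gt0.
move=> l' y ll yd yl; have [vy0|vy] := leP (v y) 0.
  by apply: le_trans (_ : 0 <= _) => //; have /andP[] := sol_range sol (refl e l' y).
have Oy : Om y by apply/andP; split=> //; apply: (h3 _ _).1; lra.
set s := 2 * (dotp y e - l'); have s0 : 0 < s by rewrite /s; lra.
have sc : s < 4 * (c' / 6).
  have := dotp_le_unit (y - p) e1; rewrite dotpDl dotpNl pe.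
  by move: ll; rewrite ltr_norml ler_norml /s => /andP[? ?] /andP[? ?]; lra.
have near r : 0 <= r <= 1 -> enorm (y + r *: (- s *: e) - p) < c' /\ Om (y + r *: (- s *: e)).
  move=> /andP[r0 r1].
  have E : y + r *: (- s *: e) = y - (r * s) *: e by rewrite scalerA mulrN scaleNr.
  have rs : 0 <= r * s <= s by rewrite mulr_ge0 ?(ltW s0)//= ler_piMl// ltW.
  have yc : enorm (y - (r * s) *: e - p) < c'.
    rewrite addrAC (le_lt_trans (enormD _ _))// enormN enormZ (unit_enorm e1) mulr1.
    by move: rs yd sc; clear_ineqs => /andP[? ?] ? ?; rewrite ger0_norm//; lra.
  have yd2 : enorm (y - p) < d2 by move: c'0 yd c'c cd2; clear_ineqs; lra.
  by rewrite E; split=> //; apply: h2 (lt_trans yc (lt_trans c'c cd2)); case/andP: rs.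
have E2 : refl e l' y = y + - s *: e by rewrite /refl -/s scaleNr.
have [r r01 E] := line_mvt_open (D := fun r => grad_dot g (y + r *: (- s *: e)) (- s *: e))
  (fun r r01 => C1bar_derive (- s *: e) oU (sol_C2 sol).1 (near r r01).2).
have [q1 q2] := near r ltac:(by case/andP: r01 => *; rewrite !ltW).
have := h1 _ q2 ltac:(lra); rewrite -subr_ge0 E2 E grad_dotZ => G.
by rewrite mulNr oppr_ge0 pmulr_rle0// ltW.
Qed.
End AtPoint.
End OnLine.

(** * Stability of the reflection inequality *)

Section Compactness.
Context {R : realType}.
Implicit Types (x y : plane R).

(** A uniform neighbourhood, by compactness of the disc of radius [B]. *)
Lemma bounded_uniform (P : R -> plane R -> Prop) (B : R) :
  (forall x, exists2 d : R, 0 < d & forall s y, `|s| < d -> enorm (y - x) < d -> P s y) ->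
  exists2 d : R, 0 < d & forall s y, `|s| < d -> enorm y <= B -> P s y.
Proof.
move=> H; apply: contrapT => nH.
have bad (i : nat) : exists sy : R * plane R, [/\ `|sy.1| < i.+1%:R^-1, enorm sy.2 <= B & ~ P sy.1 sy.2].
  apply: contrapT => nb; apply: nH; exists i.+1%:R^-1; first by rewrite invr_gt0.
  by move=> s y sd yB; apply: contrapT => nP; apply: nb; exists (s, y).
have [f hf] := choice bad.
have cK : compact [set y : plane R | enorm y <= B].
  apply: (@compact_cball _ _ 0 B); last by move=> y /=; rewrite subr0.
  have [B0|B0] := leP 0 B; last first.
    rewrite (_ : [set _ | _] = set0); first exact: closed0.
    by apply/seteqP; split => y //= yB; have := enorm_ge0 y; lra.
  rewrite (_ : [set _ | _] = [set y | dotp (y - 0) (y - 0) <= B ^+ 2]).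
    by apply: closed_le_cont; exact: sqdist_continuous.
  by apply/seteqP; split => y /=; rewrite subr0 enorm_le.
have FK : ((fun i => (f i).2) @ \oo) [set y : plane R | enorm y <= B].
  by exists 0%N => // i _ /=; have [_ ? _] := hf i.
have [x [_ cx]] := cK _ _ FK.
have [d d0 hd] := H x.
have [N hN] : exists N : nat, forall i, (N <= i)%N -> i.+1%:R^-1 < d.
  exists (Num.truncn d^-1).+1 => i Ni; rewrite invf_plt ?posrE//.
  rewrite (lt_le_trans (truncnS_gt _))// ler_nat; exact: (leq_trans Ni (leqnSn _)).
have F1 : ((fun i => (f i).2) @ \oo) [set y | exists i, (N <= i)%N /\ y = (f i).2].
  by exists N => // i Ni /=; exists i.
have [y [[i [Ni ->]] yd]] := cx _ [set y | enorm (y - x) < d] F1 ((nbhs_enorm _ _).2 (ex_intro2 _ _ d d0 (fun y h => h))).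
by have [sd _ []] := hf i; apply: hd => //; exact: lt_trans sd (hN i Ni).
Qed.
End Compactness.

Section Stability.
Context {R : realType}.
Implicit Types (x y z p q u n : plane R) (s t d a r m : R).

Definition stable_at (v : plane R -> R) (e : plane R) (l : R) x := exists2 d, 0 < d &
  forall l' y, `|l' - l| < d -> enorm (y - x) < d -> l' < dotp y e -> v y <= v (refl e l' y).

Lemma refl_move (e : plane R) l l' y : dotp e e = 1 -> enorm (refl e l' y - refl e l y) = 2 * `|l' - l|.
Proof.
move=> e1; have -> : refl e l' y - refl e l y = (2 * (l' - l)) *: e.
  by apply/planeP; rewrite /refl !mxE; ring.
by rewrite enormZ (unit_enorm e1) mulr1 normrM gtr0_norm.
Qed.

Section Zero.
Variables (v : plane R -> R) (M k : R) (g : 'I_2 -> plane R -> R) (h : 'I_2 -> 'I_2 -> plane R -> R)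
  (nu : plane R -> plane R) (gam : R -> R).
Hypothesis (sol : solution v M k g h nu gam).
Variables (e : plane R) (l : R).
Hypothesis (e1 : dotp e e = 1) (mo : mono v e l).
Notation Om := (mid v M).
Hypothesis pos : forall y, l < dotp y e -> Om y -> Om (refl e l y) -> 0 < wdiff v e l y.

(** Off the line, the inequality [mono] makes the mirror image of [x] a limit of
    points of the domain too, which [no_tangency] excludes. *)
Lemma stable_level0 x : closure Om x -> v x = 0 -> v (refl e l x) = 0 -> l <= dotp x e ->
  stable_at v e l x.
Proof.
move=> cx vx vx' xl; have oU := mid_open sol.
have nOx : ~ Om x by rewrite /mid /= vx ltxx.
have bx : boundary Om x by have [|//] := (closure_boundary x oU).1 cx.
move: xl; rewrite le_eqVlt => /orP[/eqP/esym xl|xl]; first exact: (stable_on_line sol bx vx e1 mo xl pos).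
exfalso; apply: (no_tangency sol e1 mo pos bx vx xl _ vx').
have nOx' : ~ Om (refl e l x) by rewrite /mid /= vx' ltxx.
suff cx' : closure Om (refl e l x) by have [|//] := (closure_boundary (refl e l x) oU).1 cx'.
apply/closure_enorm => d d0.
have cv : continuous v := sol_cont sol.
have vM : v (refl e l x) < M by rewrite vx'; exact: sol_M sol.
have [d1 d10 h1] := cont_lt (cv (refl e l x)) vM.
have [d2 d20 h2] := cont_gt (@dotp_continuous R e x) xl.
have [c c0 [cd cd1]] := min2 d0 d10; have [c' c'0 [c'c c'd]] := min2 c0 d20.
have [y Oy yc] := (closure_enorm Om x).1 cx c' c'0.
exists (refl e l y); last by rewrite refl_dist//; lra.
apply/andP; split; last by apply: h1; rewrite refl_dist//; lra.
have /andP[y0 _] := Oy; apply: lt_le_trans y0 (mo _); apply: h2; lra.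
Qed.

(** Since [wdiff] is positive off the line, [x] is on it; near [x], [v] is
    decreasing along [e] by [hopf_line]. *)
Lemma stable_mid x : Om x -> wdiff v e l x = 0 -> l <= dotp x e -> stable_at v e l x.
Proof.
move=> Ox wx; have oU := mid_open sol.
rewrite le_eqVlt => /orP[/eqP/esym xl|xl]; last first.
  have Ox' : Om (refl e l x).
    by move: Ox wx; rewrite /mid /= /wdiff => H /eqP; rewrite subr_eq0 => /eqP ->.
  by have := pos xl Ox Ox'; rewrite wx ltxx.
have ge := hopf_line sol e1 mo pos Ox xl.
have C1 := C1bar_dir e oU (sol_C2 sol); have [C _ _] := C1.
have [d1 d10 h1] := within_enorm C (subset_closure Ox) (a := - grad_dot g x e) ltac:(lra).
have [d2 d20 h2] := openE_enorm oU Ox.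
have [c c0 [cd1 cd2]] := min2 d10 d20.
exists (c / 6); first by rewrite divr_gt0.
move=> l' y ll yd yl.
set s := 2 * (dotp y e - l'); have s0 : 0 < s by rewrite /s; lra.
have sc : s < 4 * (c / 6).
  have := dotp_le_unit (y - x) e1; rewrite dotpDl dotpNl xl.
  by move: ll; rewrite ltr_norml ler_norml /s => /andP[? ?] /andP[? ?]; lra.
have near r : 0 <= r <= 1 -> enorm (y + r *: (- s *: e) - x) < c.
  move=> /andP[r0 r1].
  have rs : 0 <= r * s <= s by rewrite mulr_ge0 ?(ltW s0)//= ler_piMl// ltW.
  rewrite addrAC (le_lt_trans (enormD _ _))// scalerA mulrN scaleNr enormN enormZ (unit_enorm e1) mulr1.
  by rewrite ger0_norm; lra.
have inO r : 0 <= r <= 1 -> Om (y + r *: (- s *: e)) by move=> /near ?; apply: h2; lra.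
have E2 : refl e l' y = y + - s *: e by rewrite /refl -/s scaleNr.
have [r r01 E] := line_mvt_open (D := fun r => grad_dot g (y + r *: (- s *: e)) (- s *: e))
  (fun r r01 => C1bar_derive (- s *: e) oU (sol_C2 sol).1 (inO r r01)).
have r01' : 0 <= r <= 1 by case/andP: r01 => *; rewrite !ltW.
have := h1 _ (subset_closure (inO r r01')) ltac:(have := near r r01'; lra).
rewrite ltr_norml => /andP[_ G]; have {}G : grad_dot g (y + r *: (- s *: e)) e <= 0 by lra.
by rewrite -subr_ge0 E2 E grad_dotZ mulNr oppr_ge0 pmulr_rle0.
Qed.

End Zero.

Section All.
Variables (v : plane R -> R) (M k : R) (g : 'I_2 -> plane R -> R) (h : 'I_2 -> 'I_2 -> plane R -> R)
  (nu : plane R -> plane R) (gam : R -> R).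
Hypothesis (sol : solution v M k g h nu gam).
Variables (e : plane R) (l : R).
Hypothesis (e1 : dotp e e = 1) (mo : mono v e l).
Notation Om := (mid v M).
Hypothesis pos : forall y, l < dotp y e -> Om y -> Om (refl e l y) -> 0 < wdiff v e l y.

(** If [x] is not stable, then [x] is a limit of points where the inequality
    fails for nearby lines.  This forces [wdiff v e l x = 0], and puts [x], or its
    image, in the closure of [Om]. *)
Lemma stable_everywhere x : stable_at v e l x.
Proof.
have [xl|xl] := ltP (dotp x e) l.
  exists ((l - dotp x e) / 2); first by rewrite divr_gt0// subr_gt0.
  move=> l' y ll yd yl; exfalso; have := dotp_le_unit (y - x) e1.
  move: ll; rewrite dotpDl dotpNl ltr_norml ler_norml => /andP[? ?] /andP[? ?]; lra.
apply: contrapT => nb.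
have bad d : 0 < d -> exists l' y, [/\ `|l' - l| < d, enorm (y - x) < d, l' < dotp y e &
    v (refl e l' y) < v y].
  move=> d0; apply: contrapT => H; apply: nb; exists d => // l' y ll yd yl.
  by rewrite leNgt; apply/negP => vy; apply: H; exists l', y.
have cv : continuous v := sol_cont sol; have M0 := sol_M sol.
have wx : wdiff v e l x = 0.
  apply/eqP; rewrite eq_le mono_ge0// andbT leNgt; apply/negP => w0.
  have a0 : 0 < wdiff v e l x / 2 by rewrite divr_gt0.
  have [d1 d10 h1] := continuous_enorm (cv x) a0.
  have [d2 d20 h2] := continuous_enorm (cv (refl e l x)) a0.
  have [c c0 [cd1 cd2]] := min2 d10 d20.
  have [l' [y [ll yd _ vy]]] := bad (c / 3) ltac:(by rewrite divr_gt0).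
  have := h1 y ltac:(lra); have := h2 (refl e l' y).
  have -> : enorm (refl e l' y - refl e l x) < d2.
    rewrite (le_lt_trans (enorm_tri (refl e l y) _ _))// refl_move// refl_dist//; lra.
  by move=> /(_ isT); rewrite !ltr_norml /wdiff => /andP[? ?] /andP[? ?]; lra.
have vE : v (refl e l x) = v x by apply/eqP; rewrite -subr_eq0 -/(wdiff v e l x) wx.
have [Ox|nOx] := pselect (Om x); first by apply: nb; exact: (stable_mid sol e1 mo pos).
have [vx|vx] := mid_ends sol nOx.
  apply: nb; apply: (stable_level0 sol e1 mo pos) => //; last by rewrite vE.
  apply/closure_enorm => d d0.
  have vxM : v x < M by rewrite vx.
  have [d1 d10 h1] := cont_lt (cv x) vxM; have [c c0 [cd cd1]] := min2 d0 d10.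
  have [l' [y [_ yd _ vy]]] := bad c c0.
  exists y; last lra; apply/andP; split; last by apply: h1; lra.
  by apply: le_lt_trans vy; have /andP[] := sol_range sol (refl e l' y).
(* the level M is the level 0 of the dual solution, seen from the image of x *)
have e1' : dotp (- e) (- e) = 1 by rewrite dotpNl dotpNr opprK.
have sol' := solution_dual sol; have mo' := mono_dual M e1 mo.
have nbd : stable_at (fun x => M - v x) (- e) (- l) (refl e l x).
  apply: (stable_level0 sol' e1' mo').
  - move=> y; rewrite dotpNr ltrN2 mid_dual => yl Oy; rewrite reflN => Oy'.
    rewrite /wdiff reflN (_ : _ - _ = wdiff v e l (refl e l y)).
      by apply: pos; rewrite ?reflK// refl_side//; lra.
    by rewrite /wdiff reflK//; ring.
  - rewrite mid_dual; apply/closure_enorm => d d0.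
    have vx0 : 0 < v (refl e l x) by rewrite vE vx.
    have [d1 d10 h1] := cont_gt (cv (refl e l x)) vx0; have [c c0 [cd cd1]] := min2 d0 d10.
    have [l' [y [ll yd _ vy]]] := bad (c / 3) ltac:(by rewrite divr_gt0).
    have near : enorm (refl e l' y - refl e l x) < c.
      by rewrite (le_lt_trans (enorm_tri (refl e l y) _ _))// refl_move// refl_dist//; lra.
    exists (refl e l' y); last lra; apply/andP; split; first by apply: h1; lra.
    by apply: lt_le_trans vy _; have /andP[] := sol_range sol y.
  - by rewrite vE vx subrr.
  - by rewrite reflN reflK// vx subrr.
  - by rewrite dotpNr refl_side//; lra.
have [d d0 hd] := nbd.
have [l' [y [ll yd yl vy]]] := bad (d / 3) ltac:(by rewrite divr_gt0).
have := hd (- l') (refl e l' y).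
rewrite reflN reflK// dotpNr refl_side// => H.
have {H} : M - v (refl e l' y) <= M - v y.
  apply: H.
  - by rewrite -opprD normrN; lra.
  - by rewrite (le_lt_trans (enorm_tri (refl e l y) _ _))// refl_move// refl_dist//; lra.
  - lra.
lra.
Qed.

End All.
End Stability.

(** * The moving plane argument *)

Section Sweep.
Context {R : realType}.
Implicit Types (x y z p q u n : plane R) (s t d a r m : R).

(** A periodic function has no bounded support. *)
Lemma no_period (v : plane R -> R) (B : R) x0 u : (forall x, 0 < v x -> enorm x <= B) -> 0 < v x0 ->
  (forall x, v (x + u) = v x) -> u = 0.
Proof.
move=> vB vx0 per; apply/eqP/negPn/negP => u0.
have un := enorm_gt0 u0.
have it (i : nat) : v (x0 + i%:R *: u) = v x0.
  elim: i => [|i IH]; first by rewrite scale0r addr0.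
  by rewrite -natr1 scalerDl scale1r addrA per.
pose i := (Num.truncn ((B + enorm x0) / enorm u)).+1.
have iB : (B + enorm x0) / enorm u < i%:R by exact: truncnS_gt.
have := vB (x0 + i%:R *: u); rewrite it => /(_ vx0).
have : enorm (i%:R *: u) <= enorm (x0 + i%:R *: u) + enorm x0.
  by have := enormD (x0 + i%:R *: u) (- x0); rewrite addlK enormN.
rewrite enormZ ger0_norm//; move: iB; rewrite ltr_pdivrMr//; lra.
Qed.

Variables (v : plane R -> R) (M k : R) (g : 'I_2 -> plane R -> R) (h : 'I_2 -> 'I_2 -> plane R -> R)
  (nu : plane R -> plane R) (gam : R -> R).
Hypothesis (sol : solution v M k g h nu gam).
Variables (B : R) (x0 : plane R).
Hypothesis (vB : forall x, 0 < v x -> enorm x <= B) (vx0 : 0 < v x0).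
Notation Om := (mid v M).

Section Direction.
Variable e : plane R.
Hypothesis (e1 : dotp e e = 1).

Let v_ge0 x : 0 <= v x. Proof. by have /andP[] := sol_range sol x. Qed.

(** The dichotomy of [sym_of_zero], which any zero of the reflection
    difference triggers. *)
Lemma alternative l : mono v e l -> (forall x, v (refl e l x) = v x) \/
  (forall y, l < dotp y e -> Om y -> Om (refl e l y) -> 0 < wdiff v e l y).
Proof.
move=> mo; have [|ns] := pselect (forall x, v (refl e l x) = v x); [by left|right].
move=> y yl Oy Oy'; rewrite lt_neqAle mono_ge0 ?(ltW yl)// andbT; apply/eqP => wy.
exact: ns (sym_of_zero sol e1 mo yl Oy Oy' (esym wy)).
Qed.

(** At the critical value, stability at all points would be uniform on the bounded
    support of [v], and smaller values would be allowed. *)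
Lemma sweep : exists l, (forall x, v (refl e l x) = v x) /\ (forall l', l <= l' -> mono v e l').
Proof.
pose L := [set l | forall l', l <= l' -> mono v e l'].
(* beyond the support of v *)
have LB : L B.
  move=> l' Bl' y yl; suff : v y <= 0 by move/le_trans; apply.
  rewrite leNgt; apply/negP => /vB yB; have := dotp_le_unit y e1.
  rewrite ler_norml => /andP[_]; lra.
(* for very negative l the image of x0 leaves the support of v *)
have lowb l : L l -> Num.min (dotp x0 e) ((dotp x0 e - B) / 2) <= l.
  move=> Ll; rewrite leNgt lt_min; apply/negP => /andP[l1 l2].
  have := Ll l (lexx l) x0 l1; rewrite leNgt => /negP; apply.
  apply: le_lt_trans vx0; rewrite leNgt; apply/negP => /vB xB.
  have := dotp_le_unit (refl e l x0) e1; rewrite refl_side// ler_norml => /andP[]; lra.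
have hL : has_inf L by split; [exists B|exists (Num.min (dotp x0 e) ((dotp x0 e - B) / 2)) => l /lowb].
pose ls := inf L.
have above l' : ls < l' -> mono v e l'.
  move=> lsl; have [l Ll ll'] := inf_lt (proj1 hL) lsl.
  by apply: Ll; exact: ltW.
have cv : continuous v := sol_cont sol.
have mos : mono v e ls.
  move=> y yl; rewrite leNgt; apply/negP => vy.
  have [d d0 hd] := cont_lt (cv (refl e ls y)) vy.
  have [c c0 [cd cy]] := min2 d0 (ltac:(by rewrite subr_gt0) : 0 < dotp y e - ls).
  have := above (ls + c / 3) ltac:(lra) y ltac:(lra).
  rewrite leNgt => /negP; apply; apply: hd.
  by rewrite refl_move// addrAC subrr add0r gtr0_norm; lra.
have Lls : L ls by move=> l'; rewrite le_eqVlt => /orP[/eqP<-|/above].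
exists ls; split; last exact: Lls.
have [//|pos] := alternative mos; exfalso.
have loc x : exists2 d : R, 0 < d & forall s y, `|s| < d -> enorm (y - x) < d ->
    ls + s < dotp y e -> v y <= v (refl e (ls + s) y).
  have [d d0 hd] := stable_everywhere sol e1 mos pos x.
  by exists d => // s y sd yd; apply: hd => //; rewrite addrAC subrr add0r.
have [d d0 hd] := bounded_uniform B loc.
have nL : ~ L (ls - d / 2).
  by move=> Ll; have := ge_inf (proj2 hL) Ll; rewrite -/ls; lra.
apply: nL => l' l'ge y yl; have [l'ls|l'ls] := leP ls l'; first exact: Lls l'ls y yl.
have [vy0|vy] := leP (v y) 0; first exact: le_trans vy0 (v_ge0 _).
have := hd (l' - ls) y; rewrite (addrC ls) subrK; apply => //.
- by rewrite ltr0_norm; lra.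
- exact: vB.
Qed.

(** Beyond the axis of symmetry the strict case of [alternative] holds on
    every line, since two parallel axes make a period; so [hopf_line] applies
    at each point. *)
Lemma sweep_strict l x : (forall x, v (refl e l x) = v x) -> (forall l', l <= l' -> mono v e l') ->
  Om x -> l < dotp x e -> grad_dot g x e < 0.
Proof.
move=> sym mo Ox xl; have mo' := mo _ (ltW xl).
have [sym'|pos] := alternative mo'; last exact: (hopf_line sol e1 mo' pos Ox erefl).
exfalso; have := @no_period v B x0 ((2 * (dotp x e - l)) *: e) vB vx0.
have per y : v (y + (2 * (dotp x e - l)) *: e) = v y.
  rewrite -[RHS]sym -[RHS]sym'; congr v; rewrite [in RHS]/refl refl_side//.
  by apply/planeP; rewrite /refl !mxE; ring.
move=> /(_ per) /(congr1 (@enorm R)); rewrite enormZ enorm0 (unit_enorm e1) mulr1 => /eqP.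
by rewrite normr_eq0 mulf_eq0 pnatr_eq0 /= subr_eq0 gt_eqF.
Qed.
End Direction.

Definition E0 : plane R := delta_mx ord0 0.
Definition E1 : plane R := delta_mx ord0 1.
Lemma E0E0 : dotp E0 E0 = 1. Proof. exact/enorm_unit/enorm_delta. Qed.
Lemma E1E1 : dotp E1 E1 = 1. Proof. exact/enorm_unit/enorm_delta. Qed.

(** The product of the reflections in two orthogonal axes is the central
    symmetry at their intersection [c].  Combined with an axis of symmetry at
    distance [d] from [c], it generates a translation of length [4 * d]; so all axes
    pass through [c], and any two points at the same distance from [c] are mirror
    images of each other. *)
Theorem radial_symmetry : exists c : plane R,
  (forall x y, enorm (x - c) = enorm (y - c) -> v x = v y) /\
  (forall x y, enorm (x - c) <= enorm (y - c) -> v y <= v x) /\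
  (forall x e, Om x -> dotp e e = 1 -> 0 < dotp (x - c) e -> grad_dot g x e < 0).
Proof.
have [l0 [sym0 mo0]] := sweep E0E0; have [l1 [sym1 mo1]] := sweep E1E1.
pose c : plane R := l0 *: E0 + l1 *: E1.
have central x : v (2 *: c - x) = v x.
  rewrite -(sym0 x) -(sym1 (refl E0 l0 x)); congr v.
  by apply/planeP; rewrite /refl /c /E0 /E1 !plE /=; ring.
have dir e : dotp e e = 1 -> (forall x, v (refl e (dotp c e) x) = v x) /\
    (forall l', dotp c e <= l' -> mono v e l').
  move=> e1; have [l [sym mo]] := sweep e1.
  suff -> : dotp c e = l by [].
  have := @no_period v B x0 ((4 * (l - dotp c e)) *: e) vB vx0.
  have per y : v (y + (4 * (l - dotp c e)) *: e) = v y.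
    rewrite -[RHS]central -[RHS]sym -[RHS]central -[RHS]sym; congr v.
    have s1 : dotp (2 *: c - y) e = 2 * dotp c e - dotp y e by rewrite dotpDl dotpNl dotpZl.
    have s2 : dotp (2 *: c - refl e l (2 *: c - y)) e = 4 * dotp c e - 2 * l - dotp y e.
      by rewrite dotpDl dotpNl dotpZl refl_side// s1; ring.
    rewrite [in RHS]/refl s2 s1.
    by apply/planeP; rewrite !mxE; ring.
  move=> /(_ per) /(congr1 (@enorm R)); rewrite enormZ enorm0 (unit_enorm e1) mulr1 => /eqP.
  by rewrite normr_eq0 mulf_eq0 pnatr_eq0 /= subr_eq0 => /eqP.
have rad x y : enorm (x - c) = enorm (y - c) -> v x = v y.
  move=> E; have [->//|xy] := eqVneq x y.
  have [e e1 xyE] : exists2 e, dotp e e = 1 & x - y = enorm (x - y) *: e.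
    by apply: unit_direction; rewrite subr_eq0.
  rewrite -(dir e e1).1; congr v.
  (* x and y being equidistant from c, their perpendicular bisector contains c *)
  have key : 2 * dotp (x - c) e = enorm (x - y).
    have : dotp (x - c) (x - c) = dotp (y - c) (y - c) by rewrite -!enorm_sq E.
    have -> : y - c = (x - c) - enorm (x - y) *: e by rewrite -xyE; apply/planeP; rewrite !mxE; ring.
    have N0 : enorm (x - y) != 0 by rewrite lt0r_neq0// enorm_gt0// subr_eq0.
    move: (x - c) (enorm _) N0 => q N N0; rewrite !dotpl e1 (dotpC e q) => H.
    by apply: (mulfI N0); lra.
  rewrite /refl -dotpNl -dotpDl key -xyE.
  by rewrite opprB addrC subrK.
exists c; split=> //; split.
  move=> x y xy; have [E|yc] := eqVneq y c.
    by rewrite (rad x y)//; move: xy; rewrite E subrr enorm0 => H; apply/eqP; rewrite eq_le H enorm_ge0.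
  have [e e1 yE] : exists2 e, dotp e e = 1 & y - c = enorm (y - c) *: e.
    by apply: unit_direction; rewrite subr_eq0.
  have ye : y = c + enorm (y - c) *: e by rewrite -yE addrC subrK.
  have [E|lt] := eqVneq (enorm (x - c)) (enorm (y - c)); first by rewrite (rad x y).
  have xlty : enorm (x - c) < enorm (y - c) by rewrite lt_neqAle lt.
  pose x' := c + enorm (x - c) *: e.
  have xx' : enorm (x - c) = enorm (x' - c).
    by rewrite /x' addlK enormZ (unit_enorm e1) mulr1 ger0_norm// enorm_ge0.
  rewrite (rad _ _ xx').
  (* the line halfway between x' and y, on the far side of c *)
  pose l := dotp c e + (enorm (x - c) + enorm (y - c)) / 2.
  have yd : dotp y e = dotp c e + enorm (y - c) by rewrite {1}ye dotpDl dotpZl e1 mulr1.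
  have <- : refl e l y = x'.
    have yc' : y - enorm (y - c) *: e = c by apply/eqP; rewrite subr_eq; apply/eqP.
    rewrite /refl yd (_ : 2 * _ = enorm (y - c) - enorm (x - c)); last by rewrite /l; field.
    by rewrite scalerBl opprB addrCA yc' addrC.
  apply: ((dir e e1).2 l _ y _); first by rewrite /l lerDl divr_ge0// addr_ge0// enorm_ge0.
  by rewrite yd /l; lra.
move=> x e Ox e1; rewrite dotpDl dotpNl subr_gt0.
by apply: sweep_strict => //; have [] := dir e e1.
Qed.

End Sweep.

(** * A simple closed curve is locally a graph *)

Section Curves.
Context {R : realType}.
Implicit Types (x y z p q u n : plane R) (s t d a r m : R) (c : R -> plane R).

Lemma curve_derive c t u p : derivable c t 1 ->
  is_derive t 1 (fun s => dotp (c s - p) u) (dotp (derive1 c t) u).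
Proof.
move=> dc; have D i : is_derive t 1 (fun s => c s ord0 i) ((derive1 c t) ord0 i).
  rewrite derive1E derive_mx// mxE; apply: derivableP.
  exact: (derivable_mxP _ _ _).1 dc ord0 i.
have -> : (fun s => dotp (c s - p) u) =
    (fun s => (u ord0 0 * c s ord0 0 + u ord0 1 * c s ord0 1) - dotp p u).
  by apply/funext => s; rewrite dotpDl dotpNl dotpE; ring.
have D0 := D 0; have D1 := D 1.
have -> : dotp (derive1 c t) u = (u ord0 0 * (derive1 c t) ord0 0 + u ord0 1 * (derive1 c t) ord0 1) - 0.
  by rewrite dotpE; ring.
have H0 : is_derive t 1 (fun s => u ord0 0 * c s ord0 0) (u ord0 0 * (derive1 c t) ord0 0).
  exact: (is_deriveZ (u ord0 0) D0).
have H1 : is_derive t 1 (fun s => u ord0 1 * c s ord0 1) (u ord0 1 * (derive1 c t) ord0 1).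
  exact: (is_deriveZ (u ord0 1) D1).
exact: (is_deriveB (is_deriveD H0 H1) (is_derive_cst _ _ _)).
Qed.

(** Written for [a] and [b] in any order, to be used on a window around
    [t0]. *)
Lemma mvt_window (f D : R -> R) t0 (eps : R) : (forall t : R, is_derive t 1 f (D t)) ->
  forall a b, `|a - t0| <= eps -> `|b - t0| <= eps ->
  exists2 xi : R, `|xi - t0| <= eps & f b - f a = D xi * (b - a).
Proof.
move=> hD a b ha hb.
have cf a' b' : {within `[a', b'], continuous f}.
  by apply: derivable_within_continuous => s _; have [] := hD s.
have [ab|ba|->] := ltgtP a b; last by exists b => //; rewrite !subrr mulr0.
- have [xi] := MVT ab (fun s _ => hD s) (cf a b); rewrite in_itv /= => /andP[x1 x2] E.
  exists xi => //; move: ha hb; rewrite !ler_norml => /andP[? ?] /andP[? ?].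
  by apply/andP; split; lra.
- have [xi] := MVT ba (fun s _ => hD s) (cf b a); rewrite in_itv /= => /andP[x1 x2] E.
  exists xi; last by lra.
  move: ha hb; rewrite !ler_norml => /andP[? ?] /andP[? ?].
  by apply/andP; split; lra.
Qed.

Lemma signed_bounds (D m a : R) : 0 < m -> `|D| = 2 * m -> `|a - D| <= m ->
  if 0 <= D then m <= a else a <= - m.
Proof.
move=> m0 DE; rewrite ler_norml => /andP[h1 h2]; case: ifPn => [D0|].
  by move: DE; rewrite ger0_norm//; lra.
by rewrite -ltNge => D0; move: DE; rewrite ltr0_norm//; lra.
Qed.

(** On a window where [DX] keeps away from [0], [X] is a coordinate, and the
    window is mapped onto a neighbourhood of [0].  Since [DY] vanishes at
    [t0] and is Lipschitz there, [Y] is quadratically small. *)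
Lemma param_graph (X Y DX DY : R -> R) (t0 eta : R) :
  (forall t : R, is_derive t 1 X (DX t)) -> (forall t : R, is_derive t 1 Y (DY t)) ->
  X t0 = 0 -> Y t0 = 0 -> DX t0 != 0 -> DY t0 = 0 ->
  (exists2 d, 0 < d & exists K : R, 0 <= K /\ forall t, `|t - t0| < d -> `|DX t - DX t0| <= K * `|t - t0|) ->
  (exists2 d, 0 < d & exists K : R, 0 <= K /\ forall t, `|t - t0| < d -> `|DY t - DY t0| <= K * `|t - t0|) ->
  0 < eta -> exists ep m K : R, [/\ 0 < ep, 0 < m, 0 <= K &
    [/\ forall a b, `|a - t0| <= ep -> `|b - t0| <= ep -> m * `|b - a| <= `|X b - X a|,
        forall a b, `|a - t0| <= ep -> `|b - t0| <= ep -> `|Y b - Y a| <= eta * `|X b - X a|,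
        forall t, `|t - t0| <= ep -> `|Y t| <= K * `|t - t0| ^+ 2 &
        forall s, `|s| <= m * ep -> exists t, `|t - t0| <= ep /\ X t = s]].
Proof.
move=> dX dY X0 Y0 DX0 DY0 [d1 d10 [K1 [K10 h1]]] [d2 d20 [K2 [K20 h2]]] eta0.
pose m := `|DX t0| / 2; have m0 : 0 < m by rewrite divr_gt0// normr_gt0.
have mE : `|DX t0| = 2 * m by rewrite /m mulrC divfK.
move: m m0 mE => m m0 mE.
have [e1 e10 [e1a e1b]] := min2 d10 d20.
have [e2 e20 [e2a e2b]] := min2 (divr_gt0 m0 (ltr_wpDl K10 ltr01)) (divr_gt0 (mulr_gt0 eta0 m0) (ltr_wpDl K20 ltr01)).
have [ep ep0 [epa epb]] := min2 e10 e20.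
have win t : `|t - t0| <= ep -> `|DX t - DX t0| <= m /\ `|DY t| <= eta * m.
  move=> tt; split.
    apply: le_trans (h1 t _) _; first lra.
    have : `|t - t0| <= m / (K1 + 1) by lra.
    rewrite ler_pdivlMr ?ltr_wpDl//; have := normr_ge0 (t - t0); lra.
  have := h2 t ltac:(lra); rewrite DY0 subr0 => /le_trans; apply.
  have : `|t - t0| <= eta * m / (K2 + 1) by lra.
  rewrite ler_pdivlMr ?ltr_wpDl//; have := normr_ge0 (t - t0); lra.
have DXm t : `|t - t0| <= ep -> m <= `|DX t|.
  move=> /win[H _]; have := lerB_dist (DX t0) (DX t); rewrite distrC mE; lra.
have t0w : `|t0 - t0| <= ep by rewrite subrr normr0 ltW.
have Xexp a b : `|a - t0| <= ep -> `|b - t0| <= ep -> m * `|b - a| <= `|X b - X a|.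
  move=> ha hb; have [xi xiw ->] := mvt_window dX ha hb.
  by rewrite normrM; apply: ler_wpM2r => //; exact: DXm.
exists ep, m, K2; split=> //; split=> //.
- move=> a b ha hb; have [xi xiw ->] := mvt_window dY ha hb.
  have [_ B] := win xi xiw; have := Xexp a b ha hb.
  move=> /(ler_wpM2l (ltW eta0)); apply: le_trans.
  by rewrite normrM mulrA; apply: ler_wpM2r.
- move=> t tw; have [xi xiw E] := mvt_window dY (a := t0) (b := t) (t0 := t0) (eps := `|t - t0|) ltac:(by rewrite subrr normr0) (lexx _).
  rewrite -[Y t]subr0 -Y0 E normrM (_ : K2 * _ = K2 * `|t - t0| * `|t - t0|); last ring.
  apply: ler_wpM2r => //; have xid : `|xi - t0| < d2 by apply: le_lt_trans xiw _; lra.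
  have := h2 xi xid; rewrite DY0 subr0 => /le_trans; apply.
  by apply: ler_wpM2l.
- move=> s sm; have cX : {within `[t0 - ep, t0 + ep], continuous X}.
    by apply: derivable_within_continuous => r _; have [] := dX r.
  have wR : `|t0 + ep - t0| <= ep by rewrite addrC addKr gtr0_norm.
  have wL : `|t0 - ep - t0| <= ep by rewrite addrC addKr normrN gtr0_norm.
  have [xr xrw Er] := mvt_window dX t0w wR; have [xl xlw El] := mvt_window dX t0w wL.
  have [Cr _] := win xr xrw; have [Cl _] := win xl xlw.
  have Br := signed_bounds m0 mE Cr; have Bl := signed_bounds m0 mE Cl.
  have lr : t0 - ep <= t0 + ep by rewrite lerD2l (le_trans _ (ltW ep0))// oppr_le0 ltW.
  have E1 : X (t0 + ep) = DX xr * ep by move: Er; rewrite X0 subr0 (addrC t0) addrK.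
  have E2 : X (t0 - ep) = - (DX xl * ep) by move: El; rewrite X0 subr0 (addrC t0) addrK mulrN.
  have [|t tI Et] := @IVT R X (t0 - ep) (t0 + ep) s lr cX.
    rewrite E1 E2; move: sm Br Bl; move: (DX xr) (DX xl) ep0 => A B {}ep0.
    rewrite ler_norml => /andP[s1 s2]; case: ifP => _ h3 h4.
      have q1 : m * ep <= A * ep by rewrite ler_pM2r.
      have q2 : m * ep <= B * ep by rewrite ler_pM2r.
      by rewrite ge_min le_max; move: s1 s2 q1 q2; clear_ineqs => *; apply/andP; split; apply/orP; [left|right]; lra.
    have q1 : A * ep <= - m * ep by rewrite ler_pM2r.
    have q2 : B * ep <= - m * ep by rewrite ler_pM2r.
    by rewrite ge_min le_max; move: s1 s2 q1 q2; clear_ineqs => *; apply/andP; split; apply/orP; [right|left]; lra.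
  exists t; split=> //; move: tI; rewrite in_itv /=; clear_ineqs => /andP[? ?].
  by rewrite ler_norml; apply/andP; split; lra.
Qed.

Lemma frame_eq n x y : dotp n n = 1 -> dotp x n = dotp y n -> dotp x (perp n) = dotp y (perp n) -> x = y.
Proof. by move=> n1 h1 h2; rewrite (frameE x n1) (frameE y n1) h1 h2. Qed.

Section OneCurve.
Variables (c : R -> plane R).
Hypotheses (smooth : forall (n : nat) (t : R), derivable (derive1n n c) t 1)
  (regular : forall t, derive1 c t != 0) (per : forall t, c (t + 1) = c t)
  (inj : {in `[0, 1[ &, injective c}).

Lemma curve_smooth1 t : derivable c t 1. Proof. by have := @smooth 0%N t; rewrite derive1n0. Qed.
Lemma curve_smooth2 t : derivable (derive1 c) t 1. Proof. by have := @smooth 1%N t; rewrite derive1n1. Qed.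

Lemma curve_continuous t d : 0 < d ->
  exists2 a, 0 < a & forall s, `|s - t| < a -> enorm (c s - c t) < d.
Proof.
move=> d0; have ct : {for t, continuous c}.
  by apply: differentiable_continuous; apply/derivable1_diffP; exact: curve_smooth1.
have N : nbhs (c t) [set y | enorm (y - c t) < d] by apply/nbhs_enorm; exists d.
have /nbhs_ballP[a /= a0 H] := ct _ N.
by exists a => // s st; apply: H; rewrite /ball /= distrC.
Qed.

Lemma curve_periodZ (z : int) t : c (t + z%:~R) = c t.
Proof.
have perN (i : nat) s : c (s + i%:R) = c s.
  by elim: i s => [|i IH] s; [rewrite addr0|rewrite -natr1 addrA per IH].
case: z => i; first exact: perN.
by rewrite NegzE mulrNz -[LHS](perN i.+1) -pmulrn subrK.
Qed.

(** Injectivity on one period determines the parameter up to integers. *)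
Lemma curve_inj s t : c s = c t -> exists z : int, s = t + z%:~R.
Proof.
have fr r : r - (Num.floor r)%:~R \in `[0, 1[.
  rewrite in_itv /= subr_ge0 floor_le /= ltrBlDr addrC -[1]/(1%:~R) -intrD.
  exact: floorD1_gt.
have cfr r : c (r - (Num.floor r)%:~R) = c r by rewrite -mulrNz curve_periodZ.
move=> E; have := inj (fr s) (fr t); rewrite !cfr => /(_ E) H.
exists (Num.floor s - Num.floor t); rewrite intrB; move: H; lra.
Qed.

Lemma curve_representative t0 t : exists2 t', `|t' - t0| <= 1 / 2 & c t' = c t.
Proof.
pose z := Num.floor (t - t0 + 1 / 2).
exists (t + (- z)%:~R); last exact: curve_periodZ.
have := floor_le (t - t0 + 1 / 2); have := floorD1_gt (t - t0 + 1 / 2).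
rewrite -/z intrD mulrNz ler_norml => h1 h2; apply/andP; split; lra.
Qed.

(** The curve does not come back close to [c t0] at other parameters: on a
    period, away from [t0], the distance to [c t0] has a positive minimum. *)
Lemma curve_isolated t0 (eps : R) : 0 < eps -> exists2 rho, 0 < rho & forall t,
  enorm (c t - c t0) < rho -> exists2 t', `|t' - t0| < eps & c t' = c t.
Proof.
move=> e0; pose ep := Num.min eps (1 / 4).
have ep0 : 0 < ep by rewrite lt_min e0; lra.
have [ep1 ep2] : ep <= eps /\ ep <= 1 / 4 by rewrite /ep; split; rewrite ge_min lexx ?orbT.
pose f t := enorm (c t - c t0).
have cf a b : {within `[a, b], continuous f}.
  apply: continuous_subspaceT => t B /nbhs_ballP[r /= r0 rB].
  have [d d0 hd] := curve_continuous t r0.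
  apply/nbhs_ballP; exists d => // s; rewrite /ball /= => st; apply: rB; rewrite /ball /= /f distrC.
  apply: le_lt_trans (hd s ltac:(by rewrite distrC)).
  rewrite ler_norml; have := enorm_tri (c t) (c s) (c t0); have := enorm_tri (c s) (c t) (c t0).
  by rewrite (enormC (c t) (c s)) => h1 h2; apply/andP; split; lra.
have pos t : ep <= `|t - t0| <= 1 / 2 -> 0 < f t.
  move=> /andP[t1 t2]; apply: enorm_gt0; rewrite subr_eq0; apply/eqP => /curve_inj[z E].
  move: t1 t2; rewrite E addrC addKr -intr_norm => t1 t2.
  have z1 : (`|z| < 1)%R by rewrite -(ltr_int R); lra.
  have z0 : z = 0 by move: z1; rewrite -abszE ltz_nat ltnS leqn0 absz_eq0 => /eqP.
  by move: t1; rewrite z0 normr0; lra.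
have [a ha amin] := EVT_min (ltac:(lra) : t0 + ep <= t0 + 1 / 2) (cf _ _).
have [b hb bmin] := EVT_min (ltac:(lra) : t0 - 1 / 2 <= t0 - ep) (cf _ _).
have fa : 0 < f a.
  apply: pos; move: ha; rewrite in_itv /= => /andP[? ?]; rewrite ger0_norm; last lra.
  by apply/andP; split; lra.
have fb : 0 < f b.
  apply: pos; move: hb; rewrite in_itv /= => /andP[? ?]; rewrite ler0_norm; last lra.
  by apply/andP; split; lra.
exists (Num.min (f a) (f b)); first by rewrite lt_min fa.
move=> t; have [t' t'h <-] := curve_representative t0 t; rewrite lt_min => /andP[h1 h2].
exists t' => //; apply: lt_le_trans ep1; rewrite ltNge; apply/negP => h3.
move: t'h h3; have [h4|h4] := leP 0 (t' - t0).
  rewrite ger0_norm// => h5 h6; have := amin t'; rewrite in_itv /= => /(_ ltac:(apply/andP; split; lra)).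
  by rewrite leNgt h1.
rewrite ltr0_norm// => h5 h6; have := bmin t'; rewrite in_itv /= => /(_ ltac:(apply/andP; split; lra)).
by rewrite leNgt h2.
Qed.

Definition local_graph (S : set (plane R)) p n (eta : R) := exists (phi : R -> R) d (K : R),
  [/\ 0 < d, phi 0 = 0,
    forall s s', `|s| < d -> `|s'| < d -> `|phi s - phi s'| <= eta * `|s - s'|,
    forall s, `|s| < d -> `|phi s| <= K * s ^+ 2 &
    forall y, enorm (y - p) < d -> (S y <-> dotp (y - p) n = phi (dotp (y - p) (perp n)))].

(** Tangential and normal coordinates along the curve satisfy the hypotheses
    of [param_graph], and [curve_isolated] excludes other passages. *)
Lemma curve_graph t0 n (eta : R) : dotp n n = 1 -> dotp n (derive1 c t0) = 0 -> 0 < eta ->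
  local_graph (range c) (c t0) n eta.
Proof.
move=> n1 nT eta0; set p := c t0; set tau := perp n.
have tau1 : dotp tau tau = 1 by rewrite dotp_perp2.
pose X t := dotp (c t - p) tau; pose Y t := dotp (c t - p) n.
pose DX t := dotp (derive1 c t) tau; pose DY t := dotp (derive1 c t) n.
have dX t : is_derive t 1 X (DX t) by apply: curve_derive; exact: curve_smooth1.
have dY t : is_derive t 1 Y (DY t) by apply: curve_derive; exact: curve_smooth1.
have DX0 : DX t0 != 0.
  apply/eqP => E; have /eqP := regular t0; apply.
  by rewrite (frameE (derive1 c t0) n1) (dotpC _ n) nT -/tau -/(DX t0) E !scale0r addr0.
have DY0 : DY t0 = 0 by rewrite /DY dotpC.
have [X0 Y0] : X t0 = 0 /\ Y t0 = 0 by rewrite /X /Y subrr !dotpE !mxE !mul0r addr0.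
(* a differentiable function is Lipschitz at a point *)
have lipD u : exists2 d, 0 < d & exists K, 0 <= K /\ forall t, `|t - t0| < d ->
    `|dotp (derive1 c t) u - dotp (derive1 c t0) u| <= K * `|t - t0|.
  have := curve_derive u 0 (@curve_smooth2 t0); set b := dotp _ u => /is_deriveP/(_ 1 ltr01)[d d0 hd].
  exists d => //; exists (`|b| + 1); split; first by rewrite addr_ge0.
  move=> t /hd; rewrite [_%:A]mulr1 (addrC t0) subrK !subr0 mulrDl mul1r => H.
  rewrite -lerBlDl; apply: le_trans H; rewrite -normrM.
  exact: lerB_dist.
have [ep [m [K2 [ep0 m0 K20 [Xexp Ylip Yquad surj]]]]] :=
  param_graph dX dY X0 Y0 DX0 DY0 (lipD tau) (lipD n) eta0.
have t0w : `|t0 - t0| <= ep by rewrite subrr normr0 ltW.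
have surj' s : exists t, `|s| <= m * ep -> `|t - t0| <= ep /\ X t = s.
  by have [/surj[t ht]|_] := leP `|s| (m * ep); [exists t|exists t0].
have [th hth] := choice surj'.
have [rho rho0 hrho] := curve_isolated t0 ep0.
have [d d0 [da db]] := min2 (mulr_gt0 m0 ep0) rho0.
have inw s : `|s| < d -> `|th s - t0| <= ep /\ X (th s) = s by move=> sd; apply: hth; lra.
have uniq t s : `|s| < d -> `|t - t0| <= ep -> X t = s -> t = th s.
  move=> sd tw Xt; have [sw Xs] := inw s sd.
  have := Xexp _ _ sw tw; rewrite Xt Xs subrr normr0 pmulr_rle0// normr_le0 subr_eq0.
  by move=> /eqP.
exists (fun s => Y (th s)), d, (K2 / m ^+ 2); split => //.
- by rewrite -(uniq t0 0) ?normr0.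
- move=> s s' /inw[w1 E1] /inw[w2 E2]; have := Ylip _ _ w2 w1.
  by rewrite E1 E2.
- move=> s /inw[w1 E1]; apply: le_trans (Yquad _ w1) _.
  have := Xexp _ _ t0w w1; rewrite E1 X0 subr0 => q.
  rewrite -mulrA ler_wpM2l// mulrC ler_pdivlMr ?exprn_gt0// -[s ^+ 2]real_normK ?num_real//.
  by rewrite mulrC -exprMn ler_pXn2r// nnegrE ?mulr_ge0// ltW.
- move=> y yd; have sd : `|dotp (y - p) tau| < d by apply: le_lt_trans yd; exact: dotp_le_unit.
  split.
    move=> [t _ Et]; have [t' tw Et'] : exists2 t', `|t' - t0| < ep & c t' = c t.
      by apply: hrho; rewrite Et; lra.
    have Ey : y = c t' by rewrite Et'.
    have <- : t' = th (dotp (y - p) tau) by apply: uniq => //; [exact: ltW|rewrite Ey].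
    by rewrite Ey.
  move=> Ey; have [w1 E1] := inw _ sd.
  exists (th (dotp (y - p) tau)) => //.
  have : c (th (dotp (y - p) tau)) - p = y - p.
    by apply: (frame_eq n1); [rewrite Ey|exact: E1].
  by move=> /(congr1 (+%R^~ p)); rewrite !subrK.
Qed.

End OneCurve.
End Curves.

(** * The two sides of a graph *)

Section LocalSides.
Context {R : realType}.
Implicit Types (x y z p q u n : plane R) (s t d r m : R) (E S Om : set (plane R)) (phi : R -> R).

Definition below phi p n y := dotp (y - p) n < phi (dotp (y - p) (perp n)).

(** The region below the graph is connected: go down from [y], across at
    depth [d / 2], and up to [y']. *)
Lemma below_propagate (Q : plane R -> Prop) phi p n d : dotp n n = 1 ->
  (forall s, `|s| < d -> `|phi s| <= `|s|) ->
  (forall a b, (forall r, 0 <= r <= 1 -> enorm (a + r *: (b - a) - p) < d /\ below phi p n (a + r *: (b - a))) ->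
     Q a -> Q b) ->
  forall y y', enorm (y - p) < d / 4 -> enorm (y' - p) < d / 4 ->
    below phi p n y -> below phi p n y' -> Q y -> Q y'.
Proof.
move=> n1 lip prop; have n1p : dotp (perp n) (perp n) = 1 by rewrite dotp_perp2.
have nn := unit_enorm n1; have nnp := unit_enorm n1p.
pose D := d / 2.
pose base y := p + (dotp (y - p) (perp n)) *: perp n + (- D) *: n.
have baseE y : base y = y + (- D - dotp (y - p) n) *: n.
  rewrite /base [in RHS](_ : y = p + (dotp (y - p) (perp n) *: perp n + dotp (y - p) n *: n)).
    rewrite addlK; set w := dotp (y - p) (perp n); set w' := dotp (y - p) n.
    have -> : dotp (w *: perp n + w' *: n) n = w' by rewrite dotpDl !dotpZl n1 dotp_perpl mulr0 add0r mulr1.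
    by rewrite scalerBl scaleNr; apply/planeP; rewrite !mxE; ring.
  by rewrite addrC [X in X + p]addrC -(frameE _ n1) subrK.
have vert y r : 0 <= r <= 1 -> enorm (y - p) < d / 4 -> below phi p n y ->
    enorm (y + r *: (base y - y) - p) < d /\ below phi p n (y + r *: (base y - y)).
  move=> /andP[r0 r1] yd by_; set s := dotp (y - p) (perp n); set t := dotp (y - p) n.
  have E1 : y + r *: (base y - y) - p = (y - p) + (r * (- D - t)) *: n.
    by rewrite baseE addlK scalerA addrAC.
  have sb : `|s| < d / 4 by apply: le_lt_trans yd; exact: dotp_le_unit.
  have tb : `|t| < d / 4 by apply: le_lt_trans yd; exact: dotp_le_unit.
  have d0 : 0 < d by have := enorm_ge0 (y - p); lra.
  rewrite /below E1 !(dotpDl (y - p)) !dotpZl n1 dotp_perp mulr0 addr0 mulr1 -/s -/t; split.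
    rewrite (le_lt_trans (enormD _ _))// enormZ nn mulr1 normrM (ger0_norm r0).
    have : r * `|- D - t| <= `|- D - t| by rewrite ler_piMl.
    have : `|- D - t| <= D + `|t| by rewrite (le_trans (ler_normB _ _))// normrN ger0_norm// /D; lra.
    rewrite /D; lra.
  have phis : - D < phi s.
    have := lip s ltac:(lra); rewrite ler_norml => /andP[? _]; rewrite /D; lra.
  have -> : t + r * (- D - t) = (1 - r) * t + r * - D by ring.
  by apply: convex_lt => //; rewrite r0.
move=> y y' yd yd' by_ by_' Qy.
have QA : Q (base y) by apply: prop Qy => r r01; exact: vert.
have QB : Q (base y').
  apply: prop QA => r /andP[r0 r1]; set s := dotp (y - p) (perp n); set s' := dotp (y' - p) (perp n).
  have E1 : base y + r *: (base y' - base y) - p = ((1 - r) * s + r * s') *: perp n + (- D) *: n.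
    by rewrite /base -/s -/s'; apply/planeP; rewrite !mxE; ring.
  have sb : `|s| < d / 4 by apply: le_lt_trans yd; exact: dotp_le_unit.
  have sb' : `|s'| < d / 4 by apply: le_lt_trans yd'; exact: dotp_le_unit.
  have sm : `|(1 - r) * s + r * s'| < d / 4.
    have r1' : 0 <= 1 - r by rewrite subr_ge0.
    rewrite (le_lt_trans (ler_normD _ _))// !normrM (ger0_norm r1') (ger0_norm r0).
    by apply: convex_lt; rewrite ?r0.
  have d0 : 0 < d by have := enorm_ge0 (y - p); lra.
  rewrite /below E1 !dotpDl !dotpZl n1 n1p dotp_perp dotp_perpl !mulr0 !mulr1 addr0 add0r; split.
    rewrite (le_lt_trans (enormD _ _))// !enormZ nn nnp !mulr1 normrN (ger0_norm (_ : 0 <= D)) /D; lra.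
  have := lip _ (ltac:(lra) : `|(1 - r) * s + r * s'| < d); rewrite ler_norml => /andP[h1 _].
  rewrite /D; lra.
apply: prop QB => r /andP[r0 r1].
have -> : base y' + r *: (y' - base y') = y' + (1 - r) *: (base y' - y').
  by apply/planeP; rewrite !mxE; ring.
by apply: vert => //; rewrite subr_ge0 r1 /=; lra.
Qed.

Lemma above_below phi p n y :
  (phi (dotp (y - p) (perp n)) < dotp (y - p) n) = below (fun s => - phi (- s)) p (- n) y.
Proof.
rewrite /below; have -> : perp (- n) = - perp n by apply/planeP; rewrite !plE.
by rewrite !dotpNr opprK ltrN2.
Qed.

Lemma segment_avoid E x y : open E -> E x ->
  (forall t, 0 <= t <= 1 -> ~ boundary E (x + t *: (y - x))) -> E y.
Proof.
move=> oE Ex nb; apply: (@segment_propagate _ E x y Ex).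
  by move=> t t01 Et; have [d d0 hd] := openE_enorm oE Et; exists d => // t' _ /hd.
move=> t t01 H; apply: contrapT => nE; apply: (nb t t01); split.
  by apply/closure_enorm => d /H[z zd Ez]; exists z.
by move=> /interior_subset.
Qed.

Lemma segment_clopen Om S x y : open S -> (forall z, Om z -> closure S z -> S z) ->
  (forall t, 0 <= t <= 1 -> Om (x + t *: (y - x))) -> S x -> S y.
Proof.
move=> oS cS inO Sx; apply: (@segment_propagate _ S x y Sx).
  by move=> t t01 Et; have [d d0 hd] := openE_enorm oS Et; exists d => // t' _ /hd.
move=> t t01 H; apply: cS; first exact: inO.
by apply/closure_enorm => d /H[z zd Ez]; exists z.
Qed.

(** Where the boundary is contained in a graph, each side of the graph is
    either inside or outside. *)
Lemma one_side Om phi p n d : open Om -> dotp n n = 1 ->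
  (forall s, `|s| < d -> `|phi s| <= `|s|) ->
  (forall y, enorm (y - p) < d -> boundary Om y -> dotp (y - p) n = phi (dotp (y - p) (perp n))) ->
  forall y y', enorm (y - p) < d / 4 -> enorm (y' - p) < d / 4 ->
    below phi p n y -> below phi p n y' -> Om y -> Om y'.
Proof.
move=> oU n1 lip gr; apply: (below_propagate n1 lip) => a b H Oa.
apply: (segment_avoid oU Oa) => t /H[td tb] /(gr _ td) E.
by move: tb; rewrite /below E ltxx.
Qed.

Lemma other_side Om phi p n d : open Om -> dotp n n = 1 ->
  (forall s, `|s| < d -> `|phi s| <= `|s|) ->
  (forall y, enorm (y - p) < d -> boundary Om y -> dotp (y - p) n = phi (dotp (y - p) (perp n))) ->
  forall y y', enorm (y - p) < d / 4 -> enorm (y' - p) < d / 4 ->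
    phi (dotp (y - p) (perp n)) < dotp (y - p) n ->
    phi (dotp (y' - p) (perp n)) < dotp (y' - p) n -> Om y -> Om y'.
Proof.
move=> oU n1 lip gr y y' yd yd'; rewrite !above_below.
apply: (one_side oU _ _ _ yd yd').
- by rewrite dotpNl dotpNr opprK.
- by move=> s sd; rewrite normrN -(normrN s); apply: lip; rewrite normrN.
- move=> z zd bz; have -> : perp (- n) = - perp n by apply/planeP; rewrite !plE.
  by rewrite !dotpNr opprK (gr z zd bz).
Qed.

(** The curve, translated in its parameter, is one of the curves
    allowed in [tangent_vector], so that a normal in the sense of
    [outer_unit_normal] is orthogonal to its velocity. *)
Lemma curve_point S p : simple_closed_smooth_curve S -> S p ->
  exists T : plane R, [/\ T != 0,
    (forall S', S `<=` S' -> tangent_vector S' p T) &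
    forall n (eta : R), dotp n n = 1 -> dotp n T = 0 -> 0 < eta -> local_graph S p n eta].
Proof.
move=> [c [smooth regular per inj <-]] [t0 _ <-]; exists (derive1 c t0); split => //.
- move=> S' SS'; exists (fun t => c (t0 + t)); split; first by rewrite addr0.
    by move=> t; apply: SS'; exists (t0 + t).
  have dc := @curve_smooth1 R c smooth t0.
  have E : (fun r : R => r^-1 *: (((fun t => c (t0 + t)) \o shift 0) (r *: 1) - c (t0 + 0))) =
      (fun r : R => r^-1 *: ((c \o shift t0) (r *: 1) - c t0)).
    by apply/funext => r; rewrite /= !addr0 (addrC t0).
  by rewrite derive1E; apply: DeriveDef; rewrite /derivable /derive E.
- by move=> n eta n1 nT eta0; exact: (curve_graph smooth regular per inj n1 nT eta0).
Qed.

End LocalSides.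

(** * From the overdetermined problem to moving planes *)

Section Assembly.
Context {R : realType}.
Implicit Types (x y z p q n : plane R) (s t d r m : R).

Lemma not_closure (E : set (plane R)) p : ~ closure E p ->
  exists2 d, 0 < d & forall y, enorm (y - p) < d -> ~ closure E y.
Proof. by move=> nc; apply: (openE_enorm (closed_openC (@closed_closure _ E))). Qed.

Variables (Ei Eo Om : set (plane R)) (u : plane R -> R) (nu : plane R -> plane R) (a b alpha beta : R).
Hypotheses (hEi : domain Ei) (hEo : domain Eo) (bEo : bounded_set Eo)
    (curve_i : simple_closed_smooth_curve (boundary Ei))
    (curve_o : simple_closed_smooth_curve (boundary Eo))
    (hEio : compactly_contained Ei Eo)
    (hOm : Om = Eo `\` closure Ei)
    (smooth_u : smooth_up_to_boundary Om u)
    (hnu : forall x, boundary Om x -> outer_unit_normal Om x (nu x))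
    (pde : forall x, Om x -> laplacian u x = - 2)
    (bc_i : forall x, boundary Ei x ->
       u x = a /\ normal_derivative_is u x (nu x) alpha)
    (bc_o : forall x, boundary Eo x ->
       u x = b /\ normal_derivative_is u x (nu x) beta)
    (lt_ab : a < b)
    (range_u : forall x, Om x -> a < u x < b).

Let oEi : open Ei. Proof. by case: hEi. Qed.
Let oEo : open Eo. Proof. by case: hEo. Qed.
Let EiEo : closure Ei `<=` Eo. Proof. exact: hEio.2. Qed.

Lemma Om_open : open Om.
Proof. by rewrite hOm setDE; apply: openI => //; apply: closed_openC; exact: closed_closure. Qed.

Lemma OmE x : Om x <-> Eo x /\ ~ closure Ei x. Proof. by rewrite hOm. Qed.

Lemma boundary_split p : boundary Om p -> boundary Ei p \/ boundary Eo p.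
Proof.
move=> bp; have nO := boundary_open Om_open bp.
have [Eop|nEo] := pselect (Eo p).
  left; have cE : closure Ei p by apply: contrapT => nc; apply: nO; apply/OmE.
  split=> // /interior_subset Eip.
  have [d d0 hd] := openE_enorm oEi Eip.
  have [y /OmE[_ ny] yd] := (closure_enorm Om p).1 bp.1 d d0.
  by apply: ny; apply: subset_closure; exact: hd.
right; split; last by move=> /interior_subset.
apply/closure_enorm => d d0; have [y /OmE[Ey _] yd] := (closure_enorm Om p).1 bp.1 d d0.
by exists y.
Qed.

Lemma outer_far p : boundary Eo p -> exists2 d, 0 < d & forall y, enorm (y - p) < d -> ~ closure Ei y.
Proof. by move=> bp; apply: not_closure => /EiEo; exact: boundary_open oEo bp. Qed.

Lemma inner_far p : boundary Ei p -> exists2 d, 0 < d & forall y, enorm (y - p) < d -> Eo y.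
Proof. by move=> bp; apply: (openE_enorm oEo); apply: EiEo; exact: bp.1. Qed.

Lemma outer_boundary p : boundary Eo p -> boundary Om p.
Proof.
move=> bp; have nE := boundary_open oEo bp; split; last by move=> /interior_subset /OmE[].
have [d1 d10 h1] := outer_far bp.
apply/closure_enorm => d d0; have [c c0 [c1 c2]] := min2 d0 d10.
have [y Ey yd] := (closure_enorm Eo p).1 bp.1 c c0.
by exists y; [apply/OmE; split=> //; apply: h1; lra|lra].
Qed.

(** The two boundary curves are at a positive distance, so near a boundary
    point of [Om] only one of them is seen. *)
Lemma local_curve p : boundary Om p -> exists S : set (plane R),
  [/\ simple_closed_smooth_curve S, S p, (forall y, S y -> ~ Om y),
    (S = boundary Ei \/ S = boundary Eo) &
    exists2 d, 0 < d & forall y, enorm (y - p) < d -> boundary Om y -> S y].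
Proof.
move=> bp; have [bi|bo] := boundary_split bp.
  exists (boundary Ei); split=> //; first by move=> y [cy _] /OmE[_].
    by left.
  have [d d0 hd] := inner_far bi; exists d => // y /hd Ey /boundary_split[//|].
  by move=> /(boundary_open oEo).
exists (boundary Eo); split=> //; first by move=> y by_ /OmE[]; have := boundary_open oEo by_.
  by right.
have [d d0 hd] := outer_far bo; exists d => // y /hd Ey /boundary_split[|//].
by case=> /Ey.
Qed.

Lemma unit_normal (T : plane R) : T != 0 -> exists n, dotp n n = 1 /\ dotp n T = 0.
Proof.
move=> T0; exists ((enorm T)^-1 *: perp T); rewrite dotpZl dotpZr dotp_perp2 dotpZl dotp_perpl mulr0; split=> //.
by rewrite -enorm_sq; field; apply: lt0r_neq0; exact: enorm_gt0.
Qed.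

(** Near [p] the boundary is a graph, and a point of [Om] close to [p] puts
    a whole side of the graph in [Om]. *)
Lemma inner_spread p : boundary Ei p -> closure Om p ->
  exists2 d, 0 < d & forall q, boundary Ei q -> enorm (q - p) < d -> closure Om q.
Proof.
move=> bp cp; have [T [T0 _ gr]] := curve_point curve_i bp.
have [n [n1 nT]] := unit_normal T0.
have [phi [d [K [d0 phi0 lip _ grE]]]] := gr n (1 / 2) n1 nT ltac:(lra).
have [d1 d10 h1] := inner_far bp.
have [c c0 [cd cd1]] := min2 d0 d10.
have lip1 s : `|s| < c -> `|phi s| <= `|s|.
  move=> sc; have := lip s 0; rewrite phi0 !subr0 normr0 => /(_ ltac:(lra) d0).
  by have := normr_ge0 s; lra.
have bg y : enorm (y - p) < c -> boundary Om y -> dotp (y - p) n = phi (dotp (y - p) (perp n)).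
  move=> yc by_; apply/grE; first lra.
  have [//|] := boundary_split by_; move=> /(boundary_open oEo) nE.
  by case: nE; apply: h1; lra.
have [z Oz zc] := (closure_enorm Om p).1 cp (c / 4) ltac:(by rewrite divr_gt0).
have nz : dotp (z - p) n <> phi (dotp (z - p) (perp n)).
  by move=> E; have /OmE[_] := Oz; apply; apply: (((grE z ltac:(lra)).2 E)).1.
have nn := unit_enorm n1.
have tri q t : 0 < t -> enorm (q - p) < c / 8 -> t < c / 8 ->
   enorm (q + t *: n - p) < c / 4 /\ enorm (q - t *: n - p) < c / 4.
  by move=> t0 qp tc; split; rewrite addrAC (le_lt_trans (enormD _ _))// ?enormN enormZ nn mulr1 gtr0_norm//; lra.
exists (c / 8); first by rewrite divr_gt0.
move=> q bq qp; apply/closure_enorm => e e0.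
have [t t0 [te tc]] := min2 e0 (divr_gt0 c0 (ltr0n _ 8)).
have gq := (grE q ltac:(lra)).1 bq; have [t1 t2] := tri q t t0 qp tc.
have [zb|za|//] := ltgtP (dotp (z - p) n) (phi (dotp (z - p) (perp n))).
  exists (q - t *: n); last by rewrite addlK enormN enormZ nn mulr1 gtr0_norm.
  apply: (one_side Om_open n1 lip1 bg zc t2 zb _ Oz).
  by rewrite /below addrAC !(dotpDl (q - p)) !dotpNl !dotpZl n1 dotp_perp mulr0 subr0 mulr1 gq gtrDl oppr_lt0.
exists (q + t *: n); last by rewrite addlK enormZ nn mulr1 gtr0_norm.
apply: (other_side Om_open n1 lip1 bg zc t1 za _ Oz).
by rewrite addrAC !(dotpDl (q - p)) !dotpZl n1 dotp_perp mulr0 addr0 mulr1 gq ltrDl.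
Qed.

(** A closed curve is connected. *)
Lemma curve_propagate (S : set (plane R)) (Q : plane R -> Prop) p q :
  simple_closed_smooth_curve S -> S p -> S q ->
  (forall x, S x -> Q x -> exists2 d, 0 < d & forall y, S y -> enorm (y - x) < d -> Q y) ->
  (forall x, S x -> (forall d, 0 < d -> exists y, [/\ S y, enorm (y - x) < d & Q y]) -> Q x) ->
  Q p -> Q q.
Proof.
move=> [c [smooth regular per inj <-]] [t0 _ <-] [t1 _ <-] Qo Qc Q0.
pose C r := c (t0 + r * (t1 - t0)).
have contC r d : 0 < d -> exists2 e : R, 0 < e & forall s, `|s - r| < e -> enorm (C s - C r) < d.
  move=> d0; have [e e0 he] := @curve_continuous R c smooth (t0 + r * (t1 - t0)) d d0.
  have N0 : 0 < `|t1 - t0| + 1 by rewrite ltr_wpDl.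
  exists (e / (`|t1 - t0| + 1)); first by rewrite divr_gt0.
  move=> s; rewrite ltr_pdivlMr// => sr; apply: he.
  rewrite opprD addrACA subrr add0r -mulrBl normrM; apply: le_lt_trans sr.
  by rewrite ler_wpM2l// lerDl.
suff H r : 0 <= r <= 1 -> Q (C r) by have := H 1; rewrite /C mul1r (addrC t0) subrK ler01 lexx; apply.
move: r; apply: (@unit_interval_induction R (fun r => Q (C r))).
- by rewrite /C mul0r addr0.
- move=> r r01 Qr; have [d d0 hd] := Qo _ (ex_intro2 _ _ _ Logic.I erefl) Qr.
  have [e e0 he] := contC r d d0; exists e => // s s01 /he; apply: hd.
  by exists (t0 + s * (t1 - t0)).
- move=> r r01 H; apply: Qc; first by exists (t0 + r * (t1 - t0)).
  move=> d d0; have [e e0 he] := contC r d d0; have [s [s01 sr Qs]] := H e e0.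
  by exists (C s); split; [exists (t0 + s * (t1 - t0))|exact: he|].
Qed.

Lemma closureEi_proper : exists x, ~ closure Ei x.
Proof.
have [r hr] := (bounded_enorm Eo).1 bEo.
exists ((`|r| + 1) *: delta_mx ord0 0) => /EiEo /hr.
rewrite enormZ enorm_delta mulr1 ger0_norm ?addr_ge0//; have := ler_norm r; lra.
Qed.

(** Some point of the inner curve is in the closure of [Om]; otherwise the
    closure of [Ei] would be open as well as closed.  By [inner_spread] this
    propagates along the curve. *)
Lemma inner_closure q : boundary Ei q -> closure Om q.
Proof.
move=> bq; have [p [bp cp]] : exists p, boundary Ei p /\ closure Om p.
  apply: contrapT => none.
  have [x0 Ex0] : Ei !=set0 by case: hEi.
  have [y ny] := closureEi_proper; apply: ny.
  apply: (@segment_propagate _ (closure Ei) x0 y); first exact: subset_closure.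
  - move=> t t01; move: (x0 + _) => x cx.
    have : exists2 d, 0 < d & forall z, enorm (z - x) < d -> closure Ei z.
      have [Ex|nEx] := pselect (Ei x).
        by have [d d0 hd] := openE_enorm oEi Ex; exists d => // z /hd; exact: subset_closure.
      have bx : boundary Ei x by split=> // /interior_subset.
      have nc : ~ closure Om x by move=> cO; apply: none; exists x.
      have [d1 d10 h1] := not_closure nc; have [d2 d20 h2] := inner_far bx.
      have [d d0 [dd1 dd2]] := min2 d10 d20; exists d => // z zd.
      apply: contrapT => nz; apply: (h1 z); first lra.
      by apply/subset_closure/OmE; split=> //; apply: h2; lra.
    by move=> [d d0 hd]; exists d => // t' _ /hd.
  - move=> t t01; move: (x0 + _) => x H; apply/closure_enorm => d d0.
    have [z zd cz] := H (d / 2) ltac:(by rewrite divr_gt0).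
    have [w Ew wd] := (closure_enorm Ei z).1 cz (d / 2) ltac:(by rewrite divr_gt0).
    by exists w => //; have := enorm_tri z w x; lra.
apply: (curve_propagate curve_i bp bq _ _ cp).
- exact: inner_spread.
- move=> x bx H; apply/closure_enorm => d d0.
  have [z [_ zd cz]] := H (d / 2) ltac:(by rewrite divr_gt0).
  have [w Ow wd] := (closure_enorm Om z).1 cz (d / 2) ltac:(by rewrite divr_gt0).
  by exists w => //; have := enorm_tri z w x; lra.
Qed.

Lemma inner_boundary p : boundary Ei p -> boundary Om p.
Proof.
move=> bp; split; first exact: inner_closure.
by move=> /interior_subset /OmE[_]; apply; exact: bp.1.
Qed.

Lemma nu_unit p : boundary Om p -> dotp (nu p) (nu p) = 1.
Proof. by move=> /hnu[/enorm_unit]. Qed.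

(** The boundary is locally a graph orthogonal to [nu p].  Since [nu p]
    points outside, the upper side of the graph does not meet [Om]; hence [Om]
    is the lower side. *)
Lemma Om_chart p : boundary Om p -> forall eta, 0 < eta -> chart Om p (nu p) eta.
Proof.
move=> bp eta eta0; have n1 := nu_unit bp; have [_ ntan nout] := hnu bp.
have [S [cS Sp SO SE [d1 d10 h1]]] := local_curve bp.
have SB : S `<=` boundary Om.
  by move=> y; case: SE => ->; [exact: inner_boundary|exact: outer_boundary].
have [T [T0 tanT gr]] := curve_point cS Sp.
have nT : dotp (nu p) T = 0 by apply: ntan; exact: tanT.
pose eta' := Num.min eta 1.
have eta'0 : 0 < eta' by rewrite lt_min eta0 ltr01.
have [e1 e2] : eta' <= eta /\ eta' <= 1 by rewrite /eta'; split; rewrite ge_min lexx ?orbT.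
have [phi [d [K [d0 phi0 lip quad grE]]]] := gr (nu p) eta' n1 nT eta'0.
have [c c0 [cd cd1]] := min2 d0 d10.
have lip1 s : `|s| < c -> `|phi s| <= `|s|.
  move=> sc; have := lip s 0; rewrite phi0 !subr0 normr0 => /(_ ltac:(lra) d0).
  by have := normr_ge0 s => ? /le_trans; apply; rewrite ler_piMl.
set n := nu p in n1 nT nout grE *.
have bE y : enorm (y - p) < c -> (boundary Om y <-> dotp (y - p) n = phi (dotp (y - p) (perp n))).
  move=> yc; split; first by move=> by_; apply/grE; [lra|apply: h1 => //; lra].
  by move=> /grE H; apply/SB/H; lra.
have bg y : enorm (y - p) < c -> boundary Om y -> dotp (y - p) n = phi (dotp (y - p) (perp n)).
  by move=> /bE[].
have nn := unit_enorm n1.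
have above y : enorm (y - p) < c / 4 -> phi (dotp (y - p) (perp n)) < dotp (y - p) n -> ~ Om y.
  move=> yc ya Oy; move: nout; rewrite near_withinE => /nbhs_ballP[e /= e0 he].
  have [t t0 [te tc]] := min2 e0 (divr_gt0 c0 (ltr0n _ 4)).
  apply: (he t) => //; first by rewrite /ball /= sub0r normrN gtr0_norm.
  apply: (other_side Om_open n1 lip1 bg yc _ ya _ Oy).
    by rewrite addlK enormZ nn mulr1 gtr0_norm.
  by rewrite addlK !dotpZl n1 dotp_perp mulr0 phi0 mulr1.
have [z Oz zc] := (closure_enorm Om p).1 bp.1 (c / 4) ltac:(by rewrite divr_gt0).
have sides y : enorm (y - p) < c / 4 -> Om y -> below phi p n y.
  move=> yc Oy; have [//|ya|E] := ltgtP (dotp (y - p) n) (phi (dotp (y - p) (perp n))).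
    by have := above y yc ya Oy.
  by have /(bE y (lt_trans yc (quarter_lt c0))) /(boundary_open Om_open) := E.
have c4d : c / 4 < d := lt_trans (quarter_lt c0) cd.
exists phi, (c / 4), K; split => //.
- by rewrite divr_gt0.
- move=> s s' sc sc'; have scd := lt_trans sc c4d; have sc'd := lt_trans sc' c4d.
  by rewrite (le_trans (lip s s' scd sc'd))// ler_wpM2r.
- by move=> s sc; exact: quad (lt_trans sc c4d).
- move=> y yc; split; last exact: bE (lt_trans yc (quarter_lt c0)).
  split; first exact: sides.
  by move=> yb; apply: (one_side Om_open n1 lip1 bg zc yc (sides z zc Oz) yb Oz).
Qed.

Definition vext x := if `[< closure Ei x >] then b - a else if `[< Eo x >] then b - u x else 0.

Lemma vext_in x : closure Ei x -> vext x = b - a.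
Proof. by move=> cx; rewrite /vext; case: asboolP. Qed.
Lemma vext_out x : ~ Eo x -> vext x = 0.
Proof.
move=> nx; rewrite /vext; case: asboolP => [/EiEo //|_]; by case: asboolP.
Qed.
Lemma vext_closure x : closure Om x -> vext x = b - u x.
Proof.
move=> /(closure_boundary x Om_open)[/OmE[Ex nx]|/boundary_split[bx|bx]].
- by rewrite /vext; case: asboolP => // _; case: asboolP.
- by rewrite vext_in ?(bc_i bx).1//; exact: bx.1.
- by rewrite vext_out ?(bc_o bx).1 ?subrr//; exact: boundary_open oEo bx.
Qed.

Lemma cover x : [\/ closure Ei x, ~ Eo x | closure Om x].
Proof.
have [cx|nx] := pselect (closure Ei x); first by apply: Or31.
have [Ex|nEx] := pselect (Eo x); last by apply: Or32.
by apply: Or33; apply/subset_closure/OmE.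
Qed.

Lemma vext_continuous : continuous vext.
Proof.
move=> x; apply: enorm_continuous => e e0.
have piece (F : set (plane R)) : closed F ->
    (F x -> exists2 d, 0 < d & forall y, F y -> enorm (y - x) < d -> `|vext y - vext x| < e) ->
    exists2 d, 0 < d & forall y, F y -> enorm (y - x) < d -> `|vext y - vext x| < e.
  move=> cF H; have [Fx|nFx] := pselect (F x); first exact: H.
  have nc : ~ closure F x by rewrite -(closure_id F).1.
  have [d d0 hd] := not_closure nc; exists d => // y Fy yd; exfalso.
  by apply: (hd y yd); exact: subset_closure.
have [d1 d10 h1] : exists2 d, 0 < d & forall y, closure Ei y -> enorm (y - x) < d -> `|vext y - vext x| < e.
  apply: piece; first exact: closed_closure.
  by move=> cx; exists 1 => // y cy _; rewrite !vext_in// subrr normr0.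
have [d2 d20 h2] : exists2 d, 0 < d & forall y, (~` Eo) y -> enorm (y - x) < d -> `|vext y - vext x| < e.
  apply: piece; first exact: open_closedC.
  by move=> cx; exists 1 => // y cy _; rewrite !vext_out// subrr normr0.
have [d3 d30 h3] : exists2 d, 0 < d & forall y, closure Om y -> enorm (y - x) < d -> `|vext y - vext x| < e.
  apply: piece; first exact: closed_closure.
  move=> cx; have [d d0 hd] := within_enorm smooth_u.1 cx e0; exists d => // y cy /(hd y cy).
  by rewrite !vext_closure// distrC; rewrite (_ : b - u y - _ = u x - u y)//; ring.
have [c c0 [c1 c2]] := min2 d10 d20; have [c' c'0 [c'c c'3]] := min2 c0 d30.
exists c' => // y yc; have [cy|cy|cy] := cover y.
- by apply: h1 => //; lra.
- by apply: h2 => //; lra.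
- by apply: h3 => //; lra.
Qed.

Let M := b - a.
Let M0 : 0 < M. Proof. by rewrite subr_gt0. Qed.

Lemma mid_vext : mid vext M = Om.
Proof.
apply/seteqP; split => x.
  rewrite /mid /= => /andP[v0 vM]; apply/OmE; split.
    by apply: contrapT => nx; move: v0; rewrite vext_out// ltxx.
  by move=> cx; move: vM; rewrite vext_in// ltxx.
move=> Ox; have /andP[u1 u2] := range_u Ox.
by rewrite /mid /= vext_closure; [apply/andP; rewrite /M; split; lra|exact: subset_closure].
Qed.

Lemma vext_range x : 0 <= vext x <= M.
Proof.
have [cx|cx|cx] := cover x.
- by rewrite vext_in// lexx ltW.
- by rewrite vext_out// lexx ltW.
have [Ox|bx] := (closure_boundary x Om_open).1 cx.
  by have /andP[v0 vM] : mid vext M x by [rewrite mid_vext]; rewrite !ltW.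
have [bi|bo] := boundary_split bx.
- by rewrite vext_in ?lexx ?ltW//; exact: bi.1.
- by rewrite vext_out ?lexx ?ltW//; exact: boundary_open oEo bo.
Qed.

Lemma is_derive_near (f f' : plane R -> R) x w r d : 0 < d ->
  (forall y, enorm (y - x) < d -> f y = f' y) -> is_derive x w f r -> is_derive x w f' r.
Proof.
move=> d0 ff /is_deriveP H; apply/is_deriveP => e /H[d' d'0 hd].
have N0 : 0 < enorm w + 1 by rewrite ltr_wpDl ?enorm_ge0.
exists (Num.min d' (d / (enorm w + 1))); first by rewrite lt_min d'0 divr_gt0.
move=> t; rewrite lt_min => /andP[td' ]; rewrite ltr_pdivlMr// => td.
rewrite -!ff ?subrr ?enorm0//; first exact: hd.
rewrite addlK enormZ; apply: le_lt_trans td; by rewrite ler_wpM2l// lerDl.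
Qed.

(** The gradient and the Hessian are read off the continuous extensions of the
    partial derivatives of [u]. *)
Lemma vext_C2 : exists g h, C2bar Om vext g h /\ forall x, Om x -> h 0 0 x + h 1 1 x = 2.
Proof.
have [gs hgs] := choice (fun s : seq 'I_2 => (smooth_u.2 s).2).
have cg (s : seq 'I_2) : {within closure Om, continuous (fun x => - gs s x)}.
  by have := within_opp (a := 0) (hgs s).1; under eq_fun do rewrite sub0r.
have dgs (s : seq 'I_2) i x : Om x -> is_derive x (delta_mx ord0 i) (fun y => - gs s y) (- gs (i :: s) x).
  move=> Ox; have [d d0 hd] := openE_enorm Om_open Ox.
  have D : is_derive x (delta_mx ord0 i) (iter_pderiv s u) (gs (i :: s) x).
    by rewrite (hgs (i :: s)).2//; apply: derivableP; exact: (smooth_u.2 s).1.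
  apply: (is_derive_near d0 (f := fun y => - iter_pderiv s u y)).
  by move=> y /hd Oy; rewrite (hgs s).2.
exists (fun i x => - gs [:: i] x), (fun i j x => - gs [:: j; i] x); split.
  split; last first.
    by move=> i; split; [exact: cg|by move=> j; exact: cg|move=> j x; exact: dgs].
  split; [by apply: continuous_subspaceT; exact: vext_continuous|by move=> j; exact: cg|].
  move=> i x Ox; have [d d0 hd] := openE_enorm Om_open Ox.
  apply: (is_derive_near d0 (f := fun y => b - u y)).
    by move=> y /hd Oy; rewrite vext_closure//; exact: subset_closure.
  rewrite -[- _]sub0r (hgs [:: i]).2//; apply: is_deriveB.
  by apply: derivableP; exact: (smooth_u.2 [::]).1.
move=> x Ox; have := pde Ox; rewrite /laplacian big_ord_recl big_ord1.
rewrite (_ : lift ord0 ord0 = 1); last exact/val_inj.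
by rewrite !(hgs _).2//= => E; rewrite -opprD E opprK.
Qed.

Lemma vext_boundary_const p : boundary Om p -> exists2 d, 0 < d &
  forall y, boundary Om y -> enorm (y - p) < d -> vext y = vext p.
Proof.
move=> bp; have [bi|bo] := boundary_split bp.
  have [d d0 hd] := inner_far bi; exists d => // y by_ /hd Ey.
  have [biy|/(boundary_open oEo)//] := boundary_split by_.
  by rewrite !vext_in//; [exact: bi.1|exact: biy.1].
have [d d0 hd] := outer_far bo; exists d => // y by_ /hd Ey.
have [[/Ey]//|boy] := boundary_split by_.
by rewrite !vext_out//; exact: boundary_open oEo _.
Qed.

Definition gamext s := if s == 0 then beta else alpha.

Lemma normal_data p : boundary Om p -> normal_derivative_is u p (nu p) (gamext (vext p)).
Proof.
move=> /boundary_split[bi|bo].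
  by rewrite vext_in /gamext ?subr_eq0 ?gt_eqF//; [exact: (bc_i bi).2|exact: bi.1].
rewrite vext_out /gamext ?eqxx; first exact: (bc_o bo).2.
exact: boundary_open oEo bo.
Qed.

(** The tangential derivative vanishes since [vext] is constant on each curve;
    the normal derivative is the prescribed one, up to sign. *)
Lemma vext_grad g p w : C1bar Om vext g -> boundary Om p ->
  grad_dot g p w = - gamext (vext p) * dotp (nu p) w.
Proof.
move=> C1 bp; have n1 := nu_unit bp; have ch := Om_chart bp (ltac:(lra) : 0 < 1 / 2 :> R).
set n := nu p in n1 ch *; have nn := unit_enorm n1.
have T0 : grad_dot g p (perp n) = 0.
  apply: (tangential_max Om_open n1 C1 bp ch).
  by have [d d0 hd] := vext_boundary_const bp; exists d => // y by_ yd; rewrite (hd y by_ yd).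
have N0 : grad_dot g p n = - gamext (vext p).
  have := normal_data bp; move: (gamext _) => gm nd.
  apply/eqP; rewrite -subr_eq0; apply/eqP/norm_small_eq0 => e e0; rewrite opprK.
  have e2 : 0 < e / 2 by rewrite divr_gt0.
  have [d1 d10 h1] := boundary_derivative Om_open n1 C1 bp.1 ch e2.
  have [d2 d20 h2] := chart_inside ch (w := - n) ltac:(by rewrite dotpNl n1; lra).
  move: nd; rewrite /normal_derivative_is => /cvgrPdist_lt/(_ _ e2).
  rewrite near_withinE => /nbhs_ballP[d3 /= d30 h3].
  have [c c0 [c1 c2]] := min2 d10 d20; have [t t0 [tc t3]] := min2 c0 d30.
  have Ot : Om (p - t *: n) by rewrite -scalerN; apply: h2; rewrite t0; lra.
  have tn : enorm (p - t *: n - p) = t by rewrite addlK enormN enormZ nn mulr1 gtr0_norm.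
  have := h1 _ (subset_closure Ot); rewrite tn => /(_ ltac:(lra)).
  rewrite !vext_closure; [|exact: bp.1|exact: subset_closure].
  rewrite addlK grad_dotN grad_dotZ opprK.
  have := h3 t; rewrite /ball /= sub0r normrN gtr0_norm// => /(_ t3 t0); rewrite -/n.
  set G := grad_dot g p n; set U := u p - u (p - t *: n).
  rewrite (_ : b - u (p - t *: n) - (b - u p) = U); last by rewrite /U; ring.
  have tt : U = U / t * t by rewrite divfK// lt0r_neq0.
  rewrite {2}tt (_ : U / t * t + t * G = (U / t + G) * t); last ring.
  rewrite normrM (gtr0_norm t0) ler_pM2r//.
  move: (U / t) => A; rewrite ltr_norml !ler_norml => /andP[? ?] /andP[? ?].
  by apply/andP; split; lra.
rewrite (frameE w n1) grad_dotD !grad_dotZ T0 N0 mulr0 addr0 dotpDr !dotpZr n1 dotp_perp.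
by ring.
Qed.

(** Near a boundary point [Om] is the region below a graph, so a
    component of [Om] contains all of it or nothing. *)
Lemma near_boundary_connected (S : set (plane R)) p : open S ->
  (forall x, Om x -> closure S x -> S x) -> boundary Om p ->
  exists2 d, 0 < d & forall y y', enorm (y - p) < d -> enorm (y' - p) < d ->
    Om y -> Om y' -> S y -> S y'.
Proof.
move=> oS cS bp; have n1 := nu_unit bp.
have [phi [d [K [d0 phi0 lip _ ch]]]] := Om_chart bp (ltr01 : 0 < 1 :> R).
have lip1 s : `|s| < d -> `|phi s| <= `|s|.
  by move=> sc; have := lip s 0 sc; rewrite phi0 !subr0 normr0 mul1r; apply.
exists (d / 4); first by rewrite divr_gt0.
have d4 := quarter_lt d0; move=> y y' yd yd' /(ch y (lt_trans yd d4)).1 yb /(ch y' (lt_trans yd' d4)).1 yb'.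
apply: (below_propagate n1 lip1 _ yd yd' yb yb').
move=> x x' H; apply: (segment_clopen oS cS) => r r01.
by have [xd xb] := H r r01; apply: (ch _ xd).1.2.
Qed.

(** Since the Laplacian of [vext] is positive, its maximum over the closure
    of a component is at the boundary; as [vext] is positive in the component, this
    point is not on the outer curve. *)
Lemma reaches_inner (S : set (plane R)) : open S -> S !=set0 -> S `<=` Om ->
  (forall x, Om x -> closure S x -> S x) -> exists2 p, boundary Ei p & closure S p.
Proof.
move=> oS [x0 Sx0] SO cS; apply: contrapT => none.
have [g [h [C2 tr]]] := vext_C2.
have [r hr] := (bounded_enorm Eo).1 bEo.
have cK : compact (closure S).
  apply: (@compact_cball _ _ 0 (r + 1)); first exact: closed_closure.
  move=> y /closure_enorm/(_ 1 ltr01)[z /SO/OmE[/hr zr _] zy].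
  by rewrite (le_trans (enorm_tri z _ _))// enormC subr0; lra.
have E1 : dotp (delta_mx ord0 0 : plane R) (delta_mx ord0 0) = 1 by exact/enorm_unit/enorm_delta.
have cf : {within closure S, continuous (fun x => -1 * vext x)}.
  apply: continuous_subspaceT.
  exact: (continuous_mul (@continuous_const R (-1)) vext_continuous).
have := weak_min E1 cK cf; move=> /(_ _ x0 (subset_closure Sx0)) H.
have vx0 : 0 < vext x0 by have : mid vext M x0 by [rewrite mid_vext; exact: SO]; move=> /andP[].
suff : 0 <= -1 * vext x0 by lra.
apply: H => x cx fx.
have Ox : Om x.
  have cO : closure Om x by apply: closure_subset cx.
  have [//|bx] := (closure_boundary x Om_open).1 cO.
  have [bi|bo] := boundary_split bx; first by case: none; exists x.
  by move: fx; rewrite vext_out ?mulr0 ?ltxx//; exact: boundary_open oEo bo.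
have Sx := cS x Ox cx; split.
  by have [d d0 hd] := openE_enorm oS Sx; exists d => // y /hd; exact: subset_closure.
exists (- 2); first lra.
exists (-1 * hess h x (delta_mx ord0 0) (delta_mx ord0 0)),
  (-1 * hess h x (perp (delta_mx ord0 0)) (perp (delta_mx ord0 0))); split.
- by apply: is_derive2Z; exact: C2bar_derive2 Om_open C2 Ox.
- by apply: is_derive2Z; exact: C2bar_derive2 Om_open C2 Ox.
- by have := hess_trace h x E1; rewrite tr//; lra.
Qed.

(** The closure of a component meets the inner curve in a set that is open in
    it by [near_boundary_connected], and closed. *)
Lemma covers_inner (S : set (plane R)) q : open S -> S !=set0 -> S `<=` Om ->
  (forall x, Om x -> closure S x -> S x) -> boundary Ei q -> closure S q.
Proof.
move=> oS S0 SO cS bq; have [p bp cp] := reaches_inner oS S0 SO cS.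
apply: (curve_propagate curve_i bp bq _ _ cp).
- move=> x bx cx; have [d d0 hd] := near_boundary_connected oS cS (inner_boundary bx).
  exists (d / 2); first by rewrite divr_gt0.
  move=> y by_ yd; apply/closure_enorm => e e0.
  have [c c0 [ce cd]] := min2 e0 (divr_gt0 d0 (ltr0n _ 2)).
  have [z Oz zc] := (closure_enorm Om y).1 (inner_closure by_) c c0.
  have [z' Sz' zd'] := (closure_enorm S x).1 cx d d0.
  exists z; last lra; apply: (hd z' z) => //; last exact: SO.
  by have := enorm_tri y z x; lra.
- move=> x bx H; apply/closure_enorm => d d0.
  have [z [_ zd cz]] := H (d / 2) ltac:(by rewrite divr_gt0).
  have [w Ow wd] := (closure_enorm S z).1 cz (d / 2) ltac:(by rewrite divr_gt0).
  by exists w => //; have := enorm_tri z w x; lra.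
Qed.

(** Two components would have a common limit point on the inner curve, near
    which [Om] is in a single component. *)
Lemma Om_connected (S : set (plane R)) : open S -> S !=set0 -> S `<=` Om ->
  (forall x, Om x -> closure S x -> S x) -> Om `<=` S.
Proof.
move=> oS S0 SO cS x Ox; apply: contrapT => nS.
pose S2 := Om `&` ~` closure S.
have oS2 : open S2 by apply: openI; [exact: Om_open|apply: closed_openC; exact: closed_closure].
have S2O : S2 `<=` Om by move=> y [].
have S20 : S2 !=set0 by exists x; split=> // /(cS x Ox).
have cS2 z : Om z -> closure S2 z -> S2 z.
  move=> Oz cz; split=> // /(cS z Oz) Sz.
  have [d d0 hd] := openE_enorm oS Sz; have [y [_ ny] yd] := (closure_enorm S2 z).1 cz d d0.
  by apply: ny; apply: subset_closure; exact: hd.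
have [p bp cp] := reaches_inner oS S0 SO cS.
have cp2 := covers_inner oS2 S20 S2O cS2 bp.
have [d d0 hd] := near_boundary_connected oS cS (inner_boundary bp).
have [y Sy yd] := (closure_enorm S p).1 cp d d0.
have [z [Oz nz] zd] := (closure_enorm S2 p).1 cp2 d d0.
by apply: nz; apply: subset_closure; apply: (hd y z) => //; exact: SO.
Qed.

Lemma vext_solution : exists g h, solution vext M 2 g h nu gamext.
Proof.
have [g [h [C2 tr]]] := vext_C2; exists g, h; split; rewrite ?mid_vext //.
- exact: vext_continuous.
- exact: vext_range.
- exact: nu_unit.
- exact: Om_chart.
- by move=> p bp w; apply: vext_grad => //; exact: C2.1.
- exact: Om_connected.
Qed.

(** By monotonicity in the distance to [c], the level sets of [vext] are
    discs.  The set [M <= vext] is compact and contains [Ei], so its radius [ri] is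
    attained and positive; the set [0 < vext] is open and bounded. *)
Lemma annulus_conclusion : exists (x0 : plane R) (ri ro : R),
    [/\ 0 < ri < ro,
        Om = annulus x0 ri ro,
        forall x y, Om x -> Om y ->
          enorm (x - x0) = enorm (y - x0) -> u x = u y &
        forall x, Om x -> 0 < radial_derivative x0 u x].
Proof.
have [g [h sol]] := vext_solution.
have [r hr] := (bounded_enorm Eo).1 bEo.
have vpos x : 0 < vext x -> Eo x by move=> v0; apply: contrapT => nx; move: v0; rewrite vext_out// ltxx.
have vB x : 0 < vext x -> enorm x <= r by move=> /vpos /hr.
have [z Ez] : Ei !=set0 by case: hEi.
have vz : vext z = M by rewrite vext_in//; exact: subset_closure.
have vz0 : 0 < vext z by rewrite vz.
have [c [rad [dec grad]]] := radial_symmetry sol vB vz0.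
have MidE x : Om x <-> 0 < vext x < M by rewrite -[in X in X <-> _]mid_vext.
have cv : continuous vext := vext_continuous.
have vM x : vext x <= M by have /andP[] := vext_range x.
pose P := [set x | M <= vext x].
have cP : compact P.
  apply: (@compact_cball _ _ 0 r); first exact: closed_ge_cont.
  by move=> x /= Px; rewrite subr0; apply: vB; exact: lt_le_trans M0 Px.
have Pz : P z by rewrite /P /= vz.
have [w /set_mem Pw wmax] := EVT_max_rV (ex_intro _ z Pz) cP (continuous_subspaceT (@sqdist_continuous _ c)).
pose ri := enorm (w - c).
have inP x : M <= vext x <-> enorm (x - c) <= ri.
  split=> [Px|xr]; last exact: le_trans Pw (dec _ _ xr).
  by rewrite enorm_le ?enorm_ge0// enorm_sq; apply: wmax; exact/mem_set.
pose Q := [set s | exists2 x, 0 < vext x & enorm (x - c) = s].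
have hQ : has_sup Q.
  split; first by exists (enorm (z - c)), z.
  by exists (r + enorm c) => s [x /vB xr <-]; rewrite (le_trans (enormD _ _))// enormN lerD2r.
pose ro := sup Q.
have inQ x : 0 < vext x <-> enorm (x - c) < ro.
  split=> [vx|xr]; last first.
    by have [s [y vy <-] xy] := sup_gt (proj1 hQ) xr; apply: lt_le_trans vy (dec _ _ (ltW xy)).
  have [d d0 hd] := cont_gt (cv x) vx.
  (* 0 < vext x also holds a little further from c, so ro is not attained *)
  have [e [e1 xe]] : exists e, dotp e e = 1 /\ 0 <= dotp (x - c) e.
    pose e0 : plane R := delta_mx ord0 0.
    have e01 : dotp e0 e0 = 1 by exact/enorm_unit/enorm_delta.
    have [xe|xe] := leP 0 (dotp (x - c) e0); first by exists e0.
    by exists (- e0); rewrite !dotpNr dotpNl e01 opprK; split=> //; lra.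
  pose y := x + (d / 2) *: e.
  have vy : 0 < vext y by apply: hd; rewrite /y addlK enormZ (unit_enorm e1) mulr1 gtr0_norm; lra.
  have yc : enorm (x - c) < enorm (y - c).
    rewrite enorm_gt ?enorm_ge0// enorm_sq /y addrAC; move: (x - c) xe => q xe.
    by rewrite !dotpl e1 (dotpC e); nra.
  by apply: (lt_le_trans yc); apply: ub_le_sup; [case: hQ|exists y].
have OmA x : Om x <-> ri < enorm (x - c) < ro.
  apply: (iff_trans (MidE x)); split => /andP[h1 h2]; apply/andP; split.
  - by rewrite ltNge; apply/negP => /inP; rewrite leNgt h2.
  - exact/inQ.
  - exact/inQ.
  - by rewrite ltNge; apply/negP => /inP; rewrite leNgt h1.
exists c, ri, ro; split.
- apply/andP; split; last by apply/inQ; exact: lt_le_trans M0 Pw.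
  rewrite lt_neqAle enorm_ge0 andbT eq_sym; apply/eqP => ri0.
  have [d d0 hd] := openE_enorm oEi Ez.
  (* an open set does not reduce to a point *)
  have disc y : Ei y -> y = c.
    move=> Ey; have : M <= vext y by rewrite vext_in//; exact: subset_closure.
    move=> /inP; rewrite ri0 => yc; apply/eqP; rewrite -subr_eq0; apply/eqP/enorm_eq0.
    by apply/eqP; rewrite eq_le yc enorm_ge0.
  have zc := disc z Ez.
  have Ez' : Ei (z + (d / 2) *: delta_mx ord0 0).
    by apply: hd; rewrite addlK enormZ enorm_delta mulr1 gtr0_norm; lra.
  have E : enorm ((d / 2) *: delta_mx ord0 0 : plane R) = 0.
    by rewrite -(addlK z ((d / 2) *: delta_mx ord0 0)) (disc _ Ez') zc subrr enorm0.
  by move: E; rewrite enormZ enorm_delta mulr1 gtr0_norm; lra.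
- by apply/seteqP; split => x /=; rewrite /annulus /= => /OmA.
- move=> x y Ox Oy xy; have := rad x y xy.
  by rewrite !vext_closure; [lra|exact: subset_closure|exact: subset_closure].
- move=> x Ox; rewrite /radial_derivative; have /OmA/andP[xr _] := Ox.
  have xc : 0 < enorm (x - c) by apply: le_lt_trans xr; exact: enorm_ge0.
  set e := _ *: _.
  have e1 : dotp e e = 1 by rewrite /e dotpZl dotpZr -enorm_sq; field; exact: lt0r_neq0.
  have xe : 0 < dotp (x - c) e.
    by rewrite /e dotpZr mulr_gt0 ?invr_gt0// -enorm_sq exprn_gt0.
  have Gx := grad x e _ e1 xe; rewrite mid_vext in Gx.
  have D := C1bar_derive e (mid_open sol) (sol_C2 sol).1; rewrite mid_vext in D.
  have [d d0 hd] := openE_enorm Om_open Ox.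
  have D' : is_derive x e u (0 - grad_dot g x e).
    apply: (is_derive_near d0 (f := fun y => b - vext y)).
    - by move=> y /hd Oy; rewrite vext_closure ?opprB ?(addrC b) ?subrK//; exact: subset_closure.
    - by have ? := D x Ox; apply: is_deriveB.
  by have [_ ->] := D'; have := Gx Ox; lra.
Qed.

End Assembly.

Theorem theorem1p2 (R : realType) (Ei Eo Om : set (plane R))
    (u : plane R -> R) (nu : plane R -> plane R) (a b alpha beta : R)
    (hEi : domain Ei) (hEo : domain Eo)
    (bEi : bounded_set Ei) (bEo : bounded_set Eo)
    (scEi : simply_connected Ei) (scEo : simply_connected Eo)
    (curve_i : simple_closed_smooth_curve (boundary Ei))
    (curve_o : simple_closed_smooth_curve (boundary Eo))
    (hEio : compactly_contained Ei Eo)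
    (hOm : Om = Eo `\` closure Ei)
    (smooth_u : smooth_up_to_boundary Om u)
    (hnu : forall x, boundary Om x -> outer_unit_normal Om x (nu x))
    (pde : forall x, Om x -> laplacian u x = - 2)
    (bc_i : forall x, boundary Ei x ->
       u x = a /\ normal_derivative_is u x (nu x) alpha)
    (bc_o : forall x, boundary Eo x ->
       u x = b /\ normal_derivative_is u x (nu x) beta)
    (lt_ab : a < b)
    (range_u : forall x, Om x -> a < u x < b) :
  exists (x0 : plane R) (ri ro : R),
    [/\ 0 < ri < ro,
        Om = annulus x0 ri ro,
        forall x y, Om x -> Om y ->
          enorm (x - x0) = enorm (y - x0) -> u x = u y &
        forall x, Om x -> 0 < radial_derivative x0 u x].
Proof.
exact: (annulus_conclusion hEi hEo bEo curve_i curve_o hEio hOm smooth_u hnu pde bc_i bc_o lt_ab range_u).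
Qed.
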